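(* Let $n\ge1$. Every nilpotent Lie subalgebra $\mathfrak l$ of $\hat{\mathcal X}(\mathbb C^n,0)$ has soluble length $l(\mathfrak l)\le n$. As a consequence, if $G<\widehat{\mathrm{Diff}}(\mathbb C^n,0)$ is a nilpotent group, then the soluble length of $G$ satisfies $l(G)\le n$.
   Context: $\widehat{\mathrm{Diff}}(\mathbb C^n,0)$ is the group (under composition) of formal diffeomorphisms of $\mathbb C^n$ fixing the origin ($n$-tuples of formal power series in $z=(z_1,\dots,z_n)$ without constant term and with invertible linear part). $\hat{\mathcal X}(\mathbb C^n,0)$ is the complex Lie algebra of formal vector fields $\sum\hat a_j\,\partial/\partial z_j$, $\hat a_j\in\mathbb C[[z_1,\dots,z_n]]$, vanishing at the origin. For a Lie algebra $\mathfrak g$: $\mathfrak g^{(0)}=\mathfrak g$, $\mathfrak g^{(m+1)}=[\mathfrak g^{(m)},\mathfrak g^{(m)}]$, and $l(\mathfrak g)=\min\{k\ge0:\mathfrak g^{(k)}=0\}$ ($\min\emptyset=\infty$); $\mathfrak g$ is nilpotent if its descending central series $\mathcal C^0\mathfrak g=\mathfrak g$, $\mathcal C^{m+1}\mathfrak g=[\mathfrak g,\mathcal C^m\mathfrak g]$ reaches $0$. For a group $G$: $G^{(0)}=G$, $G^{(m+1)}=[G^{(m)},G^{(m)}]$, $l(G)=\min\{k\ge0:G^{(k)}=\{\mathrm{Id}\}\}$; $G$ is nilpotent if its descending central series reaches $\{\mathrm{Id}\}$. *)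

(* Defs.v *)
From HB Require Import structures.
From mathcomp Require Import all_boot all_order all_algebra.
From mathcomp Require Import boolp classical_sets.
From mathcomp Require Import ring.
From mathcomp Require Import ssrcomplements mpoly.

Set Implicit Arguments.
Unset Strict Implicit.
Unset Printing Implicit Defensive.

Import GRing.Theory.
Local Open Scope ring_scope.

Section FormalPowerSeries.
Variables (K : fieldType) (n : nat).

Record fps := Fps { fps_coef :> 'X_{1..n} -> K }.

HB.instance Definition _ := [isNew for fps_coef].
HB.instance Definition _ := gen_eqMixin fps.
HB.instance Definition _ := gen_choiceMixin fps.

Implicit Types (a b c : fps) (m : 'X_{1..n}) (d : nat).

Lemma fpsP a b : a =1 b -> a = b.
Proof. by case: a b => [a] [b] /= /funext ->. Qed.

Definition fps_zero := Fps (fun=> 0).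
Definition fps_opp a := Fps (fun m => - a m).
Definition fps_add a b := Fps (fun m => a m + b m).

Fact fps_addA : associative fps_add.
Proof. by move=> a b c; apply: fpsP => m /=; rewrite addrA. Qed.
Fact fps_addC : commutative fps_add.
Proof. by move=> a b; apply: fpsP => m /=; rewrite addrC. Qed.
Fact fps_add0 : left_id fps_zero fps_add.
Proof. by move=> a; apply: fpsP => m /=; rewrite add0r. Qed.
Fact fps_addN : left_inverse fps_zero fps_opp fps_add.
Proof. by move=> a; apply: fpsP => m /=; rewrite addNr. Qed.
HB.instance Definition _ :=
  GRing.isZmodule.Build fps fps_addA fps_addC fps_add0 fps_addN.

Lemma fps0E m : (0 : fps) m = 0. Proof. by []. Qed.
Lemma fpsDE a b m : (a + b) m = a m + b m. Proof. by []. Qed.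
Lemma fpsNE a m : (- a) m = - a m. Proof. by []. Qed.
Lemma fpsBE a b m : (a - b) m = a m - b m. Proof. by []. Qed.
Lemma fps_sumE I (r : seq I) (P : pred I) (F : I -> fps) m :
  (\sum_(i <- r | P i) F i) m = \sum_(i <- r | P i) F i m.
Proof. exact: (big_morph (fun a : fps => a m)). Qed.

Definition fps_one := Fps (fun m => (m == 0%MM)%:R).

(* The Cauchy product; the same formula as [mcoeffM] for polynomials. *)
Definition fps_mul a b := Fps (fun m =>
  \sum_(k : 'X_{1..n < (mdeg m).+1, (mdeg m).+1} | m == (k.1 + k.2)%MM)
    a k.1 * b k.2).

(* Truncation below degree [d], used to import the ring laws from [mpoly]. *)
Definition fps_trunc d a : {mpoly K[n]} :=
  \sum_(m : 'X_{1..n < d}) a m *: 'X_[m].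

Lemma mcoeff_trunc d a m : (mdeg m < d)%N -> (fps_trunc d a)@_m = a m.
Proof.
move=> lt_md; rewrite /fps_trunc raddf_sum /= (bigD1 (BMultinom lt_md)) //=.
rewrite mcoeffZ mcoeffX eqxx mulr1 big1 ?addr0 // => k.
rewrite -val_eqE /= => /negPf nk.
by rewrite mcoeffZ mcoeffX nk mulr0.
Qed.

Lemma mdeg_add_lt d m m1 m2 : m = (m1 + m2)%MM -> (mdeg m < d)%N ->
  (mdeg m1 < d)%N /\ (mdeg m2 < d)%N.
Proof.
move=> ->; rewrite mdegD => lt_d.
by split; apply: leq_ltn_trans lt_d; rewrite ?leq_addr ?leq_addl.
Qed.

Lemma mpoly_mul_trunc d (p p' q q' : {mpoly K[n]}) :
  (forall m, (mdeg m < d)%N -> p@_m = p'@_m) ->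
  (forall m, (mdeg m < d)%N -> q@_m = q'@_m) ->
  forall m, (mdeg m < d)%N -> (p * q)@_m = (p' * q')@_m.
Proof.
move=> hp hq m lt_md; rewrite !mcoeffM; apply: eq_bigr => k /eqP def_m.
by have [lt1 lt2] := mdeg_add_lt def_m lt_md; rewrite hp ?hq.
Qed.

Lemma fps_mul_trunc d a b m : (mdeg m < d)%N ->
  fps_mul a b m = (fps_trunc d a * fps_trunc d b)@_m.
Proof.
move=> lt_md; rewrite mcoeffM /=; apply: eq_bigr => k /eqP def_m.
by have [lt1 lt2] := mdeg_add_lt def_m lt_md; rewrite !mcoeff_trunc.
Qed.

Fact fps_mulC : commutative fps_mul.
Proof.
by move=> a b; apply: fpsP => m;
  rewrite !(@fps_mul_trunc (mdeg m).+1) ?ltnSn // mulrC.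
Qed.
Fact fps_mulA : associative fps_mul.
Proof.
move=> a b c; apply: fpsP => m;
  rewrite !(@fps_mul_trunc (mdeg m).+1) ?ltnSn //.
set d := (mdeg m).+1; have ltmd : (mdeg m < d)%N by [].
pose t := fps_trunc d.
transitivity (t a * t b * t c)@_m.
  rewrite -mulrA; apply: mpoly_mul_trunc ltmd => // k ltkd.
  by rewrite mcoeff_trunc // (fps_mul_trunc _ _ ltkd).
apply: mpoly_mul_trunc ltmd => // k ltkd.
by rewrite mcoeff_trunc // (fps_mul_trunc _ _ ltkd).
Qed.
Fact fps_mul1 : left_id fps_one fps_mul.
Proof.
move=> a; apply: fpsP => m;
  rewrite !(@fps_mul_trunc (mdeg m).+1) ?ltnSn //.
set d := (mdeg m).+1; have ltmd : (mdeg m < d)%N by [].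
rewrite -[RHS](mcoeff_trunc a ltmd) -[in RHS](mul1r (fps_trunc d a)).
apply: mpoly_mul_trunc ltmd => // k ltkd.
by rewrite mcoeff_trunc //= mcoeff1.
Qed.
Fact fps_mulDl : left_distributive fps_mul +%R.
Proof.
move=> a b c; apply: fpsP => m /=; rewrite -big_split /=.
by apply: eq_bigr => k _; rewrite mulrDl.
Qed.
Fact fps_one_neq0 : fps_one != 0.
Proof.
apply/eqP => /(congr1 (fun a : fps => a 0%MM)) /= /eqP.
by rewrite eqxx oner_eq0.
Qed.
HB.instance Definition _ := GRing.Zmodule_isComNzRing.Build fps
  fps_mulA fps_mulC fps_mul1 fps_mulDl fps_one_neq0.

Definition fps_scale (x : K) a := Fps (fun m => x * a m).
Fact fps_scaleA x y a : fps_scale x (fps_scale y a) = fps_scale (x * y) a.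
Proof. by apply: fpsP => m /=; rewrite mulrA. Qed.
Fact fps_scale1 : left_id 1 fps_scale.
Proof. by move=> a; apply: fpsP => m /=; rewrite mul1r. Qed.
Fact fps_scaleDr : right_distributive fps_scale +%R.
Proof. by move=> x a b; apply: fpsP => m /=; rewrite mulrDr. Qed.
Fact fps_scaleDl a : {morph fps_scale^~ a : x y / x + y}.
Proof. by move=> x y; apply: fpsP => m /=; rewrite mulrDl. Qed.
HB.instance Definition _ := GRing.Zmodule_isLmodule.Build K fps
  fps_scaleA fps_scale1 fps_scaleDr fps_scaleDl.
Fact fps_scaleAl (x : K) (a b : fps) : x *: (a * b) = x *: a * b.
Proof.
apply: fpsP => m /=; rewrite mulr_sumr; apply: eq_bigr => k _.
by rewrite mulrA.
Qed.
HB.instance Definition _ := GRing.Lmodule_isLalgebra.Build K fps fps_scaleAl.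
HB.instance Definition _ := GRing.Lalgebra_isComAlgebra.Build K fps.

Lemma fpsZE x a m : (x *: a) m = x * a m. Proof. by []. Qed.
Lemma fps1E m : (1 : fps) m = (m == 0%MM)%:R. Proof. by []. Qed.

Lemma fpsME a b m : (a * b) m =
  \sum_(k : 'X_{1..n < (mdeg m).+1, (mdeg m).+1} | m == (k.1 + k.2)%MM)
    a k.1 * b k.2.
Proof. by []. Qed.

Definition fps_of_mpoly (p : {mpoly K[n]}) := Fps (fun m => p@_m).

Lemma fps_of_mpolyM (p q : {mpoly K[n]}) :
  fps_of_mpoly (p * q) = fps_of_mpoly p * fps_of_mpoly q.
Proof. by apply: fpsP => m; rewrite /= mcoeffM. Qed.

Definition fps_X (i : 'I_n) := fps_of_mpoly 'X_i.

(* [fps_eqd d a b] : [a] and [b] agree in degrees smaller than [d]. *)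
Definition fps_eqd d a b := forall m, (mdeg m < d)%N -> a m = b m.

Lemma fps_eqdP a b : (forall d, fps_eqd d a b) -> a = b.
Proof. by move=> h; apply: fpsP => m; apply: (h (mdeg m).+1). Qed.

Lemma fps_eqd_sym d a b : fps_eqd d a b -> fps_eqd d b a.
Proof. by move=> h m lt_md; rewrite h. Qed.

Lemma fps_eqd_trans d a b c : fps_eqd d a b -> fps_eqd d b c -> fps_eqd d a c.
Proof. by move=> h1 h2 m lt_md; rewrite h1 ?h2. Qed.

Lemma fps_eqd1 a : a 0%MM = 0 -> fps_eqd 1 a 0.
Proof. by move=> a0 m; rewrite ltnS leqn0 mdeg_eq0 => /eqP ->. Qed.

Lemma fps_eqd_trunc d a : fps_eqd d a (fps_of_mpoly (fps_trunc d a)).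
Proof. by move=> m lt_md /=; rewrite mcoeff_trunc. Qed.

Lemma fps_eqdM d a a' b b' :
  fps_eqd d a a' -> fps_eqd d b b' -> fps_eqd d (a * b) (a' * b').
Proof.
move=> ha hb m lt_md; rewrite !fpsME; apply: eq_bigr => k /eqP def_m.
by have [lt1 lt2] := mdeg_add_lt def_m lt_md; rewrite ha ?hb.
Qed.

Lemma fps_eqdM0 d e a b :
  fps_eqd d a 0 -> fps_eqd e b 0 -> fps_eqd (d + e) (a * b) 0.
Proof.
move=> ha hb m lt_m; rewrite fpsME big1 // => k /eqP def_m.
have [lt1|ge1] := ltnP (mdeg k.1) d; first by rewrite ha ?mul0r.
rewrite [b _]hb ?mulr0 //; have := congr1 mdeg def_m; rewrite mdegD => e_m.
by rewrite -(ltn_add2l d) (leq_ltn_trans _ lt_m) // [leqRHS]e_m leq_add2r.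
Qed.

Lemma fps_eqdMS d e a a' b b' : fps_eqd d a 0 -> fps_eqd e b' 0 ->
  fps_eqd d.+1 a a' -> fps_eqd e.+1 b b' ->
  fps_eqd (d + e).+1 (a * b) (a' * b').
Proof.
move=> a0 b0 ha hb m lt_m.
have -> : a' * b' = a * b - a * (b - b') - (a - a') * b'.
  by rewrite mulrBr mulrBl !opprB [a * b + _]addrC subrK addrC subrK.
rewrite !fpsBE (_ : (a * (b - b')) m = (0 : fps) m) 1?(_ : (_ * b') m = (0 : fps) m).
- by rewrite !subr0.
- rewrite (_ : (d + e).+1 = d.+1 + e)%N // in lt_m.
  by apply: fps_eqdM0 lt_m => // k lt_k; rewrite fpsBE ha ?subrr.
- rewrite -addnS in lt_m.
  by apply: fps_eqdM0 lt_m => // k lt_k; rewrite fpsBE hb ?subrr.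
Qed.

Lemma fpsM_coef0 a b : (a * b) 0%MM = a 0%MM * b 0%MM.
Proof.
rewrite fpsME (bigD1 (bm0, bm0)) /= ?addm0 // big1 ?addr0 //.
case=> k1 k2 /= /andP[/eqP def0].
suff [k1_0 k2_0] : k1 = bm0 /\ k2 = bm0 by rewrite k1_0 k2_0 eqxx.
have : mdeg (k1 + k2)%MM == 0%N by rewrite -def0 mdeg0.
rewrite mdegD addn_eq0 => /andP[/eqP e1 /eqP e2].
by split; apply: val_inj; apply/eqP; rewrite -mdeg_eq0 ?e1 ?e2.
Qed.

End FormalPowerSeries.

Section Derivative.
Variables (K : fieldType) (n : nat).
Implicit Types (a b : fps K n) (i j : 'I_n).

Definition fps_deriv j a : fps K n :=
  Fps (fun m => a (m + U_(j))%MM *+ (m j).+1).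

Lemma fps_derivD j a b : fps_deriv j (a + b) = fps_deriv j a + fps_deriv j b.
Proof. by apply: fpsP => m; rewrite /= mulrnDl. Qed.

Lemma fps_derivN j a : fps_deriv j (- a) = - fps_deriv j a.
Proof. by apply: fpsP => m; rewrite /= mulNrn. Qed.

Lemma fps_derivZ j (x : K) a : fps_deriv j (x *: a) = x *: fps_deriv j a.
Proof. by apply: fpsP => m; rewrite /= mulrnAr. Qed.

Lemma fps_deriv0 j : fps_deriv j 0 = 0.
Proof. by apply: fpsP => m; rewrite /= mul0rn. Qed.

Lemma fps_deriv_sum j I (r : seq I) (P : pred I) (F : I -> fps K n) :
  fps_deriv j (\sum_(i <- r | P i) F i) =
  \sum_(i <- r | P i) fps_deriv j (F i).
Proof. exact: (big_morph _ (fps_derivD j) (fps_deriv0 j)). Qed.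

Lemma fps_derivC i j a :
  fps_deriv i (fps_deriv j a) = fps_deriv j (fps_deriv i a).
Proof.
apply: fpsP => m /=; rewrite -!mulrnA -!addmA [(U_(i) + U_(j))%MM]addmC.
congr (_ *+ _); rewrite !mnmDE !mnm1E [j == i]eq_sym.
by case: eqP => [->|_] //=; rewrite !addn0 mulnC.
Qed.

Lemma fps_deriv_eqd d j a b :
  fps_eqd d.+1 a b -> fps_eqd d (fps_deriv j a) (fps_deriv j b).
Proof. by move=> h m lt_m /=; rewrite h // mdegD mdeg1 addn1. Qed.

Lemma fps_derivM j a b :
  fps_deriv j (a * b) = fps_deriv j a * b + a * fps_deriv j b.
Proof.
apply: fps_eqdP => d; set p := fps_trunc d.+1 a; set q := fps_trunc d.+1 b.
have [ap bq] := (fps_eqd_trunc (d := d.+1) a, fps_eqd_trunc (d := d.+1) b).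
have sub (c c' : fps K n) : fps_eqd d.+1 c c' -> fps_eqd d c c'.
  by move=> h m lt_m; apply: h; apply: ltnW.
have h := fps_deriv_eqd j (fps_eqdM ap bq).
apply: (fps_eqd_trans h) => m lt_m; rewrite fpsDE.
rewrite (fps_eqdM (fps_deriv_eqd j ap) (sub _ _ bq)) //.
rewrite (fps_eqdM (sub _ _ ap) (fps_deriv_eqd j bq)) //.
have derE r : fps_deriv j (fps_of_mpoly r) = fps_of_mpoly r^`M(j).
  by apply: fpsP => k /=; rewrite mcoeff_mderiv.
by rewrite -fps_of_mpolyM !derE -!fps_of_mpolyM mderivM /= mcoeffD.
Qed.

End Derivative.

Section Composition.
Variables (K : fieldType) (n k : nat) (f : 'I_n -> fps K k).
Implicit Types (a b : fps K n).

(* The substitution [a (f_1, ..., f_n)]. It is meaningful when the [f i] have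
   no constant term: then the monomials of degree [> mdeg m] do not contribute
   to the coefficient at [m], which is why the sum may be cut off there. *)
Definition fps_comp a : fps K k :=
  Fps (fun m => \sum_(j : 'X_{1..n < (mdeg m).+1})
                  a j * (\prod_(i < n) f i ^+ j i) m).

Hypothesis f0 : forall i, f i 0%MM = 0.

Lemma fps_compD a b : fps_comp (a + b) = fps_comp a + fps_comp b.
Proof.
apply: fpsP => m; rewrite fpsDE /= -big_split; apply: eq_bigr => j _ /=.
by rewrite mulrDl.
Qed.
Lemma fps_compN a : fps_comp (- a) = - fps_comp a.
Proof.
apply: fpsP => m; rewrite fpsNE /= -sumrN; apply: eq_bigr => j _ /=.
by rewrite mulNr.
Qed.
Lemma fps_compB a b : fps_comp (a - b) = fps_comp a - fps_comp b.
Proof. by rewrite fps_compD fps_compN. Qed.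
Lemma fps_comp0 : fps_comp 0 = 0.
Proof. by rewrite -(subrr 0) fps_compB subrr. Qed.
Lemma fps_compZ (x : K) a : fps_comp (x *: a) = x *: fps_comp a.
Proof.
apply: fpsP => m; rewrite fpsZE /= mulr_sumr; apply: eq_bigr => j _ /=.
by rewrite mulrA.
Qed.
Lemma fps_comp_sum I (r : seq I) (P : pred I) (F : I -> fps K n) :
  fps_comp (\sum_(i <- r | P i) F i) = \sum_(i <- r | P i) fps_comp (F i).
Proof. exact: (big_morph _ fps_compD fps_comp0). Qed.

Lemma fps_comp_eqd d a b :
  fps_eqd d a b -> fps_eqd d (fps_comp a) (fps_comp b).
Proof.
move=> h m lt_m /=; apply: eq_bigr => j _; rewrite h //.
exact: leq_trans (bmdeg j) lt_m.
Qed.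

Lemma fps_eqd_prod (j : 'X_{1..n}) :
  fps_eqd (mdeg j) (\prod_(i < n) f i ^+ j i) 0.
Proof.
rewrite mdegE; apply: (big_ind2 (fun e (p : fps K k) => fps_eqd e p 0)) => //.
  by move=> e1 p1 e2 p2; apply: fps_eqdM0.
move=> i _; elim: (j i) => // e IHe; rewrite exprS -add1n.
exact/fps_eqdM0/IHe/fps_eqd1.
Qed.

Lemma fps_compE d a m : (mdeg m < d)%N ->
  fps_comp a m =
  \sum_(j : 'X_{1..n < d}) a j * (\prod_(i < n) f i ^+ j i) m.
Proof.
move=> lt_m; pose F (j : 'X_{1..n}) := a j * (\prod_(i < n) f i ^+ j i) m.
rewrite /= (big_sub_widen 'X_{1..n < (mdeg m).+1} 'X_{1..n < d} xpredT F) /=;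
  last first.
  by move=> j lt_j; apply: leq_trans lt_m.
rewrite [RHS](bigID (fun j : 'X_{1..n < d} => mdeg j < (mdeg m).+1)%N) /=.
rewrite [X in _ + X]big1 ?addr0 // => j; rewrite -leqNgt => lt_mj.
by rewrite fps_eqd_prod ?mulr0.
Qed.

Lemma fps_comp_of_mpoly (p : {mpoly K[n]}) :
  fps_comp (fps_of_mpoly p) = mmap (in_alg (fps K k)) f p.
Proof.
apply: fpsP => m; pose d := maxn (mdeg m).+1 (msize p).
rewrite (@fps_compE d) ?leq_maxl // (mmapE d) ?leq_maxr // fps_sumE.
by apply: eq_bigr => j _; rewrite mulr_algl fpsZE.
Qed.

Lemma fps_compM a b : fps_comp (a * b) = fps_comp a * fps_comp b.
Proof.
apply: fps_eqdP => d; set p := fps_trunc d a; set q := fps_trunc d b.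
have [ap bq] := (fps_eqd_trunc (d := d) a, fps_eqd_trunc (d := d) b).
apply: (fps_eqd_trans (fps_comp_eqd (fps_eqdM ap bq))).
rewrite -fps_of_mpolyM fps_comp_of_mpoly rmorphM /=.
by apply/fps_eqd_sym/fps_eqdM; rewrite -fps_comp_of_mpoly; apply: fps_comp_eqd.
Qed.

Lemma fps_comp1 : fps_comp 1 = 1.
Proof.
have -> : 1 = fps_of_mpoly 1 :> fps K n.
  by apply: fpsP => m; rewrite /= mcoeff1.
by rewrite fps_comp_of_mpoly rmorph1.
Qed.

Lemma fps_comp_prod I (r : seq I) (P : pred I) (F : I -> fps K n) :
  fps_comp (\prod_(i <- r | P i) F i) = \prod_(i <- r | P i) fps_comp (F i).
Proof. exact: (big_morph _ fps_compM fps_comp1). Qed.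

Lemma fps_compXn a e : fps_comp (a ^+ e) = fps_comp a ^+ e.
Proof. by elim: e => [|e IHe]; rewrite ?fps_comp1 // !exprS fps_compM IHe. Qed.

Lemma fps_comp_X i : fps_comp (fps_X K i) = f i.
Proof. by rewrite fps_comp_of_mpoly mmapX mmap1U. Qed.

Lemma fps_comp_coef0 a : fps_comp a 0%MM = a 0%MM.
Proof.
have h : fps_eqd 1 a (a 0%MM *: 1).
  move=> m; rewrite ltnS leqn0 mdeg_eq0 => /eqP ->.
  by rewrite fpsZE fps1E eqxx mulr1.
have lt0 : (mdeg (0%MM : 'X_{1..k}) < 1)%N by rewrite mdeg0.
by rewrite (fps_comp_eqd h lt0) fps_compZ fps_comp1 fpsZE fps1E eqxx mulr1.
Qed.

Lemma fps_comp_coef1 a j :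
  fps_comp a U_(j)%MM = \sum_(i < n) a U_(i)%MM * f i U_(j)%MM.
Proof.
have h : fps_eqd 2 a (a 0%MM *: 1 + \sum_(i < n) a U_(i)%MM *: fps_X K i).
  move=> m; rewrite fpsDE fpsZE fps1E fps_sumE ltnS leq_eqVlt ltnS leqn0.
  case/orP=> [/mdeg1P[i /eqP ->]|].
    rewrite mnm1_eq0 mulr0 add0r (bigD1 i) //= mcoeffXU eqxx mulr1.
    rewrite big1 ?addr0 // => l /negPf nli.
    by rewrite /= mcoeffXU nli mulr0.
  rewrite mdeg_eq0 => /eqP ->; rewrite eqxx mulr1 big1 ?addr0 // => i _.
  by rewrite /= mcoeffX mnm1_eq0 mulr0.
have lt1 : (mdeg (U_(j)%MM : 'X_{1..k}) < 2)%N by rewrite mdeg1.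
rewrite (fps_comp_eqd h lt1) fps_compD fpsDE fps_compZ fps_comp1 fpsZE fps1E.
rewrite mnm1_eq0 mulr0 add0r fps_comp_sum fps_sumE.
by apply: eq_bigr => i _; rewrite fps_compZ fps_comp_X fpsZE.
Qed.

End Composition.

Lemma fps_compA (K : fieldType) n k l (f : 'I_n -> fps K k)
    (g : 'I_k -> fps K l) (a : fps K n) :
  (forall i, f i 0%MM = 0) -> (forall i, g i 0%MM = 0) ->
  fps_comp g (fps_comp f a) = fps_comp (fun i => fps_comp g (f i)) a.
Proof.
move=> f0 g0; apply: fps_eqdP => d.
have ap := fps_eqd_trunc (d := d) a; set p := fps_trunc d a in ap.
apply: (fps_eqd_trans (fps_comp_eqd _ (fps_comp_eqd _ ap))).
apply/fps_eqd_sym/(fps_eqd_trans (fps_comp_eqd _ ap)).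
rewrite !fps_comp_of_mpoly //; last by move=> i; rewrite fps_comp_coef0.
move=> m _; congr (fps_coef _ m).
rewrite /mmap fps_comp_sum //; apply: eq_bigr => j _.
rewrite fps_compM // fps_compZ fps_comp1 //; congr (_ * _).
by rewrite /mmap1 fps_comp_prod //; apply: eq_bigr => i _; rewrite fps_compXn.
Qed.

Lemma fps_comp_id (K : fieldType) n (a : fps K n) :
  fps_comp (fun i => fps_X K i) a = a.
Proof.
have X0 i : fps_X K i 0%MM = 0 by rewrite /= mcoeffX mnm1_eq0.
apply: fps_eqdP => d; have ap := fps_eqd_trunc (d := d) a.
apply: (fps_eqd_trans (fps_comp_eqd _ ap)); apply/fps_eqd_sym.
apply: (fps_eqd_trans ap) => m _; congr (fps_coef _ m).
rewrite fps_comp_of_mpoly // /mmap; set p := fps_trunc d a.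
apply: fpsP => m'; rewrite fps_sumE -[LHS]/(p@_m') [in LHS](mpolyE p).
rewrite raddf_sum; apply: eq_bigr => j _.
rewrite -[LHS]/((p@_j *: 'X_[j])@_m') mulr_algl fpsZE mcoeffZ; congr (_ * _).
rewrite -(@mmap1_id n K j).
have of1 : fps_of_mpoly 1 = 1 :> fps K n.
  by apply: fpsP => l; rewrite /= mcoeff1.
have ofM := @fps_of_mpolyM K n.
rewrite -[LHS]/(fps_of_mpoly _ m') /mmap1; congr (fps_coef _ m').
rewrite (big_morph _ ofM of1); apply: eq_bigr => i _.
by elim: (j i) => [|e IHe]; rewrite ?of1 // !exprS ofM IHe.
Qed.

Section TangentToIdentity.
Variables (K : fieldType) (n : nat) (f : 'I_n -> fps K n).
Hypothesis f_tgt : forall i, fps_eqd 2 (f i) (fps_X K i).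

Let X0 (i : 'I_n) : fps_X K i 0%MM = 0 :> K.
Proof. by rewrite /= mcoeffX mnm1_eq0. Qed.

Let f0 i : f i 0%MM = 0.
Proof. by rewrite f_tgt ?X0 // mdeg0. Qed.

Lemma fps_eqd_prod_tgt (j : 'X_{1..n}) :
  fps_eqd (mdeg j).+1
    (\prod_(i < n) f i ^+ j i) (\prod_(i < n) fps_X K i ^+ j i).
Proof.
pose P (e : nat) (p q : fps K n) :=
  [/\ fps_eqd e p 0, fps_eqd e q 0 & fps_eqd e.+1 p q].
have P1 : P 0%N 1 1 by [].
have PM e1 p1 q1 e2 p2 q2 :
    P e1 p1 q1 -> P e2 p2 q2 -> P (e1 + e2)%N (p1 * p2) (q1 * q2).
  move=> [p10 q10 pq1] [p20 q20 pq2]; split; try exact: fps_eqdM0.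
  exact: fps_eqdMS.
suff: P (mdeg j) (\prod_(i < n) f i ^+ j i) (\prod_(i < n) fps_X K i ^+ j i).
  by case.
rewrite mdegE.
elim/big_ind3: _ => // [e1 p1 q1 e2 p2 q2 h1 h2|i _]; first exact: PM.
elim: (j i) => // e IHe; rewrite !exprS -add1n; apply: PM IHe.
by split; [apply: fps_eqd1 | apply: fps_eqd1 | apply: f_tgt].
Qed.

Lemma fps_comp_tgt d (a : fps K n) :
  fps_eqd d a 0 -> fps_eqd d.+1 (a - fps_comp f a) 0.
Proof.
move=> a0 m; rewrite ltnS => le_m; rewrite fpsBE fps0E.
rewrite -{1}(fps_comp_id a) /= -sumrB big1 // => j _.
have [lt_j|ge_j] := ltnP (mdeg j) d; first by rewrite a0 // !mul0r subrr.
rewrite fps_eqd_prod_tgt ?subrr // ltnS.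
exact: leq_trans le_m ge_j.
Qed.

Lemma fps_comp_tgt_surj (a : fps K n) : exists b, fps_comp f b = a.
Proof.
pose E j := iter j (fun e => e - fps_comp f e) a.
have E0 j : fps_eqd j (E j) 0 by elim: j => // j; apply: fps_comp_tgt.
exists (Fps (fun m => \sum_(0 <= j < (mdeg m).+1) E j m)).
apply: fps_eqdP => d.
have hb : fps_eqd d (Fps (fun m => \sum_(0 <= j < (mdeg m).+1) E j m))
                    (\sum_(0 <= j < d) E j).
  move=> m lt_m; rewrite fps_sumE /= [RHS](@big_cat_nat _ _ _ (mdeg m).+1) //=.
  rewrite [X in _ + X]big_nat_cond [X in _ + X]big1 ?addr0 // => j.
  by case/andP=> /andP[lt_j _] _; rewrite E0.
apply: (fps_eqd_trans (fps_comp_eqd _ hb)); rewrite fps_comp_sum.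
have -> : \sum_(0 <= j < d) fps_comp f (E j) = a - E d.
  rewrite -[RHS]opprB -[a]/(E 0%N) -(telescope_sumr E) // -sumrN.
  by apply: eq_bigr => j _; rewrite [E j.+1]iterS -/(E j) opprB opprB addrC subrK.
by move=> m lt_m; rewrite fpsBE E0 // fps0E subr0.
Qed.

End TangentToIdentity.

Section FormalDiffeomorphisms.
Variables (K : fieldType) (n : nat).
Local Notation ftuple := {ffun 'I_n -> fps K n}.
Implicit Types f g h : ftuple.

Definition linear_part f : 'M[K]_n := \matrix_(i, j) f i U_(j)%MM.

Definition is_fdiff f :=
  [forall i, f i 0%MM == 0] && (linear_part f \in unitmx).

Record fdiff := Fdiff { fdiff_val :> ftuple; fdiff_valP : is_fdiff fdiff_val }.

HB.instance Definition _ := [isSub for fdiff_val].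
HB.instance Definition _ := [Choice of fdiff by <:].

(* [f \o g] in the usual order: [g] is substituted into the components of [f] *)
Definition ftuple_comp f g : ftuple := [ffun i => fps_comp g (f i)].
Definition ftuple_id : ftuple := [ffun i => fps_X K i].

Lemma fdiff_coef0 (f : fdiff) i : f i 0%MM = 0.
Proof. by case: f => f /= /andP[/forallP /(_ i)/eqP]. Qed.

Lemma fdiff_unit (f : fdiff) : linear_part f \in unitmx.
Proof. by case: f => f /= /andP[]. Qed.

Lemma linear_part_comp f g : (forall i, g i 0%MM = 0) ->
  linear_part (ftuple_comp f g) = linear_part f *m linear_part g.
Proof.
move=> g0; apply/matrixP => i j; rewrite !mxE ffunE fps_comp_coef1 //.
by apply: eq_bigr => l _; rewrite !mxE.
Qed.

Lemma linear_part_id : linear_part ftuple_id = 1%:M.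
Proof. by apply/matrixP => i j; rewrite !mxE ffunE /= mcoeffXU. Qed.

Fact fdiff_one_subproof : is_fdiff ftuple_id.
Proof.
rewrite /is_fdiff linear_part_id unitmx1 andbT; apply/forallP => i.
by rewrite ffunE /= mcoeffX mnm1_eq0.
Qed.
Definition fdiff_one := Fdiff fdiff_one_subproof.

Fact fdiff_mul_subproof (f g : fdiff) : is_fdiff (ftuple_comp f g).
Proof.
have g0 := fdiff_coef0 g; apply/andP; split.
  by apply/forallP => i; rewrite ffunE fps_comp_coef0 // fdiff_coef0.
by rewrite linear_part_comp // unitmx_mul !fdiff_unit.
Qed.
Definition fdiff_mul (f g : fdiff) := Fdiff (fdiff_mul_subproof f g).

Fact fdiff_mulA : associative fdiff_mul.
Proof.
move=> f g h; apply: val_inj; apply/ffunP => i; rewrite !ffunE /=.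
rewrite fps_compA; try exact: fdiff_coef0.
by congr fps_comp; apply: funext => j; rewrite ffunE.
Qed.

Fact fdiff_mul1 : left_id fdiff_one fdiff_mul.
Proof.
move=> f; apply: val_inj; apply/ffunP => i; rewrite !ffunE /=.
by rewrite fps_comp_X //; apply: fdiff_coef0.
Qed.

Fact fdiff_mul1r : right_id fdiff_one fdiff_mul.
Proof.
move=> f; apply: val_inj; apply/ffunP => i; rewrite !ffunE /=.
rewrite -[RHS]fps_comp_id; congr fps_comp.
by apply: funext => j; rewrite ffunE.
Qed.

Lemma fdiff_left_inverse (f : fdiff) : exists g : fdiff, fdiff_mul g f = fdiff_one.
Proof.
have f0 := fdiff_coef0 f; pose A := invmx (linear_part f).
pose l i : fps K n := \sum_j A i j *: fps_X K j.
have l0 i : l i 0%MM = 0.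
  rewrite fps_sumE big1 // => j _.
  by rewrite fpsZE /= mcoeffX mnm1_eq0 mulr0.
pose h i := fps_comp f (l i).
have h0 i : h i 0%MM = 0 by rewrite fps_comp_coef0.
have h_tgt i : fps_eqd 2 (h i) (fps_X K i).
  move=> m; rewrite ltnS leq_eqVlt ltnS leqn0; case/orP; last first.
    by rewrite mdeg_eq0 => /eqP ->; rewrite h0 /= mcoeffX mnm1_eq0.
  case/mdeg1P=> k /eqP ->; rewrite /h /l fps_comp_sum fps_sumE.
  rewrite -[RHS]/('X_i@_U_(k)) mcoeffXU.
  transitivity ((A *m linear_part f) i k).
    rewrite mxE; apply: eq_bigr => j _.
    by rewrite fps_compZ fps_comp_X // fpsZE !mxE.
  by rewrite mulVmx ?fdiff_unit // mxE.
have [b hb] : exists b : 'I_n -> fps K n,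
    forall i, fps_comp h (b i) = fps_X K i.
  exists (fun i => xget 0 [set c | fps_comp h c = fps_X K i]%classic) => i.
  by case: xgetP => // /(_ (sval (cid (fps_comp_tgt_surj h_tgt (fps_X K i)))));
    case: cid.
pose g : ftuple := [ffun i => fps_comp l (b i)].
have gf : ftuple_comp g f = ftuple_id.
  by apply/ffunP => i; rewrite !ffunE fps_compA // hb.
have g_fdiff : is_fdiff g.
  apply/andP; split.
    apply/forallP => i; rewrite -(fps_comp_coef0 f0).
    have /ffunP/(_ i) := gf; rewrite !ffunE => ->.
    by rewrite /= mcoeffX mnm1_eq0.
  have /mulmx1_unit[] // : linear_part g *m linear_part f = 1%:M.
  by rewrite -linear_part_comp // gf linear_part_id.
by exists (Fdiff g_fdiff); apply: val_inj.
Qed.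

Definition fdiff_inv (f : fdiff) := sval (cid (fdiff_left_inverse f)).

Fact fdiff_mulV : left_inverse fdiff_one fdiff_inv fdiff_mul.
Proof. by move=> f; rewrite /fdiff_inv; case: cid. Qed.

Fact fdiff_mulVr : right_inverse fdiff_one fdiff_inv fdiff_mul.
Proof.
move=> f; set g := fdiff_inv f.
rewrite -[LHS]fdiff_mul1 -{1}(fdiff_mulV g) -fdiff_mulA (fdiff_mulA g f g).
by rewrite fdiff_mulV fdiff_mul1 fdiff_mulV.
Qed.

HB.instance Definition _ := isGroup.Build fdiff
  fdiff_mulA fdiff_mul1 fdiff_mul1r fdiff_mulV fdiff_mulVr.

End FormalDiffeomorphisms.

HB.mixin Record Lmodule_isLieAlgebra (R : nzRingType) L
    of GRing.Lmodule R L := {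
  lie : L -> L -> L;
  lie_linearl : forall (x : R) (u v w : L),
    lie (x *: u + v) w = x *: lie u w + lie v w;
  lie_linearr : forall (x : R) (u v w : L),
    lie u (x *: v + w) = x *: lie u v + lie u w;
  liexx : forall u : L, lie u u = 0;
  lie_jacobi : forall u v w : L,
    lie u (lie v w) + lie v (lie w u) + lie w (lie u v) = 0
}.

#[short(type="lieAlgType")]
HB.structure Definition LieAlgebra (R : nzRingType) :=
  {L of GRing.Lmodule R L & Lmodule_isLieAlgebra R L}.

Section FormalVectorFields.
Variables (K : fieldType) (n : nat).
Local Notation ftuple := {ffun 'I_n -> fps K n}.
Implicit Types (X Y Z : ftuple) (a b : fps K n).

(* [X : ftuple] stands for the derivation [\sum_j X j d/dz_j]. *)
Definition vf_apply X a := \sum_j X j * fps_deriv j a.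

Definition vf_bracket X Y : ftuple :=
  [ffun i => vf_apply X (Y i) - vf_apply Y (X i)].

Lemma vf_applyD X a b : vf_apply X (a + b) = vf_apply X a + vf_apply X b.
Proof.
rewrite -big_split; apply: eq_bigr => j _.
by rewrite /= fps_derivD mulrDr.
Qed.
Lemma vf_applyN X a : vf_apply X (- a) = - vf_apply X a.
Proof. by rewrite -sumrN; apply: eq_bigr => j _; rewrite fps_derivN mulrN. Qed.
Lemma vf_applyZ X (x : K) a : vf_apply X (x *: a) = x *: vf_apply X a.
Proof.
by rewrite scaler_sumr; apply: eq_bigr => j _; rewrite fps_derivZ scalerAr.
Qed.
Lemma vf_applyM X a b :
  vf_apply X (a * b) = vf_apply X a * b + a * vf_apply X b.
Proof.
rewrite mulr_suml mulr_sumr -big_split; apply: eq_bigr => j _ /=.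
by rewrite fps_derivM mulrDr mulrA [a * (_ * _)]mulrCA.
Qed.
Lemma vf_apply0 X : vf_apply X 0 = 0.
Proof. by rewrite [LHS]big1 // => j _; rewrite fps_deriv0 mulr0. Qed.
Lemma vf_apply_sum X I (r : seq I) (P : pred I) (F : I -> fps K n) :
  vf_apply X (\sum_(i <- r | P i) F i) =
  \sum_(i <- r | P i) vf_apply X (F i).
Proof. exact: (big_morph _ (vf_applyD X) (vf_apply0 X)). Qed.

Lemma vf_apply_linearl (x : K) X Y a :
  vf_apply (x *: X + Y) a = x *: vf_apply X a + vf_apply Y a.
Proof.
rewrite scaler_sumr -big_split; apply: eq_bigr => j _ /=.
by rewrite !ffunE mulrDl scalerAl.
Qed.

Lemma vf_apply_bracket X Y a : vf_apply (vf_bracket X Y) a =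
  vf_apply X (vf_apply Y a) - vf_apply Y (vf_apply X a).
Proof.
have actE U V : vf_apply U (vf_apply V a) =
    \sum_j vf_apply U (V j) * fps_deriv j a +
    \sum_j \sum_l V j * U l * fps_deriv l (fps_deriv j a).
  rewrite vf_apply_sum -big_split; apply: eq_bigr => j _ /=.
  rewrite vf_applyM; congr (_ + _); rewrite mulr_sumr.
  by apply: eq_bigr => l _; rewrite mulrA.
rewrite !actE [X in _ = _ - (_ + X)]exchange_big /=.
rewrite [X in _ = _ - (_ + X)](_ : _ =
    \sum_j \sum_l Y j * X l * fps_deriv l (fps_deriv j a)); last first.
  apply: eq_bigr => j _; apply: eq_bigr => l _.
  by rewrite fps_derivC [X l * _]mulrC.
rewrite opprD addrACA subrr addr0 -sumrB.
by apply: eq_bigr => j _; rewrite ffunE mulrBl.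
Qed.

Lemma vf_bracket_linearl (x : K) X Y Z :
  vf_bracket (x *: X + Y) Z = x *: vf_bracket X Z + vf_bracket Y Z.
Proof.
apply/ffunP => i; rewrite !ffunE vf_apply_linearl vf_applyD vf_applyZ.
by rewrite scalerBr opprD addrACA.
Qed.
Lemma vf_bracket_linearr (x : K) X Y Z :
  vf_bracket X (x *: Y + Z) = x *: vf_bracket X Y + vf_bracket X Z.
Proof.
apply/ffunP => i; rewrite !ffunE vf_apply_linearl vf_applyD vf_applyZ.
by rewrite scalerBr opprD addrACA.
Qed.
Lemma vf_bracketxx X : vf_bracket X X = 0.
Proof. by apply/ffunP => i; rewrite !ffunE subrr. Qed.
Lemma vf_bracket_jacobi X Y Z :
  vf_bracket X (vf_bracket Y Z) + vf_bracket Y (vf_bracket Z X) +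
  vf_bracket Z (vf_bracket X Y) = 0.
Proof.
apply/ffunP => i; rewrite !ffunE !vf_apply_bracket !vf_applyD !vf_applyN.
ring.
Qed.

Definition vanish0 : {pred ftuple} :=
  [pred X : ftuple | [forall i, X i 0%MM == 0]].

Record fvfield :=
  Fvfield { fvfield_val :> ftuple; fvfield_valP : fvfield_val \in vanish0 }.

HB.instance Definition _ := [isSub for fvfield_val].
HB.instance Definition _ := [Choice of fvfield by <:].

Fact vanish0_submod_closed : subsemimod_closed vanish0.
Proof.
split; first split.
- by apply/forallP => i; rewrite ffunE.
- move=> X Y /forallP X0 /forallP Y0; apply/forallP => i.
  by rewrite ffunE fpsDE (eqP (X0 i)) (eqP (Y0 i)) addr0.
- move=> x X /forallP X0; apply/forallP => i.
  by rewrite ffunE fpsZE (eqP (X0 i)) mulr0.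
Qed.
HB.instance Definition _ := GRing.SubChoice_isSubLmodule.Build K ftuple
  vanish0 fvfield vanish0_submod_closed.

Lemma fvfield_valD (X Y : fvfield) :
  fvfield_val (X + Y) = fvfield_val X + fvfield_val Y.
Proof. exact: (raddfD (\val : fvfield -> ftuple)). Qed.
Lemma fvfield_valZ (x : K) (X : fvfield) :
  fvfield_val (x *: X) = x *: fvfield_val X.
Proof. exact: (linearZ_LR (\val : fvfield -> ftuple)). Qed.

Fact fvfield_lie_subproof (X Y : fvfield) :
  vf_bracket X Y \in vanish0.
Proof.
have van (U : fvfield) i : U i 0%MM = 0.
  by case: U => U /= /forallP/(_ i)/eqP.
apply/forallP => i; rewrite ffunE fpsBE !fps_sumE.
by rewrite !big1 ?subrr // => j _; rewrite fpsM_coef0 van mul0r.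
Qed.
Definition fvfield_lie (X Y : fvfield) := Fvfield (fvfield_lie_subproof X Y).

Fact fvfield_lie_linearl (x : K) (X Y Z : fvfield) :
  fvfield_lie (x *: X + Y) Z = x *: fvfield_lie X Z + fvfield_lie Y Z.
Proof.
apply: val_inj; rewrite -[LHS]/(vf_bracket (fvfield_val _) _).
rewrite -[RHS]/(fvfield_val _) !fvfield_valD !fvfield_valZ.
exact: vf_bracket_linearl.
Qed.
Fact fvfield_lie_linearr (x : K) (X Y Z : fvfield) :
  fvfield_lie X (x *: Y + Z) = x *: fvfield_lie X Y + fvfield_lie X Z.
Proof.
apply: val_inj; rewrite -[LHS]/(vf_bracket _ (fvfield_val _)).
rewrite -[RHS]/(fvfield_val _) !fvfield_valD !fvfield_valZ.
exact: vf_bracket_linearr.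
Qed.
Fact fvfield_liexx (X : fvfield) : fvfield_lie X X = 0.
Proof. by apply: val_inj; apply: vf_bracketxx. Qed.
Fact fvfield_lie_jacobi (X Y Z : fvfield) :
  fvfield_lie X (fvfield_lie Y Z) + fvfield_lie Y (fvfield_lie Z X) +
  fvfield_lie Z (fvfield_lie X Y) = 0.
Proof.
apply: val_inj; rewrite -[LHS]/(fvfield_val _) !fvfield_valD.
exact: vf_bracket_jacobi.
Qed.
HB.instance Definition _ := Lmodule_isLieAlgebra.Build K fvfield
  fvfield_lie_linearl fvfield_lie_linearr fvfield_liexx fvfield_lie_jacobi.

End FormalVectorFields.

Local Open Scope classical_set_scope.

(* The least [k] such that [P k], with [None] standing for [min \emptyset],
   that is for infinity. *)
Definition min_nat (P : nat -> Prop) : option nat :=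
  if pselect (exists k, `[< P k >]) is left exP then Some (ex_minn exP)
  else None.

Definition length_le (l : option nat) (n : nat) : bool :=
  if l is Some k then (k <= n)%N else false.

Section LieSeries.
Variables (K : fieldType) (L : lieAlgType K).
Implicit Types A B : set L.

Definition is_subspace A :=
  A 0 /\ forall (x : K) u v, A u -> A v -> A (x *: u + v).

Definition is_lie_subalgebra A :=
  is_subspace A /\ forall u v, A u -> A v -> A (lie u v).

Definition lie_commutator A B : set L :=
  smallest is_subspace [set lie u v | u in A & v in B].

Definition lie_derived A (m : nat) : set L :=
  iter m (fun B => lie_commutator B B) A.

Definition lie_lower_central A (m : nat) : set L :=
  iter m (lie_commutator A) A.

Definition lie_nilpotent A := exists m, lie_lower_central A m = [set 0].

Definition lie_soluble_length A : option nat :=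
  min_nat (fun k => lie_derived A k = [set 0]).

End LieSeries.

Section GroupSeries.
Variable G : groupType.
Implicit Types A B : set G.
Local Open Scope group_scope.

Definition is_subgroup A :=
  [/\ A 1, forall x y, A x -> A y -> A (x * y) & forall x, A x -> A x^-1].

Definition grp_commutator A B : set G :=
  smallest is_subgroup [set [~ x, y] | x in A & y in B].

Definition grp_derived A (m : nat) : set G :=
  iter m (fun B => grp_commutator B B) A.

Definition grp_lower_central A (m : nat) : set G :=
  iter m (grp_commutator A) A.

Definition grp_nilpotent A := exists m, grp_lower_central A m = [set 1].

Definition grp_soluble_length A : option nat :=
  min_nat (fun k => grp_derived A k = [set 1]).

End GroupSeries.

(* Main.v *)
(* Lie algebras. Over the fraction field F of the power series, choose
   X_1, X_2, ... in l, each as deep as possible in the lower central series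
   outside the F-span of its predecessors, so that [l, X_k] lies in the span
   D_(k-1) of X_1, ..., X_(k-1). At most n steps exhaust l. If fX_k + ... is an
   element of l lying in D_k, then bracketing it with X_1, ..., X_k shows that
   these fields kill f; hence l meets D_k / D_(k-1) in an abelian algebra.

   Unipotent groups. For u with unipotent linear part, every jet of u^t is
   polynomial in t, and its derivative at t = 0 is a vector field, log u. Iterated
   commutators of powers in a nilpotent group are trivial; comparing linear terms
   in the exponents, iterated brackets of logarithms vanish, so the logarithms
   generate a nilpotent Lie algebra g. Polynomial curves whose logarithmic
   derivative lies in the k-th derived algebra of g have commutators with
   logarithmic derivative in the (k+1)-st one; those for g^(n) = 0 are constant.

   General groups. A nilpotent linear group of degree n has length at most n, and
   its k-th powers are simultaneously triangular for some k. When the linear parts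
   are triangular, the semisimple part of each element is again a diffeomorphism,
   and it centralizes the group, so dividing by it reduces to the unipotent case.
   Back from the group H of k-th powers to G: as H has length at most n, the group
   G^(n) is torsion (isolators in nilpotent groups); it is also tangent to the
   identity, hence trivial. *)

Require Import Defs.
From HB Require Import structures.
From mathcomp Require Import all_boot all_order all_algebra.
From mathcomp Require Import boolp classical_sets reals complex.
From mathcomp Require Import ssrcomplements mpoly.
From mathcomp Require Import ring zify.

Set Implicit Arguments.
Unset Strict Implicit.
Unset Printing Implicit Defensive.

Import GRing.Theory Num.Theory.
Local Open Scope ring_scope.

(** * Nilpotent Lie algebras of formal vector fields *)

(** The group is neither completed nor exponentiated. Diffeomorphisms act on power series by
    substitution, vector fields by derivation; both respect the order, so they act by matrices on
    the jets of each order [N], and these matrices together determine them. Identities along a flow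
    become polynomial identities checked at natural times, where they speak of actual powers in the
    group; this replaces the Baker-Campbell-Hausdorff formula. Such flows exist only for unipotent
    elements, and the unipotent and semisimple parts of an element need not belong to the group.
    This is harmless because central factors disappear from commutators. Triangularity of the linear
    parts is what makes semisimple parts central: commutators then have diagonal 1. Triangular form
    costs a passage to powers, which loses track of torsion. The separate bound for linear groups,
    with the same [n], repairs this: it makes the [n]-th derived group tangent to the identity,
    where characteristic zero excludes torsion. *)

Section FpsIntegralDomain.
Variables (K : fieldType) (n : nat).
Implicit Types a b : fps K n.

Lemma fps_order a : a <> 0 ->
  exists d, fps_eqd d a 0 /\ ~ fps_eqd d.+1 a 0.
Proof.
move=> a0; have exd : exists d, `[< ~ fps_eqd d a 0 >].
  apply: contrapT => h; apply: a0; apply: fps_eqdP => d.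
  by apply: contrapT => hd; apply: h; exists d; apply/asboolP.
case: (ex_minnP exd) => [[|d]] /asboolP nd dmin; first by case: nd => m.
exists d; split=> //; apply: contrapT => /asboolP/dmin.
by rewrite ltnn.
Qed.

(** The truncations [p] and [q] are the lowest homogeneous forms of [a] and [b]. Their product
    agrees with [a * b] up to its own degree [d + e], hence is zero, while polynomials over a field
    form an integral domain. *)
Lemma fps_mul_eq0 a b : a * b = 0 -> (a == 0) || (b == 0).
Proof.
move=> ab0; have [//|/eqP/fps_order[d [a0 na]]] := eqVneq a 0.
have [//|/eqP/fps_order[e [b0 nb]]] := eqVneq b 0.
pose p := fps_trunc d.+1 a; pose q := fps_trunc e.+1 b.
have ap := fps_eqd_trunc (d := d.+1) a; have bq := fps_eqd_trunc (d := e.+1) b.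
have q0 : fps_eqd e (fps_of_mpoly q) 0.
  by move=> m lt_m; rewrite -bq ?b0 // ltnW.
have pq0 := fps_eqdMS a0 q0 ap bq; rewrite ab0 -fps_of_mpolyM in pq0.
suff: p * q = 0.
  move/eqP; rewrite mulf_eq0 => /orP[] /eqP z.
    by case: na; apply: (fps_eqd_trans ap) => m _; rewrite -/p z /= mcoeff0.
  by case: nb; apply: (fps_eqd_trans bq) => m _; rewrite -/q z /= mcoeff0.
apply/mpolyP => m; rewrite mcoeff0.
have [lt_m|ge_m] := ltnP (mdeg m) (d + e).+1; first by have /= <- := pq0 _ lt_m.
rewrite mcoeffM big1 // => k /eqP def_m.
have trunc0 c f (j : 'X_{1..n}) : (f <= mdeg j)%N -> (fps_trunc f c)@_j = 0.
  move=> le_j; rewrite /fps_trunc raddf_sum big1 // => i _.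
  rewrite -[LHS]/((c i *: 'X_[i])@_j) mcoeffZ mcoeffX.
  by case: eqP => [e_ij|]; rewrite ?mulr0 //; move: (bmdeg i); rewrite e_ij ltnNge le_j.
have [le1|gt1] := leqP d.+1 (mdeg k.1); first by rewrite /p trunc0 ?mul0r.
have [le2|gt2] := leqP e.+1 (mdeg k.2); first by rewrite /q trunc0 ?mulr0.
have em := congr1 mdeg def_m; rewrite mdegD in em.
rewrite !ltnS in gt1 gt2.
by move: (leq_add gt1 gt2); rewrite -em leqNgt ge_m.
Qed.

Definition fps_unit : {pred fps K n} := fun a => `[< exists b, b * a = 1 >].
Definition fps_inv a : fps K n :=
  if pselect (exists b, b * a = 1) is left h then sval (cid h) else a.

Fact fps_mulVr : {in fps_unit, left_inverse 1 fps_inv *%R}.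
Proof.
by move=> a /asboolP h; rewrite /fps_inv; case: pselect => // h'; case: cid.
Qed.
Fact fps_unitPl a b : b * a = 1 -> a \in fps_unit.
Proof. by move=> ba; apply/asboolP; exists b. Qed.
Fact fps_inv_out : {in [predC fps_unit], fps_inv =1 id}.
Proof. by move=> a /asboolP h; rewrite /fps_inv; case: pselect. Qed.
HB.instance Definition _ := GRing.ComNzRing_hasMulInverse.Build (fps K n)
  fps_mulVr fps_unitPl fps_inv_out.
HB.instance Definition _ :=
  GRing.ComUnitRing_isIntegral.Build (fps K n) fps_mul_eq0.

End FpsIntegralDomain.

(** * Vector fields over the fraction field of the power series *)

Section LieBound.
Variables (K : fieldType) (n : nat).
Local Notation ftuple := {ffun 'I_n -> fps K n}.
Local Notation F := {fraction fps K n}.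
Local Notation "x %:F" := (@FracField.tofrac (fps K n) x).
Implicit Types (X Y Z : ftuple) (a b : fps K n) (s : seq (fvfield K n)).

Definition vf_mul a Y : ftuple := [ffun i => a * Y i].
Definition frac_row Y : 'rV[F]_n := \row_i (Y i)%:F.

Lemma frac_rowM a Y : frac_row (vf_mul a Y) = a%:F *: frac_row Y.
Proof. by apply/rowP => i; rewrite !mxE ffunE rmorphM. Qed.
Lemma frac_rowD X Y : frac_row (X + Y) = frac_row X + frac_row Y.
Proof. by apply/rowP => i; rewrite !mxE ffunE rmorphD. Qed.
Lemma frac_rowB X Y : frac_row (X - Y) = frac_row X - frac_row Y.
Proof. by apply/rowP => i; rewrite !mxE !ffunE rmorphB. Qed.
Lemma frac_row_eq0 Y : frac_row Y = 0 -> Y = 0.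
Proof.
move=> /rowP h; apply/ffunP => i; move: (h i); rewrite !mxE ffunE.
by move/eqP; rewrite tofrac_eq0 => /eqP.
Qed.
Lemma frac_row0 : frac_row 0 = 0.
Proof. by apply/rowP => i; rewrite !mxE ffunE rmorph0. Qed.

Lemma fraction_numden (f : F) : exists a b : fps K n, a != 0 /\ a%:F * f = b%:F.
Proof.
elim/quotW: f => f; exists \d_f, \n_f; split; first exact: denom_ratioP.
rewrite !piE; apply/eqmodP; rewrite /= FracField.equivfE /FracField.mulf.
rewrite !numden_Ratio ?mul1r ?mulr1 ?denom_ratioP ?oner_neq0 //.
Qed.

Lemma vf_apply_mul a X f : vf_apply (vf_mul a X) f = a * vf_apply X f.
Proof. by rewrite mulr_sumr; apply: eq_bigr => i _; rewrite ffunE mulrA. Qed.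

Lemma vf_bracket_mulr X a Y : vf_bracket X (vf_mul a Y) =
  vf_mul (vf_apply X a) Y + vf_mul a (vf_bracket X Y).
Proof.
apply/ffunP => i; rewrite !ffunE vf_applyM vf_apply_mul.
by rewrite mulrBr addrA.
Qed.
Lemma vf_bracketBr X Y Z : vf_bracket X (Y - Z) = vf_bracket X Y - vf_bracket X Z.
Proof.
have -> : Y - Z = -1 *: Z + Y by rewrite scaleN1r addrC.
by rewrite vf_bracket_linearr scaleN1r addrC.
Qed.
Lemma vf_bracket0r X : vf_bracket X 0 = 0.
Proof. by have := vf_bracketBr X 0 0; rewrite !subrr. Qed.

Fixpoint frac_span (s : seq (fvfield K n)) : 'M[F]_n :=
  if s is X :: s' then (frac_span s' + frac_row X)%MS else 0.

Definition in_span s (Y : ftuple) := (frac_row Y <= frac_span s)%MS.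

Lemma in_spanD s X Y : in_span s X -> in_span s Y -> in_span s (X + Y).
Proof. by rewrite /in_span frac_rowD; apply: addmx_sub. Qed.
Lemma in_spanB s X Y : in_span s X -> in_span s Y -> in_span s (X - Y).
Proof.
by rewrite /in_span frac_rowB => ? ?; rewrite addmx_sub // -scaleN1r scalemx_sub.
Qed.
Lemma in_spanM s a X : in_span s X -> in_span s (vf_mul a X).
Proof. by rewrite /in_span frac_rowM; apply: scalemx_sub. Qed.
Lemma in_spanMI s a X : a != 0 -> in_span s (vf_mul a X) -> in_span s X.
Proof.
move=> a0; rewrite /in_span frac_rowM => /(scalemx_sub (a%:F)^-1).
by rewrite scalerA mulVf ?scale1r // tofrac_eq0.
Qed.
Lemma in_span0 s : in_span s 0.
Proof. by rewrite /in_span frac_row0 sub0mx. Qed.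
Lemma in_span_cons s (X : fvfield K n) Y : in_span s Y -> in_span (X :: s) Y.
Proof. by move=> h; apply: (submx_trans h); apply: addsmxSl. Qed.
Lemma in_span_head s (X : fvfield K n) : in_span (X :: s) X.
Proof. exact: addsmxSr. Qed.
Lemma in_span_nil Y : in_span [::] Y -> Y = 0.
Proof. by rewrite /in_span submx0 => /eqP/frac_row_eq0. Qed.

(** Vector fields differentiate power series, not fractions. The coefficient of [Y] along [X] is
    therefore kept as a numerator [b] and a denominator [a], and relations are stated after
    multiplication by [a]. *)
Lemma in_span_consP s (X : fvfield K n) Y : in_span (X :: s) Y ->
  exists a b, a != 0 /\ in_span s (vf_mul a Y - vf_mul b X).
Proof.
case/sub_addsmxP => -[u1 u2] /= e.
have [a [b [a0 ab]]] := fraction_numden (u2 0 0).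
exists a, b; split=> //; rewrite /in_span frac_rowB !frac_rowM e.
rewrite [u2]mx11_scalar mul_scalar_mx scalerDr scalerA ab addrK.
by rewrite scalemx_sub // submxMl.
Qed.

Lemma fvfield_val0 : fvfield_val (0 : fvfield K n) = 0.
Proof. exact: (raddf0 (\val : fvfield K n -> ftuple)). Qed.

Variable l : set (fvfield K n).
Hypothesis l_alg : is_lie_subalgebra l.

(* Each new field is central in [l] modulo the span of the older ones. *)
Fixpoint adapted (s : seq (fvfield K n)) : Prop :=
  if s is X :: s' then
    [/\ adapted s', l X, ~ in_span s' X &
        forall Y : fvfield K n, l Y -> in_span s' (vf_bracket Y X)]
  else True.

Lemma adapted_size s : adapted s -> (size s <= n)%N.
Proof.
suff: adapted s -> (size s <= \rank (frac_span s))%N.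
  by move=> h /h/leq_trans; apply; apply: rank_leq_row.
elim: s => [|X s IHs] //= [/IHs le_s _ nX _].
apply: leq_ltn_trans le_s _; apply: rank_ltmx; rewrite ltmxE addsmxSl /=.
by apply/negP => /(submx_trans (addsmxSr _ _))/nX.
Qed.

(** By the Leibniz rule, the bracket of [X] with [a Y - b Z] expresses [a [X, Y]] through terms of
    the span: the tail is stable by induction, and [[X, Z]] falls into it because [Z] is central
    modulo the tail. *)
Lemma in_span_lie s (X : fvfield K n) (Y : ftuple) :
  adapted s -> l X -> in_span s Y -> in_span s (vf_bracket X Y).
Proof.
move=> + lX; elim: s Y => [|Z s IHs] Y /=.
  by move=> _ /in_span_nil ->; rewrite vf_bracket0r in_span0.
case=> ad lZ _ Zc sY; have [a [b [a0 /(IHs _ ad)]]] := in_span_consP sY.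
rewrite vf_bracketBr !vf_bracket_mulr => h.
apply: (in_spanMI a0).
set U := (X in in_span s X) in h.
have -> : vf_mul a (vf_bracket X Y) = U + vf_mul (vf_apply X b) Z
   + vf_mul b (vf_bracket X Z) - vf_mul (vf_apply X a) Y.
  by apply/ffunP => i; rewrite !ffunE; ring.
apply: in_spanB; last exact: in_spanM.
apply: in_spanD; last by apply/in_spanM/in_span_cons/Zc.
by apply: in_spanD; [apply: in_span_cons | apply/in_spanM/in_span_head].
Qed.

(** Here [D] is linear over the power series. The case of interest is [Z |-> a Z(b) - b Z(a)], the
    numerator of the derivative of [b / a] along [Z], which then need only be computed on
    generators. *)
Lemma in_span_derivation s (D : ftuple -> fps K n) :
  (forall a b Y Z, D (vf_mul a Y - vf_mul b Z) = a * D Y - b * D Z) ->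
  (forall X : fvfield K n, X \in s -> D X = 0) ->
  forall Y, in_span s Y -> D Y = 0.
Proof.
move=> Dlin; elim: s => [|X s IHs] D0 Y.
  move=> /in_span_nil ->; have := Dlin 0 0 0 0.
  by rewrite !mul0r !subrr.
case/in_span_consP=> a [b [a0 /IHs]].
rewrite Dlin (D0 X) ?mem_head // mulr0 subr0 => h.
apply/eqP; suff: a * D Y == 0 by rewrite mulf_eq0 (negPf a0).
by apply/eqP/h => Z sZ; apply: D0; rewrite in_cons sZ orbT.
Qed.

Lemma adapted_mem s (X : fvfield K n) : adapted s -> X \in s ->
  l X /\ forall Y : fvfield K n, l Y -> in_span s (vf_bracket Y X).
Proof.
elim: s => [|Z s IHs] //= [ad lZ _ Zc].
rewrite in_cons => /orP[/eqP ->|/(IHs ad)[lX Xc]]; split=> // Y lY.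
  by apply/in_span_cons/Zc.
by apply/in_span_cons/Xc.
Qed.

(* [b / a] is the coefficient of [Y] along [X] modulo the span of [s]; the
   conclusion says that [Z] kills it. *)
Lemma in_span_coef_const s (X Y : fvfield K n) a b Z :
  adapted (X :: s) -> l Y -> in_span s (vf_mul a Y - vf_mul b X) ->
  in_span (X :: s) Z -> a * vf_apply Z b - b * vf_apply Z a = 0.
Proof.
move=> adX lY h; move: (adX) => [ad lX nX Xc].
pose D Z' := a * vf_apply Z' b - b * vf_apply Z' a.
apply: (@in_span_derivation (X :: s) D) => {Z} [c d U V|Z].
  have actB f : vf_apply (vf_mul c U - vf_mul d V) f =
      c * vf_apply U f - d * vf_apply V f.
    rewrite -!vf_apply_mul -scaleN1r addrC vf_apply_linearl scaleN1r.
    by rewrite addrC.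
  by rewrite /D !actB; ring.
move=> sZ; have [lZ Zc] : l Z /\ in_span s (vf_bracket Z Y).
  move: sZ; rewrite in_cons => /orP[/eqP ->|/(adapted_mem ad)[lZ Zc]].
    split=> //; have -> : vf_bracket X Y = - vf_bracket Y X.
      by apply/ffunP => i; rewrite !ffunE opprB.
    by rewrite -sub0r; apply: in_spanB; [apply: in_span0 | apply: Xc].
  split=> //; have -> : vf_bracket Z Y = - vf_bracket Y Z.
    by apply/ffunP => i; rewrite !ffunE opprB.
  by rewrite -sub0r; apply: in_spanB; [apply: in_span0 | apply: Zc].
have := in_span_lie ad lZ h; rewrite vf_bracketBr !vf_bracket_mulr.
set W := (X in in_span s X) => hW.
(* [X] is independent of [s] over the fraction field, so a multiple of [X] lying in the span of [s]
   has coefficient zero. *)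
suff: in_span s (vf_mul (D Z) X).
  by have [-> //|Dn0 /(in_spanMI Dn0)] := eqVneq (D Z) 0.
have -> : vf_mul (D Z) X =
    vf_mul a (vf_mul a (vf_bracket Z Y) - vf_mul b (vf_bracket Z X) - W)
    + vf_mul (vf_apply Z a) (vf_mul a Y - vf_mul b X).
  by apply/ffunP => i; rewrite !ffunE /D; ring.
apply: in_spanD; apply: in_spanM => //.
by apply: in_spanB => //; apply: in_spanB; apply: in_spanM => //; apply: Xc.
Qed.

(** Modulo the span of [s], [Z] is [(b / a) X], so [[Y, Z]] is [Y(b / a) X + (b / a) [Y, X]]. The
    first term vanishes because [Y] kills [b / a], the second lies in the span because [X] is
    central modulo [s]. *)
Lemma in_span_bracket s (X Y Z : fvfield K n) : adapted (X :: s) ->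
  l Y -> l Z -> in_span (X :: s) Y -> in_span (X :: s) Z ->
  in_span s (vf_bracket Y Z).
Proof.
move=> adX lY lZ sY /in_span_consP[a [b [a0 h]]]; move: (adX) => [ad lX nX Xc].
have D0 := in_span_coef_const adX lZ h sY.
have := in_span_lie ad lY h; rewrite vf_bracketBr !vf_bracket_mulr.
set W := (X in in_span s X) => hW.
(* Two factors [a] are needed: the derivative of [b / a] has denominator [a ^+ 2]. *)
apply: (in_spanMI a0); apply: (in_spanMI a0).
have -> : vf_mul a (vf_mul a (vf_bracket Y Z)) =
    vf_mul a (W + vf_mul b (vf_bracket Y X))
    - vf_mul (vf_apply Y a) (vf_mul a Z - vf_mul b X)
    + vf_mul (a * vf_apply Y b - b * vf_apply Y a) X.
  by apply/ffunP => i; rewrite /W !ffunE; ring.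
rewrite D0; apply: in_spanD.
  apply: in_spanB; apply: in_spanM => //.
  by apply: in_spanD => //; apply/in_spanM/Xc.
have -> : vf_mul 0 X = 0 by apply/ffunP => i; rewrite !ffunE mul0r.
exact: in_span0.
Qed.

End LieBound.

Local Open Scope classical_set_scope.

Section LieSeriesTheory.
Variables (K : fieldType) (L : lieAlgType K).
Implicit Types A B C D : set L.

Lemma lie0l (u : L) : lie 0 u = 0.
Proof. by have := lie_linearl (-1) 0 0 u; rewrite scaler0 addr0 scaleN1r addNr. Qed.

Lemma lie_commutator_subspace A B : is_subspace (lie_commutator A B).
Proof.
split=> [S [[]] //|x u v hu hv S [sub cS]].
by case: (sub) => _; apply; [apply: hu | apply: hv].
Qed.

Lemma lie_commutator_in A B u v : A u -> B v -> lie_commutator A B (lie u v).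
Proof. by move=> Au Bv S [_]; apply; exists u => //; exists v. Qed.

Lemma lie_commutator_sub A B C : is_subspace C ->
  (forall u v, A u -> B v -> C (lie u v)) -> lie_commutator A B `<=` C.
Proof.
move=> C_sub h; apply: smallest_sub => //.
by move=> _ [u Au [v Bv <-]]; apply: h.
Qed.

Lemma lie_derived_subspace A m : is_subspace A -> is_subspace (lie_derived A m).
Proof. by case: m => // m _; apply: lie_commutator_subspace. Qed.

Lemma lie_subalgebra_sub A m : is_lie_subalgebra A ->
  lie_lower_central A m `<=` A.
Proof.
case=> subA lieA; elim: m => [|m IHm] //; apply: lie_commutator_sub => //.
by move=> u v Au /IHm; apply: lieA.
Qed.

End LieSeriesTheory.

Lemma min_nat_le (P : nat -> Prop) k n : P k -> (k <= n)%N ->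
  length_le (min_nat P) n.
Proof.
move=> Pk le_kn; rewrite /min_nat; case: pselect => [exP|[]] /=; last first.
  by exists k; apply/asboolP.
case: ex_minnP => j _ jmin; apply: leq_trans le_kn; apply: jmin.
exact/asboolP.
Qed.

(** * The length of a nilpotent Lie algebra of vector fields *)

Section NilpotentVectorFields.
Variables (K : fieldType) (n : nat) (l : set (fvfield K n)).
Hypotheses (l_alg : is_lie_subalgebra l) (l_nil : lie_nilpotent l).

(** Induction on the room [n - size s] left by [adapted_size]. If [i] is the last index at which the
    lower central series leaves the span, an element of that term outside the span can be added,
    since its brackets with [l] lie in the next term. *)
Lemma adapted_spanning : exists s, adapted l s /\ forall Y : fvfield K n, l Y -> in_span s Y.
Proof.
suff: forall j s, (n - size s <= j)%N -> adapted l s ->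
    exists s, adapted l s /\ forall Y : fvfield K n, l Y -> in_span s Y.
  by move=> /(_ n [::]); apply; rewrite ?leq_subr.
elim=> [|j IHj] s le_s ad;
  have [sp|nsp] := pselect (forall Y : fvfield K n, l Y -> in_span s Y);
  try (by exists s); have [m lcm] := l_nil.
all: have ex_m : exists m, `[< forall Y, lie_lower_central l m Y -> in_span s Y >]
  by exists m; apply/asboolP => Y; rewrite lcm => ->; apply: in_span0.
all: case: (ex_minnP ex_m) => -[|i] /asboolP hi imin; first by case: nsp.
all: have [X [lX nX]] : exists X, lie_lower_central l i X /\ ~ in_span s X.
  1,3: apply: contrapT => h; suff: (i.+1 <= i)%N by rewrite ltnn.
  1,2: apply/imin/asboolP => Y lY; apply: contrapT => nY; apply: h.
  1,2: by exists Y.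
all: have adX : adapted l (X :: s).
  1,3: split=> // [|Y lY]; first exact: (lie_subalgebra_sub l_alg lX).
  1,2: exact: (hi _ (lie_commutator_in lY lX)).
  have := adapted_size adX; rewrite /= leqNgt ltnS.
  by move: le_s; rewrite leqn0 subn_eq0 => ->.
by apply: IHj adX; rewrite /= subnS -ltnS; case: (n - size s)%N le_s.
Qed.

Lemma lie_nilpotent_derived : exists2 k, (k <= n)%N & lie_derived l k = [set 0].
Proof.
have [s [ad sp]] := adapted_spanning; exists (size s); first exact: adapted_size ad.
have [subl liel] := l_alg.
(* Each passage to the commutator drops the field added last, by [in_span_bracket], so nothing is
   left after [size s] steps. *)
suff h m : lie_derived l m `<=` [set Y | l Y /\ in_span (drop m s) Y].
  apply/seteqP; split=> [Y /h[_]|_ ->].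
    by rewrite drop_size => /in_span_nil e; apply: val_inj.
  by case: (lie_derived_subspace (size s) subl).
elim: m => [|m IHm]; first by move=> Y lY; rewrite drop0; split=> //; apply: sp.
have ad_drop : adapted l (drop m s).
  by elim: m {IHm} s ad {sp} => [|m IHm] [|X s] //= [ad _ _ _]; apply: IHm.
apply: lie_commutator_sub.
  split=> [|x Y Z [lY sY] [lZ sZ]].
    by split; [case: subl | rewrite fvfield_val0; apply: in_span0].
  split; first by case: subl => _; apply.
  rewrite fvfield_valD fvfield_valZ; apply: in_spanD => //.
  by have -> : x *: fvfield_val Y = vf_mul (x *: 1) Y;
    [apply/ffunP => i; rewrite !ffunE -scalerAl mul1r | apply: in_spanM].
move=> Y Z /IHm[lY sY] /IHm[lZ sZ]; split; first exact: liel.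
case e: (drop m s) ad_drop sY sZ => [|X s'] ad_drop sY sZ.
  have -> : Y = 0 by apply: val_inj; apply: in_span_nil sY.
  by rewrite lie0l fvfield_val0; apply: in_span0.
have -> : drop m.+1 s = s' by rewrite -add1n -drop_drop e /= drop0.
exact: in_span_bracket ad_drop lY lZ sY sZ.
Qed.

Lemma lie_nilpotent_length : length_le (lie_soluble_length l) n.
Proof. by have [k le_kn h] := lie_nilpotent_derived; apply: min_nat_le h le_kn. Qed.

End NilpotentVectorFields.

(** * Jets of operators on formal power series *)

Lemma mnm_ind n (P : 'X_{1..n} -> Prop) : P 0%MM ->
  (forall i m, P m -> P (U_(i) + m)%MM) -> forall m, P m.
Proof.
move=> P0 PU m; move: {-2}m (erefl (mdeg m)) => k; elim: (mdeg m) k => {m} [|d IHd] m.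
  by move/eqP; rewrite mdeg_eq0 => /eqP ->.
move=> deg_m; have [i mi] : exists i, m i != 0%N.
  apply: contrapT => h; suff m0 : m = 0%MM by rewrite m0 mdeg0 in deg_m.
  apply/mnmP => i; rewrite mnm0E; apply/eqP/negPn/negP => mi.
  by apply: h; exists i.
have le_im : (U_(i) <= m)%MM by rewrite lep1mP.
rewrite -(submK le_im) addmC; apply/PU/IHd/eqP.
by rewrite -eqSS -deg_m -{2}(submK le_im) mdegD mdeg1 addn1.
Qed.

Section Jets.
Variables (K : fieldType) (n N : nat).
Local Notation T := ('X_{1..n < N.+1}).
Implicit Types (a b : fps K n) (phi psi : fps K n -> fps K n).

(** The number of monomials of degree at most [N], less one: matrices then have a size of the form
    [_.+1], where they form a nonzero ring. *)
Definition jet_dim := #|{: T}|.-1.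

Fact jet_dimS : jet_dim.+1 = #|{: T}|.
Proof.
by rewrite prednK //; apply/card_gt0P; exists bm0.
Qed.

Definition jet_mon (i : 'I_jet_dim.+1) : 'X_{1..n} :=
  bmnm (enum_val (cast_ord jet_dimS i)).

Lemma jet_mon_deg i : (mdeg (jet_mon i) <= N)%N.
Proof. by rewrite -ltnS; apply: bmdeg. Qed.

Lemma jet_mon_inj : injective jet_mon.
Proof. by move=> i j /val_inj/enum_val_inj/cast_ord_inj. Qed.

Lemma jet_mon_exists m : (mdeg m <= N)%N -> exists i, jet_mon i = m.
Proof.
rewrite -ltnS => le_m; exists (cast_ord (esym jet_dimS) (enum_rank (BMultinom le_m : T))).
by rewrite /jet_mon cast_ordKV enum_rankK.
Qed.

Lemma sum_jet_mon (V : nmodType) (F : 'X_{1..n} -> V) :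
  \sum_i F (jet_mon i) = \sum_(m : T) F m.
Proof.
rewrite (reindex (fun i : 'I_jet_dim.+1 => enum_val (cast_ord jet_dimS i))) //=.
exists (fun m => cast_ord (esym jet_dimS) (enum_rank m)) => i _.
  by rewrite enum_valK cast_ordK.
by rewrite cast_ordKV enum_rankK.
Qed.

Definition jet a : 'rV[K]_jet_dim.+1 := \row_i a (jet_mon i).

Lemma jetP a b : jet a = jet b <-> fps_eqd N.+1 a b.
Proof.
split=> [/rowP e m le_m|e].
  by have [i <-] := jet_mon_exists le_m; have := e i; rewrite !mxE.
by apply/rowP => i; rewrite !mxE; apply: e; apply: jet_mon_deg.
Qed.

Definition fps_mon (m : 'X_{1..n}) : fps K n := fps_of_mpoly 'X_[m].

Lemma fps_monE (m k : 'X_{1..n}) : fps_mon m k = (m == k)%:R.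
Proof. by rewrite /= mcoeffX. Qed.

(** Rows are the jets of the images of the monomials. Matrices thus act on row vectors from the
    right, and a composite becomes the product in reversed order. *)
Definition jet_mx phi : 'M[K]_jet_dim.+1 :=
  \matrix_(i, j) phi (fps_mon (jet_mon i)) (jet_mon j).

Lemma row_jet_mx phi i : row i (jet_mx phi) = jet (phi (fps_mon (jet_mon i))).
Proof. by apply/rowP => j; rewrite !mxE. Qed.

Lemma fps_mon0 : fps_mon 0 = 1.
Proof. by apply: fpsP => m; rewrite fps_monE fps1E eq_sym. Qed.

Lemma fps_monU i m : fps_mon (U_(i) + m)%MM = fps_X K i * fps_mon m.
Proof. by rewrite /fps_mon mpolyXD fps_of_mpolyM. Qed.

Lemma fps_eqd_monomial m : fps_eqd (mdeg m) (fps_mon m) 0.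
Proof.
by move=> k lt_k; rewrite fps_monE; case: eqP lt_k => [->|//]; rewrite ltnn.
Qed.

Lemma jet_mon_delta i : jet (fps_mon (jet_mon i)) = delta_mx 0 i.
Proof.
by apply/rowP => j; rewrite !mxE fps_monE eqxx (inj_eq jet_mon_inj) eq_sym.
Qed.

End Jets.

Section FilteredOperators.
Variables (K : fieldType) (n : nat).
Implicit Types (a b : fps K n) (phi psi : fps K n -> fps K n).

(** Such an operator induces a matrix on each space of jets and is determined by these matrices
    ([jet_mx_inj]). *)
Definition filtered phi :=
  (forall x a b, phi (x *: a + b) = x *: phi a + phi b) /\
  (forall d a, fps_eqd d a 0 -> fps_eqd d (phi a) 0).

Lemma filtered0 phi : filtered phi -> phi 0 = 0.
Proof.
by case=> lin _; have := lin (-1) 0 0; rewrite scaler0 addr0 scaleN1r addNr.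
Qed.
Lemma filteredD phi a b : filtered phi -> phi (a + b) = phi a + phi b.
Proof. by case=> lin _; rewrite -[a in LHS]scale1r lin scale1r. Qed.
Lemma filteredZ phi x a : filtered phi -> phi (x *: a) = x *: phi a.
Proof.
by move=> h; case: (h) => lin _; rewrite -[x *: a]addr0 lin (filtered0 h) addr0.
Qed.
Lemma filteredB phi a b : filtered phi -> phi (a - b) = phi a - phi b.
Proof. by move=> h; rewrite filteredD // -scaleN1r filteredZ // scaleN1r. Qed.
Lemma filtered_sum phi I (r : seq I) (P : pred I) (F : I -> fps K n) :
  filtered phi -> phi (\sum_(i <- r | P i) F i) = \sum_(i <- r | P i) phi (F i).
Proof.
move=> h; apply: (big_morph phi) => [a b|]; first exact: filteredD.
exact: filtered0.
Qed.
Lemma filtered_eqd phi d a b :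
  filtered phi -> fps_eqd d a b -> fps_eqd d (phi a) (phi b).
Proof.
move=> h e m lt_m; apply/eqP; rewrite -subr_eq0 -fpsBE -filteredB //.
by apply/eqP/(proj2 h d) => // k lt_k; rewrite fpsBE e // subrr.
Qed.
Lemma filtered_comp phi psi :
  filtered phi -> filtered psi -> filtered (phi \o psi).
Proof.
move=> [lin1 e1] [lin2 e2]; split=> [x a b|d a /e2/e1] //=.
by rewrite lin2 lin1.
Qed.

Lemma fps_eqd_mon N a :
  fps_eqd N.+1 a (\sum_i a (jet_mon i) *: fps_mon K (@jet_mon n N i)).
Proof.
rewrite (sum_jet_mon _ (fun m => a m *: fps_mon K m)).
apply: (fps_eqd_trans (fps_eqd_trunc (d := N.+1) a)) => m lt_m.
rewrite fps_sumE /fps_trunc /= raddf_sum; apply: eq_bigr => i _.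
by rewrite -[LHS]/((a i *: 'X_[i])@_m) mcoeffZ.
Qed.

Lemma jet_filtered N phi a : filtered phi -> jet N (phi a) = jet N a *m jet_mx N phi.
Proof.
move=> h; apply/rowP => j; rewrite !mxE.
rewrite (filtered_eqd h (@fps_eqd_mon N a)) ?ltnS ?jet_mon_deg //.
rewrite filtered_sum // fps_sumE; apply: eq_bigr => i _.
by rewrite filteredZ // !mxE.
Qed.

Lemma jet_mx_comp N phi psi : filtered phi ->
  jet_mx N (phi \o psi) = jet_mx N psi *m jet_mx N phi.
Proof.
by move=> h; apply/row_matrixP => i; rewrite row_mul !row_jet_mx /= jet_filtered.
Qed.

Lemma jet_mx_ext N phi psi : phi =1 psi -> jet_mx N phi = jet_mx N psi.
Proof. by move=> e; apply/matrixP => i j; rewrite !mxE e. Qed.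

Lemma jet_mx_id N : jet_mx N (@id (fps K n)) = 1%:M.
Proof.
by apply/row_matrixP => i; rewrite row_jet_mx jet_mon_delta row1.
Qed.

Lemma jet_mx_inj phi psi : filtered phi -> filtered psi ->
  (forall N, jet_mx N phi = jet_mx N psi) -> phi =1 psi.
Proof.
move=> hphi hpsi e a; apply: fps_eqdP => -[|d]; first by move=> m.
by apply/jetP; rewrite !jet_filtered // e.
Qed.

Lemma fps_comp_filtered (g : 'I_n -> fps K n) :
  (forall i, g i 0%MM = 0) -> filtered (fps_comp g).
Proof.
move=> g0; split=> [x a b|d a a0]; first by rewrite fps_compD // fps_compZ.
by have := fps_comp_eqd g a0; rewrite fps_comp0.
Qed.

(** A derivative lowers the order by at most one, and the coefficient [X j], which vanishes at the
    origin, makes up for it. *)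
Lemma vf_apply_filtered (X : {ffun 'I_n -> fps K n}) :
  (forall i, X i 0%MM = 0) -> filtered (vf_apply X).
Proof.
move=> X0; split=> [x a b|[|d] a a0]; first by rewrite vf_applyD vf_applyZ.
  by move=> m.
move=> m lt_m; rewrite fps_sumE big1 // => j _.
apply: (@fps_eqdM0 _ _ 1 d) lt_m; first exact: fps_eqd1.
by have := fps_deriv_eqd j a0; rewrite fps_deriv0.
Qed.

End FilteredOperators.

Lemma fvfield_coef0 (K : fieldType) n (X : fvfield K n) i : X i 0%MM = 0.
Proof. by case: X => X /= /forallP/(_ i)/eqP. Qed.

Section JetRepresentation.
Variables (K : fieldType) (n N : nat).
Implicit Types (g h : fdiff K n) (X Y : fvfield K n).

Definition fdiff_op g := fps_comp (fdiff_val g).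
Definition fdiff_mx g : 'M[K]_((jet_dim n N).+1) := jet_mx N (fdiff_op g).
Definition fvfield_mx X : 'M[K]_((jet_dim n N).+1) := jet_mx N (vf_apply X).

Lemma fdiff_op_filtered g : filtered (fdiff_op g).
Proof. exact/fps_comp_filtered/fdiff_coef0. Qed.

Lemma fvfield_filtered X : filtered (vf_apply X).
Proof. exact/vf_apply_filtered/fvfield_coef0. Qed.

Lemma fdiff_opM g h a : fdiff_op (g * h)%g a = fdiff_op h (fdiff_op g a).
Proof.
rewrite /fdiff_op fps_compA; try exact: fdiff_coef0.
by congr fps_comp; apply: funext => i; rewrite ffunE.
Qed.

Lemma fdiff_op1 a : fdiff_op 1%g a = a.
Proof.
rewrite -[RHS]fps_comp_id; congr fps_comp.
by apply: funext => i; rewrite ffunE.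
Qed.

(** Substitution reverses products of diffeomorphisms, and row vectors reverse composites; the two
    reversals cancel. *)
Lemma fdiff_mxM g h : fdiff_mx (g * h)%g = fdiff_mx g * fdiff_mx h.
Proof.
rewrite -[RHS]jet_mx_comp; last exact: fdiff_op_filtered.
by apply: jet_mx_ext => a; rewrite fdiff_opM.
Qed.

Lemma fdiff_mx1 : fdiff_mx 1%g = 1.
Proof. by rewrite -[RHS]jet_mx_id; apply: jet_mx_ext => a; rewrite fdiff_op1. Qed.

Lemma fdiff_mxV g : fdiff_mx g * fdiff_mx g^-1%g = 1.
Proof. by rewrite -fdiff_mxM mulgV fdiff_mx1. Qed.
Lemma fdiff_mxVl g : fdiff_mx g^-1%g * fdiff_mx g = 1.
Proof. by rewrite -fdiff_mxM mulVg fdiff_mx1. Qed.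

Lemma fdiff_mxX g k : fdiff_mx (g ^+ k)%g = fdiff_mx g ^+ k.
Proof.
by elim: k => [|k IHk]; rewrite ?fdiff_mx1 // expgS exprS fdiff_mxM IHk.
Qed.

Lemma fvfield_mxP (x : K) X Y :
  fvfield_mx (x *: X + Y) = x *: fvfield_mx X + fvfield_mx Y.
Proof.
apply/matrixP => i j; rewrite !mxE fvfield_valD fvfield_valZ.
by rewrite vf_apply_linearl.
Qed.

Lemma fvfield_mx0 : fvfield_mx 0 = 0.
Proof. by have := fvfield_mxP (-1) 0 0; rewrite scaler0 addr0 scaleN1r addNr. Qed.

(** Vector fields undergo only the reversal due to row vectors, so their bracket becomes the
    opposite commutator of matrices. *)
Lemma fvfield_mx_lie X Y :
  fvfield_mx (lie X Y) = fvfield_mx Y * fvfield_mx X - fvfield_mx X * fvfield_mx Y.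
Proof.
rewrite -!mulmxE -!jet_mx_comp; try exact: fvfield_filtered.
by apply/matrixP => i j; rewrite !mxE /= vf_apply_bracket.
Qed.

End JetRepresentation.

Lemma fdiff_mx_inj (K : fieldType) n (g h : fdiff K n) :
  (forall N, fdiff_mx N g = fdiff_mx N h) -> g = h.
Proof.
move=> e; apply: val_inj; apply/ffunP => i.
have f_op f : fdiff_op f (fps_X K i) = f i.
  by rewrite /fdiff_op fps_comp_X //; apply: fdiff_coef0.
rewrite -[LHS]/(g i) -f_op -[RHS]/(h i) -[RHS]f_op.
by apply: jet_mx_inj => //; apply: fdiff_op_filtered.
Qed.

Lemma vf_apply_X (K : fieldType) n (X : {ffun 'I_n -> fps K n}) i :
  vf_apply X (fps_X K i) = X i.
Proof.
have derX j : fps_deriv j (fps_X K i) = (i == j)%:R.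
  have -> : fps_deriv j (fps_X K i) = fps_of_mpoly ('X_i)^`M(j).
    by apply: fpsP => m; rewrite /= mcoeff_mderiv.
  rewrite mderivX mnm1E; apply: fpsP => m; case: eqP => [->|_].
    have -> : (U_(j) - U_(j) = 0 :> 'X_{1..n})%MM.
      by apply/mnmP => k; rewrite mnmBE subnn mnm0E.
    by rewrite mpolyX0 scale1r /= mcoeff1.
  by rewrite scale0r /= mcoeff0.
rewrite /vf_apply (bigD1 i) //= big1 => [|j /negPf ne_ji].
  by rewrite derX eqxx mulr1 addr0.
by rewrite derX eq_sym ne_ji mulr0.
Qed.

(** * Flows and logarithms of unipotent diffeomorphisms *)

Section MatrixPolynomials.
Variables (K : numFieldType) (D : nat).
Local Notation C := 'M[K]_D.+1.
Implicit Types (p q : {poly C}) (A X Y Z : C).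

(** In characteristic zero the natural numbers are infinitely many points. Identities along flows
    are thereby reduced to identities between powers. *)
Lemma poly_nat_inj (p q : {poly K}) :
  (forall j : nat, p.[j%:R] = q.[j%:R]) -> p = q.
Proof.
move=> e; apply/eqP; rewrite -subr_eq0; apply/negPn/negP => nz.
set r := p - q in nz; pose rs : seq K := [seq j%:R | j <- iota 0 (size r)].
have /(max_poly_roots nz): all (root r) rs.
  by apply/allP => _ /mapP[j _ ->]; rewrite rootE /r hornerD hornerN e subrr.
rewrite map_inj_uniq ?iota_uniq => [/(_ isT)|i j]; last first.
  by move/eqP; rewrite eqr_nat => /eqP.
by rewrite size_map size_iota ltnn.
Qed.

Definition poly_entry (a b : 'I_D.+1) p : {poly K} :=
  \poly_(i < size p) p`_i a b.

Lemma coef_poly_entry a b p i : (poly_entry a b p)`_i = p`_i a b.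
Proof.
by rewrite coef_poly; case: ltnP => // le_i; rewrite nth_default // mxE.
Qed.

Lemma horner_poly_entry a b p (j : nat) :
  (poly_entry a b p).[j%:R] = p.[j%:R] a b.
Proof.
rewrite (horner_coef_wide _ (size_poly _ _)) horner_coef summxE.
apply: eq_bigr => i _; rewrite coef_poly_entry -!natrX !mulr_natr.
by rewrite mulmxnE.
Qed.

Lemma polymx_nat_inj p q : (forall j : nat, p.[j%:R] = q.[j%:R]) -> p = q.
Proof.
move=> e; apply/polyP => i; apply/matrixP => a b.
rewrite -!coef_poly_entry.
suff -> : poly_entry a b p = poly_entry a b q by []; apply: poly_nat_inj => j.
by rewrite !horner_poly_entry e.
Qed.

(** Over a noncommutative ring, evaluation is multiplicative at points commuting with the
    coefficients, and natural numbers are central. *)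
Lemma horner_natM p q (j : nat) : (p * q).[j%:R] = p.[j%:R] * q.[j%:R].
Proof. by apply: hornerM_comm; apply/commr_sym/commr_nat. Qed.

Lemma deriv_poly_entry a b p : (poly_entry a b p)^`() = poly_entry a b p^`().
Proof.
by apply/polyP => i; rewrite coef_deriv !coef_poly_entry coef_deriv mulmxnE.
Qed.

Definition is_flow A p := forall j : nat, p.[j%:R] = A ^+ j.

(** Newton's binomial series for [A ^ t] in powers of [A - 1], finite because [A - 1] is nilpotent;
    [ff i] is the falling factorial of [t]. *)
Lemma flow_exists A M : (A - 1) ^+ M = 0 -> exists p, is_flow A p.
Proof.
move=> AM; pose ff i : {poly C} := \prod_(l < i) ('X - l%:R%:P).
have ffE i (j : nat) : (ff i).[j%:R] = (j ^_ i)%:R.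
  rewrite /ff; elim: i => [|i IHi]; first by rewrite big_ord0 hornerC.
  rewrite big_ord_recr horner_natM IHi ffactnSr hornerXsubC natrM.
  have [le_ij|lt_ji] := leqP i j; first by rewrite natrB.
  by rewrite ffact_small // !mul0r.
exists (\sum_(i < M) ff i * (i`!%:R^-1 *: (A - 1) ^+ i)%:P) => j.
rewrite horner_sum.
transitivity (\sum_(i < M) (A - 1) ^+ i *+ 'C(j, i)).
  apply: eq_bigr => i _; rewrite horner_natM ffE hornerC.
  rewrite -scalerAr mulr_natl -bin_ffact mulrnA.
  by rewrite -[X in _ *: X]scaler_nat scalerA mulVf ?scale1r // pnatr_eq0 -lt0n fact_gt0.
rewrite -[A in RHS](subrK 1) exprD1n.
pose F i := (A - 1) ^+ i *+ 'C(j, i).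
have F0M i : (M <= i)%N -> F i = 0.
  by move=> /subnK <-; rewrite /F addnC exprD AM mul0r mul0rn.
have F0j i : (j < i)%N -> F i = 0 by move=> lt_ji; rewrite /F bin_small.
rewrite -[LHS](big_mkord xpredT F) -[RHS](big_mkord xpredT F).
have split_sum c : (c <= M + j.+1)%N -> (forall i, (c <= i)%N -> F i = 0) ->
    \sum_(0 <= i < c) F i = \sum_(0 <= i < M + j.+1) F i.
  move=> le_c F0; rewrite [RHS](@big_cat_nat _ _ _ c) //=.
  by rewrite [X in _ = _ + X]big_nat_cond [X in _ = _ + X]big1 ?addr0 // => i
    /andP[/andP[/F0]].
by rewrite !split_sum ?leq_addr ?leq_addl.
Qed.

(** Differentiate [A ^ (i + s) = A ^ i * A ^ s] at [s = 0], entry by entry. The coefficient of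
    degree one plays the role of [log A]. *)
Lemma flow_deriv A p : is_flow A p -> p^`() = p * (p`_1)%:P.
Proof.
move=> hp; apply: polymx_nat_inj => i; apply/matrixP => a b.
rewrite horner_natM hp hornerC mxE -horner_poly_entry -deriv_poly_entry.
have e : poly_entry a b p \Po ('X + i%:R%:P) =
    \sum_c (A ^+ i) a c *: poly_entry c b p.
  apply: poly_nat_inj => j; rewrite horner_comp !hornerE -natrD.
  rewrite horner_poly_entry hp addnC exprD mxE horner_sum.
  by apply: eq_bigr => c _; rewrite hornerZ horner_poly_entry hp.
have /(congr1 (fun q : {poly K} => q^`().[0])) := e.
rewrite deriv_comp derivD derivX derivC addr0 mulr1 horner_comp !hornerE => ->.
rewrite raddf_sum /= horner_sum; apply: eq_bigr => c _.
by rewrite derivZ hornerZ horner_coef0 coef_deriv coef_poly_entry mulr1n.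
Qed.

Lemma flow_coef0 A p : is_flow A p -> p`_0 = 1.
Proof. by move=> /(_ 0); rewrite horner_coef0 expr0. Qed.

Lemma flow_mul A B p q : A * B = 1 -> B * A = 1 ->
  is_flow A p -> is_flow B q -> p * q = 1.
Proof.
move=> AB BA hp hq; apply: polymx_nat_inj => j.
rewrite horner_natM hp hq hornerC -exprMn_comm ?AB ?expr1n //.
by rewrite /GRing.comm AB BA.
Qed.

End MatrixPolynomials.

Definition jet_unipotent (K : fieldType) n (g : fdiff K n) :=
  forall N, exists M, (fdiff_mx N g - 1) ^+ M = 0.

(** The Leibniz rule determines a derivation on monomials from its values on the coordinates;
    respect for the order extends the agreement to all power series. *)
Lemma derivation_vf (K : fieldType) n (D : fps K n -> fps K n)
    (X : {ffun 'I_n -> fps K n}) :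
  filtered D -> (forall a b, D (a * b) = D a * b + a * D b) ->
  (forall i, X i = D (fps_X K i)) -> D =1 vf_apply X.
Proof.
move=> hD DM DX.
have X0 i : X i 0%MM = 0.
  rewrite DX; have := proj2 hD 1 (fps_X K i); apply.
    by apply: fps_eqd1; rewrite /= mcoeffX mnm1_eq0.
  by rewrite mdeg0.
have hX := vf_apply_filtered X0.
have D1 : D 1 = 0.
  by have := DM 1 1; rewrite !mulr1 mul1r => /eqP; rewrite -subr_eq0 opprD addrA
    subrr sub0r oppr_eq0 => /eqP.
have X1 : vf_apply X 1 = 0.
  have := vf_applyM X 1 1; rewrite !mulr1 mul1r => /eqP.
  by rewrite -subr_eq0 opprD addrA subrr sub0r oppr_eq0 => /eqP.
have mon m : D (fps_mon K m) = vf_apply X (fps_mon K m).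
  elim/mnm_ind: m => [|i m IHm]; first by rewrite fps_mon0 D1 X1.
  by rewrite fps_monU DM vf_applyM IHm -DX vf_apply_X.
apply: jet_mx_inj => // N; apply/matrixP => i j.
by rewrite !mxE mon.
Qed.

Section Logarithm.
Variables (K : numFieldType) (n : nat) (u : fdiff K n).
Hypothesis u_unip : jet_unipotent u.
Implicit Types (a b : fps K n) (m : 'X_{1..n}).

(** The coefficient at [m] depends only on the jet of order [mdeg m], where the powers of [u] are
    interpolated by a matrix flow. *)
Lemma orbit_poly_exists a m : exists p : {poly K},
  forall j : nat, p.[j%:R] = fdiff_op (u ^+ j)%g a m.
Proof.
have [M uM] := u_unip (mdeg m); have [E hE] := flow_exists uM.
have [i def_m] := @jet_mon_exists n (mdeg m) m (leqnn _).
exists (\sum_k jet (mdeg m) a 0 k *: poly_entry k i E) => j.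
rewrite horner_sum.
have := jet_filtered (mdeg m) a (fdiff_op_filtered (u ^+ j)%g).
move/(congr1 (fun v : 'rV_ _ => v 0 i)); rewrite !mxE def_m => ->.
apply: eq_bigr => k _; rewrite hornerZ horner_poly_entry hE.
by rewrite -[jet_mx _ _]/(fdiff_mx _ _) fdiff_mxX.
Qed.

Definition orbit_poly a m : {poly K} := sval (cid (orbit_poly_exists a m)).

Lemma orbit_polyE a m j : (orbit_poly a m).[j%:R] = fdiff_op (u ^+ j)%g a m.
Proof. by rewrite /orbit_poly; case: cid. Qed.

Lemma orbit_poly_uniq a m (p : {poly K}) :
  (forall j : nat, p.[j%:R] = fdiff_op (u ^+ j)%g a m) -> orbit_poly a m = p.
Proof. by move=> h; apply: poly_nat_inj => j; rewrite orbit_polyE h. Qed.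

Lemma orbit_poly_coef0 a m : (orbit_poly a m)`_0 = a m.
Proof.
rewrite -horner_coef0 -[0 in LHS]/(0%:R) orbit_polyE.
by rewrite -[a in RHS]fdiff_op1.
Qed.

(* The derivative of [a \o u ^ t] at [t = 0], that is, [log u] applied to [a]. *)
Definition log_op a : fps K n := Fps (fun m => (orbit_poly a m)`_1).

Lemma log_op_filtered : filtered log_op.
Proof.
split=> [x a b|d a a0].
  apply: fpsP => m; rewrite fpsDE fpsZE /=.
  rewrite (@orbit_poly_uniq _ _ (x *: orbit_poly a m + orbit_poly b m)).
    by rewrite coefD coefZ.
  move=> j; rewrite hornerD hornerZ !orbit_polyE.
  by rewrite (proj1 (fdiff_op_filtered _)) fpsDE fpsZE.
move=> m lt_m /=; rewrite (@orbit_poly_uniq _ _ 0) ?coef0 // => j.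
by rewrite horner0 (proj2 (fdiff_op_filtered _) _ _ a0).
Qed.

(** Compare the coefficients of degree one in [t] when [u ^ t] is substituted into [a * b]:
    substitution is multiplicative. *)
Lemma log_opM a b : log_op (a * b) = log_op a * b + a * log_op b.
Proof.
apply: fpsP => m; rewrite fpsDE !fpsME /=.
rewrite (@orbit_poly_uniq _ _ (\sum_(k : 'X_{1..n < (mdeg m).+1, (mdeg m).+1}
    | m == (k.1 + k.2)%MM) orbit_poly a k.1 * orbit_poly b k.2)).
  rewrite coef_sum -big_split; apply: eq_bigr => k _.
  rewrite coefM big_ord_recl big_ord1 /= subn0 subnn !orbit_poly_coef0.
  by rewrite addrC.
move=> j; rewrite horner_sum /fdiff_op fps_compM; last exact: fdiff_coef0.
by rewrite fpsME; apply: eq_bigr => k _; rewrite hornerM !orbit_polyE.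
Qed.

Fact log_vf_subproof : [ffun i => log_op (fps_X K i)] \in @vanish0 K n.
Proof.
apply/forallP => i; rewrite ffunE; apply/eqP.
have := proj2 log_op_filtered 1 (fps_X K i); apply; last by rewrite mdeg0.
by apply: fps_eqd1; rewrite /= mcoeffX mnm1_eq0.
Qed.
Definition fdiff_log : fvfield K n := Fvfield log_vf_subproof.

Lemma fdiff_log_flow N (E : {poly 'M[K]_((jet_dim n N).+1)}) :
  is_flow (fdiff_mx N u) E -> E`_1 = fvfield_mx N fdiff_log.
Proof.
move=> hE; apply/matrixP => i j; rewrite mxE.
rewrite -(derivation_vf log_op_filtered log_opM) => [|k]; last by rewrite ffunE.
rewrite -coef_poly_entry /=; congr (_ `_ 1); symmetry; congr (polyseq _).
apply: orbit_poly_uniq => k; rewrite horner_poly_entry hE -fdiff_mxX mxE.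
by [].
Qed.

End Logarithm.

(** * Series of groups and Lie algebras *)

Section GroupSeriesTheory.
Variable G : groupType.
Implicit Types (A B C : set G) (x y z : G).
Local Open Scope group_scope.

Lemma grp_commutator_subgroup A B : is_subgroup (grp_commutator A B).
Proof.
split=> [S [[]]|x y hx hy S cS|x hx S cS] //; have [[S1 SM SV] _] := cS.
  by apply: SM; [apply: hx | apply: hy].
by apply: SV; apply: hx.
Qed.

Lemma grp_commutator_in A B x y : A x -> B y -> grp_commutator A B [~ x, y].
Proof. by move=> Ax By S [_]; apply; exists x => //; exists y. Qed.

Lemma grp_commutator_sub A B C : is_subgroup C ->
  (forall x y, A x -> B y -> C [~ x, y]) -> grp_commutator A B `<=` C.
Proof.
move=> C_sub h; apply: smallest_sub => //.
by move=> _ [u Au [v Bv <-]]; apply: h.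
Qed.

Lemma grp_commutatorS A A' B B' : A `<=` A' -> B `<=` B' ->
  grp_commutator A B `<=` grp_commutator A' B'.
Proof.
move=> sA sB; apply: grp_commutator_sub; first exact: grp_commutator_subgroup.
by move=> x y /sA Ax /sB By; apply: grp_commutator_in.
Qed.

Lemma grp_derivedS A B m : A `<=` B -> grp_derived A m `<=` grp_derived B m.
Proof. by move=> sAB; elim: m => //= m IHm; apply: grp_commutatorS. Qed.

Lemma grp_lower_centralS A B m : A `<=` B ->
  grp_lower_central A m `<=` grp_lower_central B m.
Proof. by move=> sAB; elim: m => //= m IHm; apply: grp_commutatorS. Qed.

Lemma grp_derived_subgroup A m : is_subgroup A -> is_subgroup (grp_derived A m).
Proof. by case: m => // m _; apply: grp_commutator_subgroup. Qed.

Lemma grp_lower_central_subgroup A m :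
  is_subgroup A -> is_subgroup (grp_lower_central A m).
Proof. by case: m => // m _; apply: grp_commutator_subgroup. Qed.

Lemma subgroup_comm A x y : is_subgroup A -> A x -> A y -> A [~ x, y].
Proof.
case=> _ AM AV Ax Ay.
by apply: (AM _ _ (AV _ Ax)); apply: (AM _ _ (AV _ Ay)); apply: AM.
Qed.

Lemma grp_lower_central_sub A m : is_subgroup A -> grp_lower_central A m `<=` A.
Proof.
move=> hA; elim: m => //= m IHm; apply: grp_commutator_sub => // x y Ax /IHm.
exact: subgroup_comm.
Qed.

Lemma grp_derived_sub A m : is_subgroup A -> grp_derived A m `<=` A.
Proof.
move=> hA; elim: m => //= m IHm; apply: grp_commutator_sub => // x y /IHm Ax /IHm.
exact: subgroup_comm.
Qed.

Lemma grp_derived_add A i j : grp_derived A (i + j) = grp_derived (grp_derived A j) i.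
Proof. by rewrite /grp_derived iterD. Qed.

Lemma grp_derivedSn A m : is_subgroup A -> grp_derived A m.+1 `<=` grp_derived A m.
Proof.
move=> hA; rewrite -(add1n m) grp_derived_add.
by apply: grp_derived_sub; apply: grp_derived_subgroup.
Qed.

Lemma grp_nilpotentS A B : is_subgroup A -> A `<=` B ->
  grp_nilpotent B -> grp_nilpotent A.
Proof.
move=> hA sAB [m Bm]; exists m; apply/seteqP; split.
  by rewrite -Bm; apply: grp_lower_centralS.
by move=> _ ->; case: (grp_lower_central_subgroup m hA).
Qed.

End GroupSeriesTheory.

(** * The Lie algebra generated by a set, filtered by the length of brackets *)

Section GeneratedLieAlgebra.
Variables (K : fieldType) (L : lieAlgType K) (S : set L).
Implicit Types (x y u v : L).

Lemma lieDr u v w : lie w (u + v) = lie w u + lie w v.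
Proof. by rewrite -[u in LHS]scale1r lie_linearr scale1r. Qed.
Lemma lieDl u v w : lie (u + v) w = lie u w + lie v w.
Proof. by rewrite -[u in LHS]scale1r lie_linearl scale1r. Qed.
Lemma lie_anti u v : lie u v = - lie v u.
Proof.
have := liexx (u + v); rewrite lieDl !lieDr !liexx add0r addr0.
by move/eqP; rewrite addr_eq0 => /eqP.
Qed.
Lemma lie0r u : lie u 0 = 0.
Proof. by rewrite lie_anti lie0l oppr0. Qed.
Lemma lieNr u v : lie u (- v) = - lie u v.
Proof. by rewrite -scaleN1r -[X in lie u X]addr0 lie_linearr lie0r addr0 scaleN1r. Qed.
Lemma lie_lie x y u : lie (lie x y) u = lie x (lie y u) - lie y (lie x u).
Proof.
have /eqP := lie_jacobi x y u; rewrite (lie_anti u (lie x y)) addr_eq0 opprK.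
by move/eqP => <-; rewrite [lie u x]lie_anti lieNr.
Qed.

(** Index [i] stands for nested brackets with [i.+1] entries from [S], so bracketing indices [i] and
    [j] yields index [(i + j).+1]. *)
Fixpoint left_normed (i : nat) : set L :=
  if i is j.+1 then [set lie x b | x in S & b in left_normed j] else S.

Definition bracket_span (i : nat) : set L :=
  smallest (@is_subspace K L) [set z | exists2 j, (i <= j)%N & left_normed j z].

Lemma bracket_span_subspace i : is_subspace (bracket_span i).
Proof.
split=> [A [[]] //|a u v hu hv A [subA cA]].
by case: (subA) => _; apply; [apply: hu | apply: hv].
Qed.

Lemma left_normed_span i j b : (i <= j)%N -> left_normed j b -> bracket_span i b.
Proof. by move=> le_ij hb A [_]; apply; exists j. Qed.

Lemma bracket_span_sub i (A : set L) : is_subspace A ->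
  (forall j b, (i <= j)%N -> left_normed j b -> A b) -> bracket_span i `<=` A.
Proof. by move=> hA h; apply: smallest_sub => // z [j]; apply: h. Qed.

Lemma bracket_span_ad i x v : S x -> bracket_span i v -> bracket_span i.+1 (lie x v).
Proof.
move=> Sx; apply: (@bracket_span_sub i (fun v => bracket_span i.+1 (lie x v))).
  have [s0 sl] := bracket_span_subspace i.+1.
  by split=> [|a u w hu hw]; rewrite ?lie0r ?lie_linearr //; apply: sl.
move=> j b le_ij hb; apply: (@left_normed_span _ j.+1) => //.
by exists x => //; exists b.
Qed.

Lemma bracket_span_leq i j : (i <= j)%N -> bracket_span j `<=` bracket_span i.
Proof.
move=> le_ij; apply: bracket_span_sub; first exact: bracket_span_subspace.
by move=> k b le_jk; apply: left_normed_span; apply: leq_trans le_jk.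
Qed.

(** Induction on [i] through the Jacobi identity [[[x, b'], v] = [x, [b', v]] - [b', [x, v]]], in
    which [b'] is shorter. *)
Lemma bracket_span_left_normed i j b v : left_normed i b -> bracket_span j v ->
  bracket_span (i + j).+1 (lie b v).
Proof.
elim: i j b v => [|i IHi] j b v; first exact: bracket_span_ad.
case=> x Sx [b' hb' <-] hv; rewrite lie_lie addSn.
have [s0 sl] := bracket_span_subspace (i + j).+2.
rewrite addrC -scaleN1r; apply: sl.
  by rewrite -addnS; apply: IHi => //; apply: bracket_span_ad.
by apply: bracket_span_ad => //; apply: IHi.
Qed.

Lemma bracket_span_lie i j u v : bracket_span i u -> bracket_span j v ->
  bracket_span (i + j).+1 (lie u v).
Proof.
move=> + hv; apply: (@bracket_span_sub i (fun u => bracket_span (i + j).+1 (lie u v))).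
  have [s0 sl] := bracket_span_subspace (i + j).+1.
  by split=> [|a w z hw hz]; rewrite ?lie0l ?lie_linearl //; apply: sl.
move=> k b le_ik hb; apply: (@bracket_span_leq _ (k + j).+1).
  by rewrite ltnS leq_add2r.
exact: bracket_span_left_normed.
Qed.

Lemma bracket_span_subalgebra : is_lie_subalgebra (bracket_span 0).
Proof.
split=> [|u v hu hv]; first exact: bracket_span_subspace.
by apply: (@bracket_span_leq _ 1) => //; apply: (@bracket_span_lie 0 0).
Qed.

Lemma bracket_span_nilpotent c : left_normed c `<=` [set 0] ->
  lie_nilpotent (bracket_span 0).
Proof.
move=> c0; have sub0 : is_subspace [set 0 : L].
  by split=> // a u v -> ->; rewrite /= scaler0 addr0.
exists c; apply/seteqP; split=> [u|_ ->]; last first.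
  by case: (c) => [|m]; [case: (bracket_span_subspace 0) | case: (lie_commutator_subspace
    (bracket_span 0) (lie_lower_central (bracket_span 0) m))].
have sub : lie_lower_central (bracket_span 0) c `<=` bracket_span c.
  elim: (c) => //= m IHm; apply: lie_commutator_sub => [|y z hy /IHm hz].
    exact: bracket_span_subspace.
  by rewrite -[m]add0n; apply: bracket_span_lie.
move/sub; apply: bracket_span_sub => // j b /subnK <-.
elim: (j - c)%N b => [|k IHk] b /=; first exact: c0.
by case=> x _ [z /IHk -> <-]; rewrite /= lie0r.
Qed.

End GeneratedLieAlgebra.

(** * Nilpotent groups of unipotent diffeomorphisms *)

Section CommutatorLinearization.
Variables (K : numFieldType) (D : nat).
Local Notation C := 'M[K]_D.+1.
Implicit Types (p q : {poly C}) (A B X Y Z : C).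

Definition commutes_with_sub (Phi : C -> C) := forall Y Z, Phi (Y - Z) = Phi Y - Phi Z.

Lemma coef1M p q : (p * q)`_1 = p`_0 * q`_1 + p`_1 * q`_0.
Proof. by rewrite coefM big_ord_recl big_ord1 /= subn0 subnn. Qed.

Lemma coef1M_unit p q : p * q = 1 -> p`_0 = 1 -> q`_0 = 1 -> q`_1 = - p`_1.
Proof.
move=> pq p0 q0; have := coef1M p q; rewrite pq p0 q0 coef1 mul1r mulr1.
by move/esym/eqP; rewrite addr_eq0 => /eqP.
Qed.

Lemma coef0M p q : (p * q)`_0 = p`_0 * q`_0.
Proof. by rewrite coefM big_ord1. Qed.

(* Differentiating [Z - A^-t Z A^t] at [t = 0]. *)
Lemma linearize_conj (Phi : C -> C) A B p q Z : commutes_with_sub Phi ->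
  A * B = 1 -> B * A = 1 -> is_flow A p -> is_flow B q ->
  (forall j : nat, Phi (Z - B ^+ j * Z * A ^+ j) = 0) ->
  Phi (p`_1 * Z - Z * p`_1) = 0.
Proof.
move=> PhiB AB BA hp hq h.
have Phi0 : Phi 0 = 0 by have := PhiB 0 0; rewrite !subrr.
have PhiN Y : Phi (- Y) = - Phi Y by rewrite -sub0r PhiB Phi0 sub0r.
have PhiD Y Y' : Phi (Y + Y') = Phi Y + Phi Y' by rewrite -{1}[Y']opprK PhiB PhiN opprK.
have PhiMn Y k : Phi (Y *+ k) = Phi Y *+ k.
  by elim: k => [|k IHk]; rewrite ?mulr0n // !mulrS PhiD IHk.
pose Q : {poly C} := Z%:P - q * Z%:P * p.
(* The additive map [Phi] commutes with evaluation at natural numbers, where [Q] takes the values in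
   the hypothesis. Its image therefore vanishes identically; the coefficient of degree one of [Q] is
   the bracket of [log A] with [Z]. *)
have /polyP/(_ 1) : map_poly Phi Q = 0.
  apply: polymx_nat_inj => j; rewrite horner0 -(h j) -hq -hp.
  have -> : Z - q.[j%:R] * Z * p.[j%:R] = Q.[j%:R].
    by rewrite hornerD hornerN !horner_natM !hornerC.
  rewrite (horner_coef_wide _ (size_poly _ _)) horner_coef.
  rewrite (big_morph Phi PhiD Phi0); apply: eq_bigr => i _.
  by rewrite coef_map_id0 // -natrX !mulr_natr PhiMn.
rewrite coef0 coef_map_id0 // coefB coefC /= sub0r => Q1.
rewrite -[RHS]Q1; congr Phi.
rewrite !coef1M coef0M !coefC /= (flow_coef0 hp) (flow_coef0 hq).
rewrite mulr0 add0r mul1r mulr1 (coef1M_unit (flow_mul AB BA hp hq)) //;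
  try exact: flow_coef0 hp; try exact: flow_coef0 hq.
by rewrite opprD mulNr opprK addrC.
Qed.

End CommutatorLinearization.

Section UnipotentLieAlgebra.
Variables (K : numFieldType) (n : nat) (U : set (fdiff K n)).
Hypotheses (U_sub : is_subgroup U) (U_nil : grp_nilpotent U).
Hypothesis U_unip : forall u, U u -> jet_unipotent u.

Definition log_set : set (fvfield K n) :=
  [set X | exists u (hu : jet_unipotent u), U u /\ X = fdiff_log hu].

Lemma jet_flow N u : U u -> exists p, is_flow (fdiff_mx N u) p.
Proof. by move=> /U_unip/(_ N)[M]; apply: flow_exists. Qed.

Section Level.
Variable N : nat.
Local Notation rho := (fdiff_mx N).
Local Notation C := 'M[K]_((jet_dim n N).+1).

(** If a curve through 1 has linear term [Z], this is the linear term of the commutator of [u] with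
    that curve. *)
Definition conj_diff (u : fdiff K n) (Z : C) := Z - rho u^-1%g * Z * rho u.

(* The iterated commutator of [us] with [w ^ t] is a polynomial in [t] that is
   [1] at all integers, hence constant; the conclusion is its linear term. *)
Lemma conj_diff_log (us : seq (fdiff K n)) w X c :
  grp_lower_central U c = [set 1%g] -> size us = c ->
  (forall u, u \in us -> U u) -> U w -> forall hw : jet_unipotent w,
  X = fdiff_log hw -> foldr conj_diff (fvfield_mx N X) us = 0.
Proof.
move=> Uc sz Uus Uw hw ->.
have Uw' : U w^-1%g by case: U_sub => _ _; apply.
have [p hp] := jet_flow N Uw; have [q hq] := jet_flow N Uw'.
rewrite -(fdiff_log_flow hw hp).
suff [p' [q' [pq p0 q0 p1 h]]] : exists p' q' : {poly C}, [/\ p' * q' = 1,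
    p'`_0 = 1, q'`_0 = 1, p'`_1 = foldr conj_diff p`_1 us &
    forall j : nat, exists2 x, grp_lower_central U (size us) x &
      p'.[j%:R] = rho x /\ q'.[j%:R] = rho x^-1%g].
  rewrite -p1 (_ : p' = 1) ?coef1 //; apply: polymx_nat_inj => j.
  have [x + [-> _]] := h j; rewrite sz Uc => ->.
  by rewrite fdiff_mx1 hornerC.
elim: us Uus {sz} => [|u us IHus] Uus.
  exists p, q; split=> //; try exact: (flow_coef0 hp); try exact: (flow_coef0 hq).
    by apply: flow_mul hp hq; [apply: fdiff_mxV | apply: fdiff_mxVl].
  move=> j; exists (w ^+ j)%g; first by elim: j => [|j IHj] /=;
    rewrite ?expgS; case: U_sub => // U1 UM _; apply: UM.
  by rewrite hp hq !fdiff_mxX // -expVgn fdiff_mxX.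
have [|p' [q' [pq p0 q0 p1 h]]] := IHus.
  by move=> x xus; apply: Uus; rewrite in_cons xus orbT.
have Uu : U u by apply: Uus; rewrite mem_head.
have uV := fdiff_mxV N u; have Vu := fdiff_mxVl N u.
have qp : q' * p' = 1.
  apply: polymx_nat_inj => j; have [x _ [ex ey]] := h j.
  by rewrite horner_natM ex ey fdiff_mxVl hornerC.
have conj1 (r : {poly C}) : r`_0 = 1 ->
    ((rho u^-1%g)%:P * r * (rho u)%:P)`_0 = 1.
  by move=> r0; rewrite !coef0M r0 !coefC /= mulr1.
(* The commutator of [u] with the curve [p'], followed by its inverse; [q'] is carried along so that
   the inverse is a polynomial too. *)
exists ((rho u^-1%g)%:P * q' * (rho u)%:P * p').
exists (q' * ((rho u^-1%g)%:P * p' * (rho u)%:P)).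
have q1 := coef1M_unit pq p0 q0.
split.
- rewrite !mulrA -(mulrA _ p' q') pq mulr1 -(mulrA _ (rho u)%:P) -polyCM uV.
  by rewrite mulr1 -(mulrA _ q' p') qp mulr1 -polyCM Vu.
- by rewrite coef0M conj1 // p0 mulr1.
- by rewrite coef0M conj1 // q0 mulr1.
- rewrite coef1M conj1 // mul1r p0 mulr1 !coef1M !coef0M !coefC /= q0 q1.
  by rewrite !mulr0 mul0r add0r addr0 p1 /conj_diff mulrN mulNr.
move=> j; have [x cx [ex ey]] := h j; exists [~ u, x]%g.
  exact: grp_commutator_in.
rewrite !horner_natM ex ey !hornerC commgEl conjgE !invgM !invgK.
by rewrite !fdiff_mxM !mulrA.
Qed.

(** The operators [conj_diff] are replaced by brackets with logarithms one at a time, the outermost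
    first; [Phi] collects those already replaced. Each replacement lets the outermost remaining [u]
    run through its powers and applies [linearize_conj]. *)
Lemma log_ad_vanish (Phi : C -> C) k (Z : C) : commutes_with_sub Phi ->
  (forall us, size us = k -> (forall u, u \in us -> U u) ->
     Phi (foldr conj_diff Z us) = 0) ->
  forall Xs, size Xs = k -> (forall X, X \in Xs -> log_set X) ->
  Phi (foldr (fun X Y => fvfield_mx N X * Y - Y * fvfield_mx N X) Z Xs) = 0.
Proof.
elim: k Phi => [|k IHk] Phi PhiB h [|X Xs] //=; first by move=> _ _; apply: (h [::]).
case=> sz SXs; have [u [hu [Uu eX]]] : log_set X by apply: SXs; rewrite mem_head.
set ad := fun X Y => fvfield_mx N X * Y - Y * fvfield_mx N X.
apply: (IHk (fun Y => Phi (ad X Y))) sz _.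
- move=> Y Y'; rewrite -PhiB; congr Phi; rewrite /ad mulrBr mulrBl.
  by rewrite !opprB addrACA [RHS]addrACA; congr (_ + _); rewrite addrC.
- move=> us szus Uus; have Uu' : U u^-1%g by case: U_sub => _ _; apply.
  have [p hp] := jet_flow N Uu; have [q hq] := jet_flow N Uu'.
  rewrite /ad eX -(fdiff_log_flow hu hp).
  apply: (linearize_conj PhiB (fdiff_mxV N u) (fdiff_mxVl N u) hp hq) => j.
  have := h ((u ^+ j)%g :: us); rewrite /= szus /conj_diff => <- //.
    by rewrite -!fdiff_mxX expVgn.
  move=> x; rewrite in_cons => /orP[/eqP ->|/Uus //].
  by elim: j => [|j IHj]; rewrite ?expgS; case: U_sub => // U1 UM _; apply: UM.
by move=> Y sY; apply: SXs; rewrite in_cons sY orbT.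
Qed.

End Level.

Lemma left_normed_foldr k Z : left_normed log_set k Z -> exists Xs X,
  [/\ size Xs = k, forall Y, Y \in Xs -> log_set Y, log_set X &
      Z = foldr (@lie K (fvfield K n)) X Xs].
Proof.
elim: k Z => [|k IHk] Z /=; first by move=> SZ; exists [::], Z.
case=> X SX [Z' /IHk[Xs [Y [sz SXs SY ->]]] <-]; exists (X :: Xs), Y.
split=> //=; first by rewrite sz.
by move=> V; rewrite in_cons => /orP[/eqP ->|/SXs].
Qed.

Lemma fvfield_mx_inj (X Y : fvfield K n) :
  (forall N, fvfield_mx N X = fvfield_mx N Y) -> X = Y.
Proof.
move=> e; apply: val_inj; apply/ffunP => i.
rewrite -[LHS]/(fvfield_val X i) -[RHS]/(fvfield_val Y i) -!vf_apply_X.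
by apply: jet_mx_inj => //; apply: fvfield_filtered.
Qed.

Lemma log_set_nilpotent : exists c, left_normed log_set c `<=` [set 0].
Proof.
have [c Uc] := U_nil; exists c => _ /left_normed_foldr[Xs [X [sz SXs SX ->]]].
apply: fvfield_mx_inj => N.
rewrite fvfield_mx0; have [w [hw [Uw eX]]] := SX.
pose ad X Y : 'M[K]_((jet_dim n N).+1) := fvfield_mx N X * Y - Y * fvfield_mx N X.
have foldr0 : foldr ad (fvfield_mx N X) Xs = 0.
  apply: (@log_ad_vanish N id c) => // us szus Uus.
  exact: (conj_diff_log N Uc szus Uus Uw eX).
(* Each bracket of vector fields costs a sign when read on matrices. *)
have : exists b : bool, fvfield_mx N (foldr (@lie K (fvfield K n)) X Xs)
    = (-1) ^+ b * foldr ad (fvfield_mx N X) Xs.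
  elim: (Xs) => [|Y Ys [b IH]] /=; first by exists false; rewrite mul1r.
  exists (~~ b); rewrite fvfield_mx_lie IH /ad; case: b {IH}; rewrite /= expr0 expr1.
    by rewrite mul1r !mulN1r mulNr mulrN opprK addrC.
  by rewrite !mul1r mulN1r opprB.
by case=> b ->; rewrite foldr0 mulr0.
Qed.

End UnipotentLieAlgebra.

(** * Polynomial curves of matrices and their logarithmic derivatives *)

Section PolynomialCurves.
Variables (K : numFieldType) (D : nat).
Local Notation C := 'M[K]_D.+1.
Implicit Types (p q r g h : {poly C}) (X Y Z : C) (a b c : set C).

Definition mx_subspace a := a 0 /\ forall (x : K) u v, a u -> a v -> a (x *: u + v).
Definition coefs_in a p := forall i, a p`_i.
Definition brackets_in a b c := forall X Y, a X -> b Y -> c (X * Y - Y * X).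

Lemma mx_subspaceD a u v : mx_subspace a -> a u -> a v -> a (u + v).
Proof. by case=> _ al au av; rewrite -[u]scale1r; apply: al. Qed.
Lemma mx_subspaceZ a x u : mx_subspace a -> a u -> a (x *: u).
Proof. by case=> a0 al au; rewrite -[x *: u]addr0; apply: al. Qed.
Lemma mx_subspaceN a u : mx_subspace a -> a u -> a (- u).
Proof. by move=> al au; rewrite -scaleN1r; apply: mx_subspaceZ. Qed.
Lemma mx_subspace_sum a I (s : seq I) (P : pred I) (F : I -> C) : mx_subspace a ->
  (forall i, P i -> a (F i)) -> a (\sum_(i <- s | P i) F i).
Proof.
move=> ha h; elim/big_ind: _ => //; first by case: ha.
by move=> x y; apply: mx_subspaceD.
Qed.

Lemma coefs_inD a p q : mx_subspace a -> coefs_in a p -> coefs_in a q ->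
  coefs_in a (p + q).
Proof. by move=> ha hp hq i; rewrite coefD; apply: mx_subspaceD. Qed.
Lemma coefs_inN a p : mx_subspace a -> coefs_in a p -> coefs_in a (- p).
Proof. by move=> ha hp i; rewrite coefN; apply: mx_subspaceN. Qed.

(* [h] is the inverse of the polynomial curve [g] through [1]; the last two
   conditions bear on its left and right logarithmic derivatives. *)
Definition curve_in a g h :=
  [/\ g * h = 1, h * g = 1, g`_0 = 1, coefs_in a (h * g^`()) &
      coefs_in a (g^`() * h)].

Lemma curve_coef0 a g h : curve_in a g h -> h`_0 = 1.
Proof.
case=> gh _ g0 _ _; have := coef0M g h.
by rewrite gh g0 mul1r coef1 /= => <-.
Qed.

Lemma curve_derivV a g h : curve_in a g h -> h^`() = - (h * g^`() * h).
Proof.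
case=> gh hg _ _ _; have := congr1 (fun p => p^`() * h) hg.
rewrite derivM derivC mul0r mulrDl -mulrA gh mulr1.
by move/eqP; rewrite addr_eq0 => /eqP.
Qed.

Lemma curve_inV a g h : mx_subspace a -> curve_in a g h -> curve_in a h g.
Proof.
move=> ha hgh; have hd := curve_derivV hgh; have h0 := curve_coef0 hgh.
case: hgh => gh hg g0 l r; split=> //; rewrite hd.
  by rewrite mulrN !mulrA gh mul1r; apply: coefs_inN.
by rewrite mulNr -!mulrA hg mulr1; apply: coefs_inN.
Qed.

(** The conjugate [rho] of [Y] solves [rho' = rho * lam - lam * rho] with [lam] in [a]. Its
    coefficients are thus obtained recursively from brackets, which lie in [c]; only the constant
    term [Y] does not arise this way. *)
Lemma curve_conj a b c g h Y : mx_subspace b -> mx_subspace c -> c `<=` b ->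
  brackets_in a b c -> curve_in a g h -> b Y ->
  coefs_in c (h * Y%:P * g - Y%:P).
Proof.
move=> hb hc cb abc hgh bY; have hd := curve_derivV hgh.
have h0 := curve_coef0 hgh; case: hgh => gh hg g0 l _.
set lam := h * g^`() in l hd; pose rho := h * Y%:P * g.
have rho_deriv : rho^`() = rho * lam - lam * rho.
  rewrite /rho !derivM derivC mulr0 addr0 hd [RHS]addrC; congr (_ + _).
    by rewrite !mulNr !mulrA.
  by rewrite /lam mulrA -(mulrA _ g h) gh mulr1.
have rec i : rho`_i.+1 *+ i.+1 =
    \sum_(j < i.+1) - (lam`_(i - j) * rho`_j - rho`_j * lam`_(i - j)).
  rewrite -coef_deriv rho_deriv coefB coefM coefMr -sumrB.
  by apply: eq_bigr => j _; rewrite opprB.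
have rho0 : rho`_0 = Y by rewrite !coef0M coefC /= h0 g0 mul1r mulr1.
have step i : (forall j, (j <= i)%N -> b rho`_j) -> c rho`_i.+1.
  move=> IH; have -> : rho`_i.+1 = (i.+1%:R)^-1 *: (rho`_i.+1 *+ i.+1).
    by rewrite -scaler_nat scalerA mulVf ?scale1r // pnatr_eq0.
  rewrite rec; apply: mx_subspaceZ => //; apply: mx_subspace_sum => // j _.
  apply: mx_subspaceN => //; apply: abc; first exact: l.
  by apply: IH; rewrite -ltnS.
have brho i : b rho`_i.
  elim/ltn_ind: i => -[|i] IH; first by rewrite rho0.
  exact/cb/step.
case=> [|i]; rewrite coefB coefC /=; first by rewrite -/rho rho0 subrr; case: hc.
by rewrite subr0; apply: step.
Qed.

Lemma curve_conj_poly a b c g h p : mx_subspace b -> mx_subspace c -> c `<=` b ->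
  brackets_in a b c -> curve_in a g h -> coefs_in b p ->
  coefs_in c (h * p * g - p).
Proof.
move=> hb hc cb abc hgh bp.
rewrite -[p](coefK p) poly_def mulr_sumr mulr_suml -sumrB => i.
rewrite coef_sum; apply: mx_subspace_sum => // j _.
have -> : h * (p`_j *: 'X^j) * g - p`_j *: 'X^j =
    (h * (p`_j)%:P * g - (p`_j)%:P) * 'X^j.
  by rewrite -!mul_polyC mulrBl -!mulrA (commr_polyXn g j).
rewrite coefMXn; case: ifP => _; first by case: hc.
exact: (curve_conj hb hc cb abc hgh (bp j)).
Qed.

Lemma curve_inM a g h g' h' : mx_subspace a -> brackets_in a a a ->
  curve_in a g h -> curve_in a g' h' -> curve_in a (g * g') (h' * h).
Proof.
move=> ha haa c1 c2; have V1 := curve_inV ha c1.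
have conj1 := curve_conj_poly ha ha (@subset_refl _ a) haa.
have h1 := conj1 _ _ _ c2; have h2 := conj1 _ _ _ V1.
case: (c1) => gh hg g0 l r; case: (c2) => gh' hg' g0' l' r'; split.
- by rewrite mulrA -(mulrA g) gh' mulr1 gh.
- by rewrite mulrA -(mulrA h') hg mulr1 hg'.
- by rewrite coef0M g0 g0' mulr1.
- rewrite derivM mulrDr; apply: coefs_inD => //.
    rewrite (_ : _ * _ = (h' * (h * g^`()) * g' - h * g^`()) + h * g^`()).
      exact: coefs_inD (h1 _ l) l.
    by rewrite subrK !mulrA.
  by rewrite !mulrA -(mulrA h') hg mulr1.
rewrite derivM mulrDl; apply: coefs_inD => //.
  by rewrite !mulrA -(mulrA _ g') gh' mulr1.
rewrite (_ : _ * _ = (g * (g'^`() * h') * h - g'^`() * h') + g'^`() * h').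
  exact: coefs_inD (h2 _ r') r'.
by rewrite subrK !mulrA.
Qed.

Lemma curve_deriv_inv g h : g * h = 1 -> g * h^`() = - (g^`() * h).
Proof.
move=> gh; apply/eqP; rewrite -addr_eq0 addrC -derivM gh.
by rewrite derivC.
Qed.

Section Commutator.
Variables (a c : set C).
Hypotheses (ha : mx_subspace a) (hc : mx_subspace c) (ca : c `<=` a).
Hypothesis aac : brackets_in a a c.

Let aaa : brackets_in a a a. Proof. by move=> X Y aX aY; apply/ca/aac. Qed.
Let acc : brackets_in a c c. Proof. by move=> X Y aX /ca; apply: aac. Qed.

(** The logarithmic derivative of a product is that of the second factor plus a conjugate of that of
    the first, and this conjugation is trivial modulo [c]. *)
Lemma curve_dlogM g h g' h' : curve_in a g h -> curve_in a g' h' ->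
  coefs_in c ((h' * h) * (g * g')^`() - (h * g^`() + h' * g'^`())).
Proof.
move=> c1 c2; case: (c1) => gh hg _ l _.
have := curve_conj_poly ha hc ca aac c2 l.
rewrite derivM mulrDr !mulrA -(mulrA h' h g) hg mulr1.
by rewrite opprD addrACA subrr addr0.
Qed.

Lemma curve_dlogV g h : curve_in a g h -> coefs_in c (g * h^`() + h * g^`()).
Proof.
move=> c1; case: (c1) => gh hg _ _ r.
have := curve_conj_poly ha hc ca aac c1 r.
by rewrite (curve_deriv_inv gh) mulrA -mulrA hg mulr1 addrC.
Qed.

Lemma coefs_in_congr p q r :
  coefs_in c (q - r) -> coefs_in c (p + r) -> coefs_in c (p + q).
Proof.
move=> h1 h2; have -> : p + q = (q - r) + (p + r).
  by rewrite [p + r]addrC addrA subrK addrC.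
exact: coefs_inD.
Qed.

(** Modulo [c], logarithmic derivatives add under products and change sign under inversion, so they
    cancel in a commutator. *)
Lemma curve_in_commutator g h g' h' : curve_in a g h -> curve_in a g' h' ->
  curve_in c (h * (h' * (g * g'))) (h' * h * g' * g).
Proof.
move=> c1 c2; have V1 := curve_inV ha c1; have V2 := curve_inV ha c2.
have c3 := curve_inM ha aaa c1 c2; have c4 := curve_inM ha aaa V2 c3.
have c5 := curve_inM ha aaa V1 c4.
have l5 : coefs_in c ((h' * h * g' * g) * (h * (h' * (g * g')))^`()).
  rewrite -[X in coefs_in c X]add0r.
  apply: (coefs_in_congr (curve_dlogM V1 c4)); rewrite add0r.
  apply: (coefs_in_congr (curve_dlogM V2 c3)); rewrite addrA.
  apply: (coefs_in_congr (curve_dlogM c1 c2)); rewrite addrACA.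
  by apply: coefs_inD => //; apply: curve_dlogV.
case: (c5) => e1 e2 e3 _ _; split=> //.
(* The right logarithmic derivative is the conjugate of the left one by the curve, and this
   conjugation preserves [c]. *)
have := curve_conj_poly hc hc (@subset_refl _ c) acc (curve_inV ha c5) l5.
move/(coefs_inD hc)/(_ l5); rewrite subrK.
by rewrite !mulrA in e1 *; rewrite e1 mul1r.
Qed.

End Commutator.
End PolynomialCurves.

Lemma lie_derived_subalgebra (K : fieldType) (L : lieAlgType K) (A : set L) m :
  is_lie_subalgebra A -> is_lie_subalgebra (lie_derived A m).
Proof.
move=> hA; elim: m => // m [IHs IHl]; split; first exact: lie_commutator_subspace.
have sub : lie_derived A m.+1 `<=` lie_derived A m by apply: lie_commutator_sub.
by move=> u v /sub hu /sub hv; apply: lie_commutator_in.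
Qed.

Lemma flow_commute (K : numFieldType) D (A : 'M[K]_D.+1) p : is_flow A p ->
  p * (p`_1)%:P = (p`_1)%:P * p.
Proof.
move=> hp; have comm1 : GRing.comm (p`_1) A.
  have : p * A%:P = A%:P * p.
    apply: polymx_nat_inj => j; rewrite !horner_natM hp !hornerC.
    by rewrite -exprSr -exprS.
  by move/(congr1 (fun q : {poly _} => q`_1)); rewrite coefMC coefCM.
apply: polymx_nat_inj => j; rewrite !horner_natM hp !hornerC.
exact/esym/commrX.
Qed.

(** * The length of a nilpotent group of unipotent diffeomorphisms *)

Section UnipotentBound.
Variables (K : numFieldType) (n : nat) (U : set (fdiff K n)).
Hypotheses (U_sub : is_subgroup U) (U_nil : grp_nilpotent U).
Hypothesis U_unip : forall u, U u -> jet_unipotent u.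

Let l : set (fvfield K n) := bracket_span (log_set U) 0.

Let l_alg : is_lie_subalgebra l.
Proof. exact: bracket_span_subalgebra. Qed.

Let l_nil : lie_nilpotent l.
Proof.
by have [c] := log_set_nilpotent U_sub U_nil U_unip; apply: bracket_span_nilpotent.
Qed.

Section Level.
Variable N : nat.
Local Notation rho := (fdiff_mx N).
Local Notation C := 'M[K]_((jet_dim n N).+1).

Definition lie_mx m : set C := fvfield_mx N @` lie_derived l m.

Lemma lie_mx_subspace m : mx_subspace (lie_mx m).
Proof.
have [[s0 sl] _] := lie_derived_subalgebra m l_alg.
split=> [|x _ _ [X lX <-] [Y lY <-]]; last first.
  by rewrite -fvfield_mxP; exists (x *: X + Y) => //; apply: sl.
by exists 0 => //; apply: fvfield_mx0.
Qed.

Lemma lie_mx_brackets m : brackets_in (lie_mx m) (lie_mx m) (lie_mx m.+1).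
Proof.
move=> _ _ [X lX <-] [Y lY <-]; rewrite -fvfield_mx_lie.
by exists (lie Y X) => //; apply: lie_commutator_in.
Qed.

Lemma lie_mxS m : lie_mx m.+1 `<=` lie_mx m.
Proof.
move=> _ [X lX <-]; exists X => //; move: X lX; apply: lie_commutator_sub.
  exact: (proj1 (lie_derived_subalgebra m l_alg)).
exact: (proj2 (lie_derived_subalgebra m l_alg)).
Qed.

(* The diffeomorphisms whose [N]-jet is the end point of a polynomial curve with
   logarithmic derivative in the [m]-th derived algebra. *)
Definition integrated m : set (fdiff K n) := [set x | exists g h : {poly C},
  [/\ curve_in (lie_mx m) g h, g.[1] = rho x & h.[1] = rho x^-1%g]].

Lemma horner1M (p q : {poly C}) : (p * q).[1] = p.[1] * q.[1].
Proof. exact: (horner_natM p q 1). Qed.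

Lemma integrated_subgroup m : is_subgroup (integrated m).
Proof.
have a_sub := lie_mx_subspace m.
have aaa : brackets_in (lie_mx m) (lie_mx m) (lie_mx m).
  by move=> X Y hX hY; apply/lie_mxS/lie_mx_brackets.
split.
- exists 1, 1; rewrite invg1 fdiff_mx1 hornerC; split=> //.
  have h0 : 1^`() = 0 :> {poly C} by rewrite derivC.
  split; rewrite ?mulr1 ?coef1 // h0 ?mulr0 ?mul0r => i;
    by rewrite coef0; case: a_sub.
- move=> x y [g [h [c1 gx hx]]] [g' [h' [c2 gy hy]]].
  exists (g * g'), (h' * h); rewrite !horner1M gx gy hx hy -!fdiff_mxM invgM.
  by split=> //; apply: curve_inM.
move=> x [g [h [c1 gx hx]]]; exists h, g; rewrite invgK; split=> //.
exact: curve_inV.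
Qed.

Lemma integrated_comm m x y : integrated m x -> integrated m y ->
  integrated m.+1 [~ x, y]%g.
Proof.
move=> [g [h [c1 gx hx]]] [g' [h' [c2 gy hy]]].
exists (h * (h' * (g * g'))), (h' * h * g' * g); split.
- apply: (curve_in_commutator (lie_mx_subspace m) (lie_mx_subspace m.+1) _ _ c1 c2).
    exact: lie_mxS.
  exact: lie_mx_brackets.
- by rewrite !horner1M gx gy hx hy -!fdiff_mxM.
by rewrite !horner1M gx gy hx hy -!fdiff_mxM commgEl conjgE !invgM !invgK.
Qed.

(** The flow of [u] joins 1 to [u], and both of its logarithmic derivatives are the constant
    [log u]. *)
Lemma unipotent_integrated : U `<=` integrated 0.
Proof.
move=> u Uu; have Uu' : U u^-1%g by case: U_sub => _ _; apply.
have [p hp] := jet_flow U_unip N Uu; have [q hq] := jet_flow U_unip N Uu'.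
have uV := fdiff_mxV N u; have Vu := fdiff_mxVl N u.
have pq := flow_mul uV Vu hp hq; have qp := flow_mul Vu uV hq hp.
have X_in : coefs_in (lie_mx 0) (p`_1)%:P.
  case=> [|i]; rewrite coefC /=; last by case: (lie_mx_subspace 0).
  rewrite (fdiff_log_flow (U_unip Uu) hp); exists (fdiff_log (U_unip Uu)) => //.
  by apply: (@left_normed_span _ _ _ 0 0) => //; exists u, (U_unip Uu).
exists p, q; split; last 1 first.
- by rewrite -[1]/(1%:R) hq.
- split=> //; first exact: flow_coef0 hp.
    by rewrite (flow_deriv hp) mulrA qp mul1r.
  by rewrite (flow_deriv hp) (flow_commute hp) -mulrA pq mulr1.
by rewrite -[1]/(1%:R) hp.
Qed.

Lemma derived_integrated m : grp_derived U m `<=` integrated m.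
Proof.
elim: m => [|m IHm]; first exact: unipotent_integrated.
apply: grp_commutator_sub; first exact: integrated_subgroup.
by move=> x y /IHm hx /IHm hy; apply: integrated_comm.
Qed.

Lemma integrated0 m x : lie_derived l m = [set 0] -> integrated m x -> rho x = 1.
Proof.
move=> l0 [g [h [[gh hg g0 ll _] <- _]]].
have hg0 : h * g^`() = 0.
  apply/polyP => i; rewrite coef0; have := ll i; rewrite /lie_mx l0 image_set1 => ->.
  exact: fvfield_mx0.
have g'0 : g^`() = 0 by rewrite -[LHS]mul1r -gh -mulrA hg0 mulr0.
suff -> : g = 1 by rewrite hornerC.
apply/polyP => -[|i]; first by rewrite g0 coef1.
have := congr1 (fun p : {poly C} => p`_i) g'0; rewrite coef_deriv coef0 coef1 /=.
move=> e; have : (i.+1%:R)^-1 *: (g`_i.+1 *+ i.+1) = 0 by rewrite e scaler0.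
by rewrite -scaler_nat scalerA mulVf ?scale1r // pnatr_eq0.
Qed.

End Level.

Lemma unipotent_derived :
  exists2 k, (k <= n)%N & grp_derived U k = [set 1%g].
Proof.
have [k le_kn lk] := lie_nilpotent_derived l_alg l_nil; exists k => //.
apply/seteqP; split=> [x hx|_ ->]; last by case: (grp_derived_subgroup k U_sub).
apply: fdiff_mx_inj => N; rewrite fdiff_mx1; apply: (integrated0 lk).
exact: derived_integrated.
Qed.

End UnipotentBound.

(** * Nilpotent linear groups *)

Lemma grp_derived_conj (G : groupType) (H : set G) (y : G) k :
  (forall x, H x -> H (x ^ y)%g) ->
  forall x, grp_derived H k x -> grp_derived H k (x ^ y)%g.
Proof.
move=> hH; elim: k => [|k IHk] //= x.
apply: (@grp_commutator_sub _ _ _ (fun x => grp_commutator _ _ (x ^ y)%g)).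
  have [c1 cM cV] := grp_commutator_subgroup (grp_derived H k) (grp_derived H k).
  split=> [|u v hu hv|u hu]; rewrite ?conj1g ?conjMg ?conjVg //.
    exact: cM.
  exact: cV.
by move=> u v /IHk hu /IHk hv; rewrite conjRg; apply: grp_commutator_in.
Qed.

Lemma subgroup_expg (G : groupType) (A : set G) x k :
  is_subgroup A -> A x -> A (x ^+ k)%g.
Proof.
by case=> A1 AM _ Ax; elim: k => [|k IHk]; rewrite ?expg0 // expgS; apply: AM.
Qed.

Lemma grp_derived_leq (G : groupType) (A : set G) i j : is_subgroup A ->
  (i <= j)%N -> grp_derived A j `<=` grp_derived A i.
Proof.
move=> hA /subnK <-; elim: (j - i)%N => [|k IHk]; first by [].
by rewrite addSn; apply: subset_trans IHk; apply: grp_derivedSn.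
Qed.

(* Take [V] of maximal rank among the matrices with row space inside [P]. *)
Lemma row_subspace_mx (F : fieldType) n (P : 'rV[F]_n -> Prop) :
  P 0 -> (forall (x : F) u v, P u -> P v -> P (x *: u + v)) ->
  exists V : 'M[F]_n, forall v, P v <-> (v <= V)%MS.
Proof.
move=> P0 Plin.
pose good (V : 'M[F]_n) := forall v : 'rV_n, (v <= V)%MS -> P v.
suff h j (V : 'M[F]_n) : good V -> (n - \rank V <= j)%N ->
    exists V : 'M[F]_n, forall v, P v <-> (v <= V)%MS.
  apply: (h n 0); last exact: leq_subr.
  by move=> v; rewrite submx0 => /eqP ->.
elim: j V => [|j IHj] V gV le_j;
  have [e|ne] := pselect (forall v, P v -> (v <= V)%MS);
  try by exists V => v; split; [apply: e | apply: gV].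
all: have [w [Pw nw]] : exists w, P w /\ ~ (w <= V)%MS by
  apply: contrapT => h; apply: ne => v Pv; apply: contrapT => nv; apply: h; exists v.
all: have lt_r : (\rank V < \rank (V + w)%MS)%N by
  apply: rank_ltmx; rewrite ltmxE addsmxSl /=; apply/negP => /(submx_trans (addsmxSr _ _)).
  by have := leq_trans lt_r (rank_leq_row _); move: le_j; rewrite leqn0 subn_eq0 leqNgt => /negPf ->.
apply: (IHj (V + w)%MS) => [v|].
  case/sub_addsmxP => -[a b] /= ->; rewrite [b]mx11_scalar mul_scalar_mx addrC.
  by apply: Plin => //; apply: gV; apply: submxMl.
by move: le_j lt_r; lia.
Qed.

Section LinearRepresentations.
Variables (K : numClosedFieldType) (Gam : groupType).
Implicit Types (G H : set Gam) (n : nat) (x y : Gam).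

Definition mx_rep G n (phi : Gam -> 'M[K]_n) :=
  phi 1%g = 1%:M /\ forall x y, G x -> G y -> phi (x * y)%g = phi x *m phi y.

Lemma mx_repS G H n (phi : Gam -> 'M[K]_n) :
  H `<=` G -> mx_rep G phi -> mx_rep H phi.
Proof. by move=> sHG [p1 pM]; split=> // x y /sHG hx /sHG hy; apply: pM. Qed.

Section Fixed.
Variables (G : set Gam) (n : nat) (phi : Gam -> 'M[K]_n).
Hypotheses (G_sub : is_subgroup G) (phi_rep : mx_rep G phi).

Lemma mx_repV x : G x -> phi x *m phi x^-1%g = 1%:M.
Proof.
case: G_sub phi_rep => _ _ GV [p1 pM] Gx.
by rewrite -pM ?mulgV //; apply: GV.
Qed.

Lemma mx_repVl x : G x -> phi x^-1%g *m phi x = 1%:M.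
Proof.
case: G_sub phi_rep => _ _ GV [p1 pM] Gx.
by rewrite -pM ?mulVg //; apply: GV.
Qed.

Lemma mx_rep_unit x : G x -> phi x \in unitmx.
Proof. by move=> Gx; case: (mulmx1_unit (mx_repV Gx)). Qed.

Lemma mx_rep_comm x y : G x -> G y -> phi x *m phi y = phi y *m phi x ->
  phi [~ x, y]%g = 1%:M.
Proof.
move=> Gx Gy e; case: (G_sub) (phi_rep) => G1 GM GV [p1 pM].
have [Gx' Gy'] := (GV _ Gx, GV _ Gy).
have Gxy := GM _ _ Gx Gy; have Gy'xy := GM _ _ Gy' Gxy.
rewrite commgEl conjgE pM // pM // pM // e !mulmxA -(mulmxA (phi x^-1%g)).
by rewrite mx_repVl // mulmx1 mx_repVl.
Qed.

Lemma mx_rep_ker_subgroup : is_subgroup [set x | G x /\ phi x = 1%:M].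
Proof.
case: (G_sub) (phi_rep) => G1 GM GV [p1 pM].
split=> [//|x y [Gx ex] [Gy ey]|x [Gx ex]]; split.
- exact: GM.
- by rewrite pM // ex ey mulmx1.
- exact: GV.
by rewrite -[LHS]mul1mx -ex mx_repV.
Qed.

Lemma mx_rep_sub r (V : 'M[K]_(r, n)) : row_free V ->
  (forall x, G x -> stablemx V (phi x)) ->
  exists2 psi : Gam -> 'M[K]_r, mx_rep G psi &
    forall x, G x -> V *m phi x = psi x *m V.
Proof.
move=> fV sV; case: (G_sub) (phi_rep) => G1 GM GV [p1 pM].
pose psi x := V *m phi x *m pinvmx V.
have psiV x : G x -> V *m phi x = psi x *m V.
  by move=> Gx; rewrite mulmxKpV //; apply: sV.
exists psi => //; split=> [|x y Gx Gy]; first by rewrite /psi p1 mulmx1 mulmxVp.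
by rewrite {1}/psi pM // mulmxA psiV // -(mulmxA (psi x)) -(mulmxA (psi x)).
Qed.

Lemma mx_rep_quo r (V : 'M[K]_(r, n)) :
  (forall x, G x -> stablemx V (phi x)) ->
  exists Q : 'M[K]_(n, n - \rank V), exists2 psi : Gam -> 'M[K]_(n - \rank V),
    [/\ mx_rep G psi, row_full Q & V *m Q = 0] &
    (forall x, G x -> phi x *m Q = Q *m psi x) /\
    (forall m (W : 'M[K]_(m, n)), W *m Q = 0 -> (W <= V)%MS).
Proof.
move=> sV; rewrite -mxrank_coker; set Q := col_base (cokermx V).
have fQ : row_full Q := col_base_full _.
case: (G_sub) (phi_rep) => G1 GM GV [p1 pM].
have VQ : V *m Q = 0.
  apply: (row_free_inj (row_base_free (cokermx V))).
  by rewrite mul0mx -mulmxA mulmx_base mulmx_coker.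
have QV m (W : 'M[K]_(m, n)) : W *m Q = 0 -> (W <= V)%MS.
  by move=> WQ; rewrite submxE -[cokermx V]mulmx_base mulmxA -/Q WQ mul0mx.
pose psi x := pinvmx Q *m phi x *m Q.
have psiQ x : G x -> phi x *m Q = Q *m psi x.
  move=> Gx; apply/eqP; rewrite -subr_eq0 /psi (mulmxA Q (_ *m _)) (mulmxA Q (pinvmx Q)) -mulmxBl.
  (* [pinvmx Q] is a section of the projection [Q]; what it misses lies in [V], which is stable and
     killed by [Q]. *)
  have : ((1%:M - Q *m pinvmx Q) <= V)%MS.
    by apply: QV; rewrite mulmxBl mul1mx -mulmxA mulVpmx // mulmx1 subrr.
  move=> /(submxMr (phi x))/submx_trans/(_ (sV x Gx)) h.
  have {h} : (phi x - Q *m pinvmx Q *m phi x <= V)%MS.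
    by rewrite mulmxBl mul1mx in h.
  by case/submxP=> Z ->; rewrite -mulmxA VQ mulmx0.
exists Q, psi => //; split=> //; split=> [|x y Gx Gy].
  by rewrite /psi p1 mulmx1 mulVpmx.
rewrite {1}/psi pM // -(mulmxA (pinvmx Q)) -(mulmxA (phi x)) psiQ //.
by rewrite (mulmxA (phi x)) psiQ // -!(mulmxA Q) (mulmxA (pinvmx Q)) mulVpmx // mul1mx.
Qed.

End Fixed.
End LinearRepresentations.

(** * Elements that are central modulo scalars *)

Section TwistedCommutation.
Variables (K : numClosedFieldType) (Gam : groupType).
Variables (G : set Gam) (m : nat) (phi : Gam -> 'M[K]_m.+1) (g : Gam).
Hypotheses (G_sub : is_subgroup G) (phi_rep : mx_rep G phi) (Gg : G g).

(* For [g] central modulo scalars, [h] is twisted by the scalar of [[~ h, g]]. *)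
Definition twisted (c : K) h := phi h *m phi g = c *: (phi g *m phi h).

Lemma twistedM c d h k : G h -> G k -> twisted c h -> twisted d k ->
  twisted (c * d) (h * k)%g.
Proof.
case: (phi_rep) => p1 pM Gh Gk; rewrite /twisted => e1 e2.
rewrite pM // -mulmxA e2 -scalemxAr (mulmxA (phi h)) e1 -scalemxAl scalerA mulrC.
by rewrite mulmxA.
Qed.

Lemma twisted_neq0 c h : G h -> twisted c h -> c != 0.
Proof.
move=> Gh e; apply/eqP => c0; move: e; rewrite /twisted c0 scale0r => e.
have : phi h *m phi g \in unitmx by rewrite unitmx_mul !(mx_rep_unit G_sub phi_rep).
by rewrite e unitmxE det0 unitr0.
Qed.

Lemma twistedV c h : G h -> twisted c h -> twisted c^-1 h^-1%g.
Proof.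
move=> Gh e; have c0 := twisted_neq0 Gh e; rewrite /twisted.
have hV := mx_repV G_sub phi_rep Gh; have Vh := mx_repVl G_sub phi_rep Gh.
rewrite -[LHS]mulmx1 -hV mulmxA -(mulmxA _ (phi g)) -[_ *m phi h](scalerK c0).
rewrite -[c *: _]e -scalemxAr -scalemxAl !mulmxA Vh mul1mx.
by [].
Qed.

Lemma twisted_comm (tw : forall h, G h -> exists c, twisted c h) x y :
  G x -> G y -> twisted 1 [~ x, y]%g.
Proof.
move=> Gx Gy; case: (G_sub) => _ GM GV.
have [c ex] := tw x Gx; have [d ey] := tw y Gy.
have [Gx' Gy'] := (GV _ Gx, GV _ Gy).
have := twistedM Gx' (GM _ _ Gy' (GM _ _ Gx Gy)) (twistedV Gx ex)
  (twistedM Gy' (GM _ _ Gx Gy) (twistedV Gy ey) (twistedM Gx Gy ex ey)).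
rewrite (mulrC c d) mulKf ?mulVf //; first exact: twisted_neq0 Gx ex.
exact: twisted_neq0 Gy ey.
Qed.

Lemma twisted_conj x y c : G x -> G y -> twisted c y -> twisted 1 x ->
  twisted 1 (x ^ y)%g.
Proof.
move=> Gx Gy ey ex; case: (G_sub) => _ GM GV; have Gy' := GV _ Gy.
have := twistedM Gy' (GM _ _ Gx Gy) (twistedV Gy ey) (twistedM Gx Gy ex ey).
by rewrite mul1r mulVf // (twisted_neq0 Gy ey).
Qed.

Definition twisted_centralizer : set Gam := [set h | G h /\ twisted 1 h].

Lemma twisted_centralizer_subgroup : is_subgroup twisted_centralizer.
Proof.
case: (G_sub) (phi_rep) => G1 GM GV [p1 pM]; split.
- by split=> //; rewrite /twisted p1 mul1mx mulmx1 scale1r.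
- move=> x y [Gx ex] [Gy ey]; split; first exact: GM.
  by have := twistedM Gx Gy ex ey; rewrite mul1r.
move=> x [Gx ex]; split; first exact: GV.
by have := twistedV Gx ex; rewrite invr1.
Qed.

Lemma twisted_expg c h k : G h -> twisted c h -> twisted (c ^+ k) (h ^+ k)%g.
Proof.
move=> Gh e; elim: k => [|k IHk].
  case: (phi_rep) => p1 _.
  by rewrite /twisted expg0 p1 mul1mx mulmx1 scale1r.
by rewrite exprS expgS; apply: twistedM => //; apply: subgroup_expg.
Qed.

(** Compare determinants. Hence [m.+1]-st powers commute with [g] in the representation. *)
Lemma twisted_root c h : G h -> twisted c h -> c ^+ m.+1 = 1.
Proof.
move=> Gh /(congr1 determinant); rewrite detZ !det_mulmx [\det (phi g) * _]mulrC.
have u : \det (phi h) * \det (phi g) \is a GRing.unit.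
  by rewrite unitrM -!unitmxE !(mx_rep_unit G_sub phi_rep).
by move=> e; apply: (mulIr u); rewrite mul1r -e.
Qed.

Lemma twisted_eigenspace : ~~ is_scalar_mx (phi g) -> exists V : 'M[K]_m.+1,
  [/\ (0 < \rank V)%N, (\rank V < m.+1)%N &
      forall h, twisted_centralizer h -> stablemx V (phi h)].
Proof.
move=> nsc; have [a ea] := eigenvalue_closed (phi g) (ltn0Sn m).
exists (eigenspace (phi g) a); split.
- by rewrite lt0n mxrank_eq0.
- rewrite ltn_neqAle rank_leq_row andbT; apply: contra nsc => full.
  have /eigenspaceP : (1%:M <= eigenspace (phi g) a)%MS by rewrite sub1mx.
  by rewrite mul1mx scalemx1 => ->; apply: scalar_mx_is_scalar.
move=> h [_]; rewrite /twisted scale1r => e.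
by apply: comm_mx_stable_eigenspace; rewrite /comm_mx e.
Qed.

End TwistedCommutation.

(** [g] is taken in the last term of the lower central series that does not act by scalars, so every
    [[~ h, g]] acts by a scalar. *)
Lemma twisted_exists (K : numClosedFieldType) (Gam : groupType) (G : set Gam) n
    (phi : Gam -> 'M[K]_n) : is_subgroup G -> grp_nilpotent G -> mx_rep G phi ->
  (forall x, G x -> is_scalar_mx (phi x)) \/
  exists g, [/\ G g, ~~ is_scalar_mx (phi g) &
     forall h, G h -> exists c, phi h *m phi g = c *: (phi g *m phi h)].
Proof.
move=> G_sub [c Gc] [p1 pM].
have ex : exists k, `[< forall x, grp_lower_central G k x -> is_scalar_mx (phi x) >].
  by exists c; apply/asboolP => x; rewrite Gc => ->; rewrite p1; apply: scalar_mx_is_scalar.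
case: (ex_minnP ex) => -[|k] /asboolP hk kmin; first by left.
right; have [g [gk ng]] : exists g, grp_lower_central G k g /\ ~~ is_scalar_mx (phi g).
  apply: contrapT => h; suff: (k.+1 <= k)%N by rewrite ltnn.
  apply/kmin/asboolP => x xk; apply/negPn/negP => nx; apply: h.
  by exists x.
have Gg := grp_lower_central_sub G_sub gk; exists g; split=> // h Gh.
case: (G_sub) => _ GM GV.
have /hk/is_scalar_mxP[a ea] : grp_lower_central G k.+1 [~ h, g]%g.
  exact: grp_commutator_in.
exists a; rewrite -!pM // commgC pM //; last exact: subgroup_comm.
  by rewrite ea mul_mx_scalar.
exact: GM.
Qed.

(** In degree [m.+1], if a proper [V] is stable, [G^(m)] acts trivially on [V] and on the quotient
    by induction, hence commutatively. Otherwise, unless [G] acts by scalars, the twisted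
    centralizer [H] contains [[G, G]] and stabilizes a proper eigenspace, which [H^(m)] fixes by
    induction. As [H] is normal, the vectors fixed by [H^(m)] form a [G]-stable subspace, so the
    whole space; and [G^(m+1)] lies in [H^(m)]. *)
Lemma linear_nilpotent_derived (K : numClosedFieldType) (Gam : groupType) n
    (G : set Gam) (phi : Gam -> 'M[K]_n) :
  is_subgroup G -> grp_nilpotent G -> mx_rep G phi ->
  forall x, grp_derived G n x -> phi x = 1%:M.
Proof.
elim/ltn_ind: n => -[|m] IH in G phi *; first by move=> *; apply/matrixP => -[].
move=> G_sub G_nil phi_rep.
have [[V [V0 Vn sV]]|irr] := pselect (exists V : 'M[K]_m.+1,
    [/\ (0 < \rank V)%N, (\rank V < m.+1)%N & forall x, G x -> stablemx V (phi x)]).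
  have sW x : G x -> stablemx (row_base V) (phi x).
    by move=> Gx; rewrite stablemx_row_base; apply: sV.
  have [psi psi_rep Vpsi] := mx_rep_sub G_sub phi_rep (row_base_free V) sW.
  have [Q [chi [chi_rep fQ VQ] [Qchi QV]]] := mx_rep_quo G_sub phi_rep sV.
  have fixV x : grp_derived G m x -> V *m phi x = V.
    move=> xm; have Gx := grp_derived_sub G_sub xm.
    have psi1 : psi x = 1%:M.
      by apply: (IH _ Vn G) => //; apply: grp_derived_leq xm.
    rewrite -[V](mulmx_base V) -mulmxA -[X in _ *m X]/(row_base V *m phi x).
    by rewrite Vpsi // psi1 mul1mx.
  have fixQ x : grp_derived G m x -> (phi x - 1%:M <= V)%MS.
    move=> xm; have Gx := grp_derived_sub G_sub xm; apply: QV.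
    have chi1 : chi x = 1%:M.
      apply: (IH (m.+1 - \rank V)%N _ G) => //; first by lia.
      by apply: grp_derived_leq xm => //; lia.
    by rewrite mulmxBl Qchi // chi1 mulmx1 mul1mx subrr.
  have phiD x y : grp_derived G m x -> grp_derived G m y ->
      phi x *m phi y = phi x + phi y - 1%:M.
    move=> xm ym; have /submxP[Z eZ] := fixQ x xm.
    have : (phi x - 1%:M) *m phi y = phi x - 1%:M.
      by rewrite eZ -mulmxA fixV.
    rewrite mulmxBl mul1mx => /eqP; rewrite subr_eq => /eqP ->.
    by rewrite addrAC.
  move=> x /= xm; suff : [set x | G x /\ phi x = 1%:M] x by case.
  move: x xm; apply: grp_commutator_sub.
    exact: mx_rep_ker_subgroup G_sub phi_rep.
  move=> x y xm ym; have Gx := grp_derived_sub G_sub xm.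
  have Gy := grp_derived_sub G_sub ym; split; first exact: subgroup_comm.
  apply: (mx_rep_comm G_sub phi_rep) => //.
  by rewrite !phiD // [phi x + _]addrC.
have [sc|[g [Gg ng tw]]] := twisted_exists G_sub G_nil phi_rep.
  move=> x /(grp_derived_leq G_sub (ltn0Sn m)) xm.
  suff : [set x | G x /\ phi x = 1%:M] x by case.
  move: x xm; apply: grp_commutator_sub.
    exact: mx_rep_ker_subgroup G_sub phi_rep.
  move=> x y Gx Gy; split; first exact: subgroup_comm.
  apply: (mx_rep_comm G_sub phi_rep) => //.
  by have /is_scalar_mxP[a ->] := sc x Gx; rewrite scalar_mxC.
pose H := twisted_centralizer G phi g.
have H_sub : is_subgroup H := twisted_centralizer_subgroup G_sub phi_rep Gg.
have sHG : H `<=` G by move=> x [].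
have H_rep := mx_repS sHG phi_rep.
have [V [V0 Vn sV]] := twisted_eigenspace G ng.
have sW x : H x -> stablemx (row_base V) (phi x).
  by move=> Hx; rewrite stablemx_row_base; apply: sV.
have [psi psi_rep Vpsi] := mx_rep_sub H_sub H_rep (row_base_free V) sW.
pose P (v : 'rV[K]_m.+1) := forall x, grp_derived H m x -> v *m phi x = v.
have [|a u v Pu Pv x xm|T PT] := @row_subspace_mx K m.+1 P.
- by move=> x _; rewrite mul0mx.
- by rewrite mulmxDl -scalemxAl Pu // Pv.
have VT : (V <= T)%MS.
  rewrite -[V]mulmx_base; apply/row_subP => i; apply/PT => x xm.
  have Hx := grp_derived_sub H_sub xm.
  have psi1 : psi x = 1%:M.
    apply: (IH _ Vn H) => //; first exact: grp_nilpotentS G_nil.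
    by apply: grp_derived_leq xm.
  by rewrite row_mul -mulmxA Vpsi // psi1 mul1mx.
have sT y : G y -> stablemx T (phi y).
  move=> Gy; apply/row_subP => i; rewrite row_mul; apply/PT => x xm.
  have /PT Pi := row_sub i T; have Hx := grp_derived_sub H_sub xm.
  case: (G_sub) (phi_rep) => _ GM GV [_ pM]; have Gy' := GV _ Gy.
  have e : (y * x = x ^ y^-1 * y)%g by rewrite conjgE invgK !mulgA mulgVK.
  have xy : grp_derived H m (x ^ y^-1)%g.
    apply: grp_derived_conj xm => z [Gz tz]; have [c ty] := tw _ Gy'.
    split; first by rewrite conjgE invgK; apply: (GM _ _ Gy); apply: GM.
    exact: (twisted_conj G_sub phi_rep Gg Gz Gy' ty tz).
  have Hxy := grp_derived_sub H_sub xy.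
  rewrite -mulmxA -(pM _ _ Gy (sHG _ Hx)) e (pM _ _ (sHG _ Hxy) Gy).
  by rewrite mulmxA Pi.
have T1 : (1%:M <= T)%MS.
  rewrite sub1mx /row_full eqn_leq rank_leq_row leqNgt; apply/negP => Tn.
  by apply: irr; exists T; split=> //; apply: leq_trans V0 (mxrankS VT).
have /(congr1 (grp_derived G)) := addn1 m; rewrite grp_derived_add => eG x.
rewrite -eG => {eG} xm.
have sG1 : grp_derived G 1 `<=` H.
  apply: grp_commutator_sub => // y z Gy Gz; split; first exact: subgroup_comm.
  exact: (twisted_comm G_sub phi_rep Gg tw).
have Hx := grp_derivedS sG1 xm.
apply/row_matrixP => i; rewrite !rowE mulmx1.
have iT : ((delta_mx 0 i : 'rV[K]_m.+1) <= T)%MS.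
  exact: submx_trans (submx1 _) T1.
by have /PT -> := iT.
Qed.

(** The [n.+1]-st powers lie in the twisted centralizer, which acts on a proper eigenspace, of
    dimension [r.+1 <= n]; the exponents met along the induction divide the factorial. *)
Lemma linear_nilpotent_eigenvector (K : numClosedFieldType) (Gam : groupType) n
    (G : set Gam) (phi : Gam -> 'M[K]_n.+1) :
  is_subgroup G -> grp_nilpotent G -> mx_rep G phi ->
  exists2 v : 'rV[K]_n.+1, v != 0 &
    forall x, G x -> (v *m phi (x ^+ n.+1`!)%g <= v)%MS.
Proof.
elim/ltn_ind: n => n IH in G phi *; move=> G_sub G_nil phi_rep.
have [sc|[g [Gg ng tw]]] := twisted_exists G_sub G_nil phi_rep.
  exists (delta_mx 0 ord0).
    by apply/eqP => /rowP/(_ ord0)/eqP; rewrite !mxE !eqxx oner_eq0.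
  move=> x Gx; have /is_scalar_mxP[a ->] := sc _ (subgroup_expg n.+1`! G_sub Gx).
  by rewrite mul_mx_scalar scalemx_sub.
pose H := twisted_centralizer G phi g.
have H_sub : is_subgroup H := twisted_centralizer_subgroup G_sub phi_rep Gg.
have sHG : H `<=` G by move=> x [].
have H_rep := mx_repS sHG phi_rep.
have [V [V0 Vn sV]] := twisted_eigenspace G ng.
have sW x : H x -> stablemx (row_base V) (phi x).
  by move=> Hx; rewrite stablemx_row_base; apply: sV.
have [psi psi_rep Vpsi] := mx_rep_sub H_sub H_rep (row_base_free V) sW.
case: (\rank V) V0 Vn psi psi_rep (row_base V) (row_base_free V) Vpsi {sV sW}
  => // r _ lt_rn psi psi_rep W fW Wpsi.
have [v v0 ev] := IH r lt_rn H psi H_sub (grp_nilpotentS H_sub sHG G_nil) psi_rep.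
exists (v *m W) => [|x Gx].
  by apply: contra v0 => /eqP e; apply/eqP/(row_free_inj fW); rewrite e mul0mx.
have [q ->] : exists q, (n.+1`! = n.+1 * (r.+1`! * q))%N.
  exists (n ^_ (n - r.+1)); rewrite factS -(ffact_fact (leq_subr r.+1 n)).
  by rewrite subKn // mulnC [(_`! * _)%N]mulnC mulnC.
rewrite (expgnA x n.+1) (expgnA _ r.+1`!); set y := (x ^+ n.+1)%g.
have Hy : H y.
  split; first exact: subgroup_expg.
  have [c ex] := tw x Gx; have := twisted_expg G_sub phi_rep n.+1 Gx ex.
  by rewrite (twisted_root G_sub phi_rep Gg Gx ex).
set z := (y ^+ r.+1`!)%g; have Hz : H z by apply: subgroup_expg.
have Gz := sHG _ Hz; have stz : (v *m W *m phi z <= v *m W)%MS.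
  by rewrite -mulmxA Wpsi // mulmxA; apply: submxMr; exact: (ev y Hy).
elim: q => [|q IHq]; first by rewrite expg0 (proj1 phi_rep) mulmx1.
rewrite expgSr (proj2 phi_rep) ?mulmxA //; last exact: subgroup_expg.
exact: submx_trans (submxMr _ IHq) stz.
Qed.

(** The stabilizer [H] of the line of [v] contains the [n.+1]!-th powers, and induction applies to
    its action on the quotient by [v]; exponents multiply. *)
Lemma linear_nilpotent_trig (K : numClosedFieldType) (Gam : groupType) n
    (G : set Gam) (phi : Gam -> 'M[K]_n) :
  is_subgroup G -> grp_nilpotent G -> mx_rep G phi ->
  exists k (P : 'M[K]_n), [/\ (0 < k)%N, P \in unitmx &
    forall x, G x -> is_trig_mx (P *m phi (x ^+ k)%g *m invmx P)].
Proof.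
elim: n => [|n IHn] in G phi *.
  move=> _ _ _; exists 1%N, 1%:M; split; rewrite ?unitmx1 // => x _.
  by apply/is_trig_mxP => -[].
move=> G_sub G_nil phi_rep.
have [v v0 ev] := linear_nilpotent_eigenvector G_sub G_nil phi_rep.
pose H : set Gam := [set x | G x /\ (v *m phi x <= v)%MS].
have sHG : H `<=` G by move=> x [].
case: (G_sub) (phi_rep) => G1 GM GV [p1 pM].
have rv : \rank v = 1%N by apply/eqP; rewrite rank_rV v0.
have H_sub : is_subgroup H.
  split=> [|x y [Gx sx] [Gy sy]|x [Gx sx]].
  - by split=> //; rewrite p1 mulmx1.
  - split; first exact: GM.
    by rewrite pM // mulmxA; apply: submx_trans (submxMr _ sx) sy.
  split; first exact: GV.
  have ux := mx_rep_unit G_sub phi_rep Gx.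
  have /andP[_ sx'] : (v *m phi x == v)%MS.
    by rewrite -(mxrank_leqif_eq sx).2 mxrankMfree ?row_free_unit // eqxx.
  have := submxMr (phi x^-1%g) sx'.
  by rewrite -mulmxA (mx_repV G_sub phi_rep) // mulmx1.
have H_rep := mx_repS sHG phi_rep.
have [Q [chi [chi_rep fQ VQ] [Qchi QV]]] :=
  mx_rep_quo H_sub H_rep (fun x (hx : H x) => proj2 hx).
have dimQ : (n.+1 - \rank v = n)%N by rewrite rv subn1.
move: Q chi chi_rep fQ VQ Qchi QV; rewrite dimQ => Q chi chi_rep fQ VQ Qchi QV.
have [k [P [k0 uP tP]]] := IHn H chi H_sub (grp_nilpotentS H_sub sHG G_nil) chi_rep.
(* [R] lifts the triangularizing basis of the quotient; with [v] in front it triangularizes the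
   whole space. *)
have [R RQ] : exists R : 'M[K]_(n, n.+1), R *m Q = P.
  by exists (P *m pinvmx Q); rewrite -mulmxA mulVpmx // mulmx1.
pose S : 'M[K]_(1 + n) := col_mx v R.
have uS : S \in unitmx.
  rewrite -row_free_unit; apply/inj_row_free => w.
  rewrite -[w]hsubmxK mul_row_col => e.
  have /(congr1 (mulmx^~ Q)) := e.
  rewrite mul0mx mulmxDl -!mulmxA VQ RQ mulmx0 add0r => /(canRL (mulmxK uP)).
  rewrite mul0mx => w2; move: e; rewrite w2 mul0mx addr0.
  rewrite [lsubmx w]mx11_scalar mul_scalar_mx => /eqP.
  rewrite scaler_eq0 (negPf v0) orbF => /eqP ->.
  by rewrite raddf0 row_mx0.
exists (n.+1`! * k)%N, S; split=> // [|x Gx].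
  by rewrite muln_gt0 fact_gt0.
have Hx : H (x ^+ n.+1`!)%g by split; [apply: subgroup_expg | apply: ev].
have Hxk := subgroup_expg k H_sub Hx.
rewrite expgnA; set y := (_ ^+ k)%g in Hxk *.
have [Gy /submxP[c vy]] := Hxk.
set T := P *m chi y *m invmx P.
have /QV/submxP[u Ru] : (R *m phi y - T *m R) *m Q = 0.
  rewrite mulmxBl -(mulmxA R) Qchi // mulmxA RQ -(mulmxA T) RQ /T.
  by rewrite mulmxKV // subrr.
have -> : S *m phi y = block_mx c 0 u T *m S.
  rewrite /S mul_col_mx mul_block_col mul0mx addr0 -vy; congr col_mx.
  by rewrite -Ru subrK.
rewrite mulmxK //; suff : is_trig_mx (block_mx c 0 u T) by [].
by rewrite is_trig_block_mx // eqxx mx11_is_trig; apply: tP.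
Qed.

(** * Semisimple parts of formal diffeomorphisms *)

Section SemisimplePart.
Variables (K : numClosedFieldType) (D : nat).
Local Notation C := 'M[K]_D.+1.
Implicit Types (A B S : C) (q f : {poly K}) (rs : seq K).

(** The Chinese remainder theorem, one root at a time: the correction is a multiple of the previous
    moduli [M], and the Bezout relation gives it the right residue at [a]. *)
Lemma poly_interpolate e rs (c : K -> K) : uniq rs -> exists q,
  forall x, x \in rs -> ('X - x%:P) ^+ e %| q - (c x)%:P.
Proof.
elim: rs => [|a rs IHrs] /=; first by exists 0.
case/andP=> nars /IHrs[q0 hq0]; pose M := \prod_(x <- rs) ('X - x%:P) ^+ e.
have /Bezout_eq1_coprimepP[[u v] /= uv] : coprimep M (('X - a%:P) ^+ e).
  apply: coprimep_expr; rewrite coprimep_XsubC rootE horner_prod.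
  rewrite prodf_seq_neq0; apply/allP => x xrs /=.
  rewrite horner_exp hornerXsubC expf_neq0 // subr_eq0.
  by apply: contraNneq nars => ->.
exists (q0 + M * (u * ((c a)%:P - q0))) => x; rewrite in_cons => /orP[/eqP ->|xrs].
  have -> : q0 + M * (u * ((c a)%:P - q0)) - (c a)%:P =
      (q0 - (c a)%:P) * (1 - u * M) by ring.
  by rewrite -uv [u * M + _]addrC addrK mulrA dvdp_mulIr.
rewrite addrAC dvdp_add ?hq0 //; apply: dvdp_mulr.
by rewrite /M (big_rem x) //= dvdp_mulIl.
Qed.

Lemma dvdp_prod (I : eqType) (s : seq I) (F G : I -> {poly K}) :
  (forall i, i \in s -> F i %| G i) -> \prod_(i <- s) F i %| \prod_(i <- s) G i.
Proof.
elim: s => [|i s IHs] h; first by rewrite !big_nil.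
rewrite !big_cons dvdp_mul ?h ?mem_head // IHs // => j js.
by apply: h; rewrite in_cons js orbT.
Qed.

Lemma horner_mx_dvdp A f q : f %| q -> horner_mx A f = 0 -> horner_mx A q = 0.
Proof. by case/dvdpP=> r -> h; rewrite rmorphM /= h mulr0. Qed.

(* [q] evaluates at [A] to its semisimple part. *)
Definition jordan_poly A q :=
  (exists2 rs, uniq rs & horner_mx A (\prod_(x <- rs) (q - x%:P)) = 0) /\
  (exists e, horner_mx A ((q - 'X) ^+ e) = 0).

(** Choose [q] congruent to [x] modulo a high power of ['X - x] for every eigenvalue [x]. Both
    polynomials to be killed are then divisible by the characteristic polynomial. *)
Lemma jordan_poly_exists A : exists q, jordan_poly A q.
Proof.
have [s es] := closed_field_poly_normal (char_poly A).
rewrite (monicP (char_poly_monic A)) scale1r in es.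
pose e := (size s).+1; pose rs := undup s.
have [q hq] := poly_interpolate e id (undup_uniq s).
have zero f : (\prod_(x <- rs) ('X - x%:P) ^+ e) %| f -> horner_mx A f = 0.
  move=> hf; apply: horner_mx_dvdp (dvdp_trans _ hf) (Cayley_Hamilton A).
  rewrite es -prodr_undup_exp_count; apply: dvdp_prod => x _.
  by apply: dvdp_exp2l; apply: leq_trans (count_size _ _) (leqnSn _).
exists q; split.
  by exists rs; [apply: undup_uniq | apply/zero/dvdp_prod].
exists (\sum_(x <- rs) e)%N; apply: zero; rewrite expr_sum.
apply: dvdp_prod => x xrs; apply: dvdp_exp2r.
have -> : q - 'X = (q - x%:P) - ('X - x%:P) by ring.
by rewrite dvdp_sub // (dvdp_trans _ (hq _ xrs)) // exprS dvdp_mulIl.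
Qed.

Lemma jordan_eigenbasis A q : jordan_poly A q -> exists2 P : C, P \in unitmx &
  exists d : 'rV[K]_D.+1, P *m horner_mx A q = diag_mx d *m P.
Proof.
case=> [[rs urs hrs] _].
have : horner_mx (horner_mx A q) (\prod_(x <- rs) ('X - x%:P)) = 0.
  rewrite -hrs !rmorph_prod; apply: eq_bigr => x _.
  by rewrite /= !rmorphB /= horner_mx_X !horner_mx_C.
move/mxminpoly_min => h; have [_ /(_ (ex_intro2 _ _ rs urs h))] :=
  diagonalizableP (horner_mx A q).
case=> P uP /similar_diagPex[d]; move/(similarP uP) => e.
by exists P => //; exists d.
Qed.

Lemma eigenbasis_ext A q B B' : jordan_poly A q ->
  (forall (v : 'rV_D.+1) x, v *m horner_mx A q = x *: v -> v *m B = v *m B') -> B = B'.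
Proof.
case/jordan_eigenbasis=> P uP [d eP] h.
suff : P *m B = P *m B' by move/(can_inj (mulKmx uP)).
apply/row_matrixP => i; rewrite !row_mul; apply: (h _ (d 0 i)).
by rewrite -row_mul eP row_mul row_diag_mx -scalemxAl -rowE.
Qed.

(** With [S] the semisimple part, [S - x] is the sum of the commuting [A - x] and [S - A], so a
    power of it kills [v]. As [S] is diagonalizable, the first power does. *)
Lemma jordan_generalized A q (v : 'rV_D.+1) x M : jordan_poly A q ->
  v *m (A - x%:M) ^+ M = 0 -> v *m horner_mx A q = x *: v.
Proof.
move=> jA vM; have [P uP [d eP]] := jordan_eigenbasis jA.
case: jA => _ [e he]; set S := horner_mx A q in eP *.
have cAS : GRing.comm (A - x%:M) (S - A).
  have cS : GRing.comm A S by apply/esym/comm_horner_mx.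
  have xS B : GRing.comm B x%:M by rewrite /GRing.comm -!mulmxE scalar_mxC.
  by apply: commrB; apply/commr_sym/commrB => //; apply: commr_sym.
have nilS : (S - A) ^+ e = 0.
  by rewrite -he rmorphXn rmorphB /= horner_mx_X.
have vS : v *m (S - x%:M) ^+ (M + e) = 0.
  have -> : S - x%:M = (A - x%:M) + (S - A) by rewrite [RHS]addrC addrA subrK.
  rewrite exprDn_comm // mulmx_sumr big1 // => i _.
  have z : v *m ((A - x%:M) ^+ (M + e - i) * (S - A) ^+ i) = 0.
    have [le_ei|/ltnW le_ie] := leqP e i.
      by rewrite -(subnK le_ei) exprD nilS !mulr0 mulmx0.
    by rewrite -addnBA // exprD -!mulmxE !mulmxA vM !mul0mx.
  by rewrite -scaler_nat -scalemxAr z scaler0.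
pose w := v *m invmx P.
have ev k : v *m (S - x%:M) ^+ k = (\row_j (w 0 j * (d 0 j - x) ^+ k)) *m P.
  elim: k => [|k IHk].
    rewrite expr0 mulmx1 -[LHS](mulmxKV uP); congr (_ *m P).
    by apply/rowP => j; rewrite mxE expr0 mulr1.
  rewrite exprSr -mulmxE mulmxA IHk -mulmxA mulmxBr eP mul_mx_scalar.
  rewrite -mul_scalar_mx -mulmxBl mulmxA; congr (_ *m P).
  apply/rowP => j; rewrite mulmxBr mul_mx_scalar mul_mx_diag !mxE.
  by rewrite exprSr; ring.
have : v *m (S - x%:M) ^+ 1 = 0.
  rewrite ev; move: vS; rewrite ev => /(congr1 (mulmx^~ (invmx P))).
  rewrite mulmxK // mul0mx => /rowP h.
  rewrite [X in X *m P](_ : _ = 0) ?mul0mx //; apply/rowP => j.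
  have /eqP := h j; rewrite !mxE expr1 mulf_eq0 expf_eq0 => /orP[/eqP ->|].
    by rewrite mul0r.
  by case/andP=> _ /eqP ->; rewrite mulr0.
by rewrite expr1 mulmxBr mul_mx_scalar => /eqP; rewrite subr_eq0 => /eqP.
Qed.

(** On an eigenspace of the semisimple part [S], the operator [A - x] is [A - S], which is
    nilpotent. *)
Lemma jordan_eigenvector A q (v : 'rV_D.+1) x : jordan_poly A q ->
  v *m horner_mx A q = x *: v -> exists M, v *m (A - x%:M) ^+ M = 0.
Proof.
move=> jA vS; case: (jA) => _ [e he]; exists e; set S := horner_mx A q in vS.
have nilS : (S - A) ^+ e = 0.
  by rewrite -he rmorphXn rmorphB /= horner_mx_X.
have cAS : GRing.comm A S by apply/esym/comm_horner_mx.
have nilA : (A - S) ^+ e = 0 by rewrite -opprB exprNn nilS mulr0.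
suff [] : v *m (A - x%:M) ^+ e = v *m (A - S) ^+ e /\
    v *m (A - S) ^+ e *m S = x *: (v *m (A - S) ^+ e) by rewrite nilA mulmx0.
elim: e {he nilS nilA} => [|e [IH1 IH2]]; first by rewrite expr0 mulmx1.
rewrite !exprSr -!mulmxE !mulmxA IH1; split.
  by rewrite !mulmxBr IH2 mul_mx_scalar.
rewrite -mulmxA [X in _ *m X](_ : _ = S *m (A - S)); last first.
  by rewrite !mulmxE mulrBl mulrBr cAS.
by rewrite mulmxA IH2 -scalemxAl.
Qed.

(** The eigenspaces of the semisimple part are the generalized eigenspaces of [A], which do not
    involve [q]. This is what makes semisimple parts on jets of different orders compatible. *)
Lemma jordan_poly_uniq A q q' :
  jordan_poly A q -> jordan_poly A q' -> horner_mx A q = horner_mx A q'.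
Proof.
move=> jq jq'; apply: (eigenbasis_ext jq) => v x vS; rewrite vS.
by have [M vM] := jordan_eigenvector jq vS; rewrite (jordan_generalized jq' vM).
Qed.

(* Conjugating [A] by [B] multiplies it by [E], so the semisimple part of [A * E]
   is on the one hand [S], on the other hand the conjugate of [S] by [B]. *)
Lemma jordan_conj_comm A B B' E W q M : jordan_poly A q ->
  B * B' = 1 -> B' * B = 1 -> B' * A * B = A * E ->
  A * E = horner_mx A q * W -> GRing.comm (horner_mx A q) W -> (W - 1) ^+ M = 0 ->
  GRing.comm (horner_mx A q) B.
Proof.
move=> jA BB' B'B conjA AE cSW nilW; set S := horner_mx A q in AE cSW *.
suff e : B' * S * B = S by rewrite /GRing.comm -{2}e !mulrA BB' mul1r.
apply: (eigenbasis_ext jA) => v x vS; rewrite vS.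
(* On an eigenvector of [S], the product [S * W] acts as [x *: W], so [A * E - x] acts as a multiple
   of the nilpotent [W - 1]. *)
have vW k : v *m (A * E - x%:M) ^+ k = x ^+ k *: (v *m (W - 1) ^+ k) /\
    v *m (W - 1) ^+ k *m S = x *: (v *m (W - 1) ^+ k).
  elim: k => [|k [IH1 IH2]]; first by rewrite !expr0 mulmx1 scale1r.
  rewrite !exprSr -!mulmxE !mulmxA IH1; split.
    rewrite -scalemxAl mulmxBr mul_mx_scalar (AE : A *m E = S *m W) mulmxA IH2.
    by rewrite -scalemxAl -scalerBr -scalerA mulmxBr mulmx1.
  rewrite -mulmxA [X in _ *m X](_ : _ = S *m (W - 1)); last first.
    by rewrite !mulmxE mulrBl mulrBr cSW mulr1 mul1r.
  by rewrite mulmxA IH2 -scalemxAl.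
have BA k : v *m B' *m (A - x%:M) ^+ k = v *m (A * E - x%:M) ^+ k *m B'.
  elim: k => [|k IHk]; first by rewrite !expr0 !mulmx1.
  rewrite !exprSr -!mulmxE !mulmxA IHk -!mulmxA; congr (v *m (_ *m _)).
  rewrite !mulmxE mulrBr mulrBl -conjA -!mulrA BB' mulr1.
  by rewrite -!mulmxE scalar_mxC.
have : v *m B' *m (A - x%:M) ^+ M = 0.
  by rewrite BA (proj1 (vW M)) nilW mulmx0 scaler0 mul0mx.
move/(jordan_generalized jA) => h.
by rewrite -!mulmxE !mulmxA h -scalemxAl -mulmxA mulmxE B'B mulmx1.
Qed.

End SemisimplePart.

Lemma fps_eqd_leq (K : fieldType) n d e (a b : fps K n) :
  (d <= e)%N -> fps_eqd e a b -> fps_eqd d a b.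
Proof. by move=> le_de h m lt_m; apply: h; apply: leq_trans le_de. Qed.

Lemma fps_eqdD (K : fieldType) n d (a a' b b' : fps K n) :
  fps_eqd d a a' -> fps_eqd d b b' -> fps_eqd d (a + b) (a' + b').
Proof. by move=> ha hb m lt_m; rewrite !fpsDE ha ?hb. Qed.

Lemma fps_eqdZ (K : fieldType) n d x (a a' : fps K n) :
  fps_eqd d a a' -> fps_eqd d (x *: a) (x *: a').
Proof. by move=> ha m lt_m; rewrite !fpsZE ha. Qed.

Lemma horner_mx_sum (K : fieldType) D (A : 'M[K]_D.+1) (f : {poly K}) :
  horner_mx A f = \sum_(i < size f) f`_i *: A ^+ i.
Proof.
rewrite -{1}[f]coefK poly_def rmorph_sum; apply: eq_bigr => i _ /=.
by rewrite linearZ /= rmorphXn /= horner_mx_X.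
Qed.

Section OperatorPolynomials.
Variables (K : fieldType) (n : nat) (phi : fps K n -> fps K n).
Hypothesis phi_filt : filtered phi.
Implicit Types (a b : fps K n) (f : {poly K}).

Lemma filtered_id : filtered (@id (fps K n)).
Proof. by []. Qed.

Lemma filtered_iter i : filtered (iter i phi).
Proof.
elim: i => [|i IHi]; first exact: filtered_id.
exact: filtered_comp phi_filt IHi.
Qed.

Lemma jet_iter N i a : jet N (iter i phi a) = jet N a *m jet_mx N phi ^+ i.
Proof.
elim: i => [|i IHi]; first by rewrite expr0 mulmx1.
by rewrite iterS jet_filtered // IHi exprSr -mulmxE mulmxA.
Qed.

Lemma jet_sum N I (r : seq I) (P : pred I) (F : I -> fps K n) :
  jet N (\sum_(i <- r | P i) F i) = \sum_(i <- r | P i) jet N (F i).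
Proof.
apply: (big_morph (jet N)) => [a b|]; apply/rowP => i; rewrite !mxE //.
Qed.

Lemma jetZ N x a : jet N (x *: a) = x *: jet N a.
Proof. by apply/rowP => i; rewrite !mxE. Qed.

Definition op_poly f a := \sum_(i < size f) f`_i *: iter i phi a.

Lemma op_poly_filtered f : filtered (op_poly f).
Proof.
split=> [x a b|d a a0].
  rewrite /op_poly scaler_sumr -big_split; apply: eq_bigr => i _ /=.
  by rewrite (proj1 (filtered_iter i)) scalerDr !scalerA mulrC.
move=> m lt_m; rewrite fps_sumE big1 // => i _.
by rewrite fpsZE (proj2 (filtered_iter i) _ _ a0) // mulr0.
Qed.

Lemma jet_op_poly N f a :
  jet N (op_poly f a) = jet N a *m horner_mx (jet_mx N phi) f.
Proof.
rewrite jet_sum horner_mx_sum mulmx_sumr; apply: eq_bigr => i _.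
by rewrite jetZ jet_iter -scalemxAr.
Qed.

Lemma horner_jet_mx0 N N' f : (N' <= N)%N ->
  horner_mx (jet_mx N phi) f = 0 -> horner_mx (jet_mx N' phi) f = 0.
Proof.
move=> le_N h; apply/row_matrixP => i; rewrite rowE -jet_mon_delta -jet_op_poly.
rewrite row0; apply/rowP => j; rewrite !mxE.
have /jetP e : jet N (op_poly f (fps_mon K (jet_mon i))) = jet N 0.
  by rewrite jet_op_poly h mulmx0; apply/rowP => k; rewrite !mxE.
by rewrite e // ltnS (leq_trans _ le_N) // jet_mon_deg.
Qed.

Definition op_sub (x : K) a := phi a - x *: a.

Lemma op_sub_filtered x : filtered (op_sub x).
Proof.
split=> [y a b|d a a0]; rewrite /op_sub.
  rewrite (proj1 phi_filt) scalerDr scalerBr !scalerA mulrC opprD.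
  by rewrite addrACA.
by move=> m lt_m; rewrite fpsBE fpsZE (proj2 phi_filt _ _ a0) // a0 // mulr0 subrr.
Qed.

End OperatorPolynomials.

Lemma jordan_poly_leq (K : numClosedFieldType) n (phi : fps K n -> fps K n) N N' q :
  filtered phi -> (N' <= N)%N ->
  jordan_poly (jet_mx N phi) q -> jordan_poly (jet_mx N' phi) q.
Proof.
move=> hphi le_N [[rs urs hrs] [e he]]; split; last exists e.
  by exists rs => //; apply: horner_jet_mx0 hrs.
exact: horner_jet_mx0 he.
Qed.

Lemma jet_op_sub (K : fieldType) n (phi : fps K n -> fps K n) N x k a :
  filtered phi ->
  jet N (iter k (op_sub phi x) a) = jet N a *m (jet_mx N phi - x%:M) ^+ k.
Proof.
move=> hphi; rewrite jet_iter; last exact: op_sub_filtered.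
congr (_ *m _ ^+ k); apply/matrixP => i j.
rewrite !mxE /op_sub fpsBE fpsZE.
by rewrite fps_monE (inj_eq (@jet_mon_inj _ _)) mulr_natr.
Qed.

(* The gain in order is that of either factor; with [d = e = 0] this says that
   generalized eigenvectors multiply to generalized eigenvectors. *)
Lemma op_sub_mul (K : fieldType) n (phi : fps K n -> fps K n) x y d d' e e' r
    k l a b :
  filtered phi -> (forall a b, phi (a * b) = phi a * phi b) ->
  fps_eqd d a 0 -> fps_eqd e b 0 -> (r <= d' + e)%N -> (r <= d + e')%N ->
  fps_eqd d' (iter k (op_sub phi x) a) 0 ->
  fps_eqd e' (iter l (op_sub phi y) b) 0 ->
  fps_eqd r (iter (k + l) (op_sub phi (x * y)) (a * b)) 0.
Proof.
move=> hphi phiM.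
have hsub z j : filtered (iter j (op_sub phi z)).
  by apply: filtered_iter; apply: op_sub_filtered.
have phi_sub z c : phi (op_sub phi z c) = op_sub phi z (phi c).
  by rewrite /op_sub filteredB // filteredZ.
have phi_iter z j c : phi (iter j (op_sub phi z) c) = iter j (op_sub phi z) (phi c).
  by elim: j => //= j IHj; rewrite phi_sub IHj.
have [N] := ubnP (k + l); elim: N k l a b => // N IHN k l a b lt_N a0 b0 le1 le2 hk hl.
case: k => [|k] in lt_N hk *.
  apply: (proj2 (hsub _ _)); apply: fps_eqd_leq le1 _; exact: fps_eqdM0.
case: l => [|l] in lt_N hl *.
  apply: (proj2 (hsub _ _)); apply: fps_eqd_leq le2 _; exact: fps_eqdM0.
rewrite addSn iterSr.
(* A twisted Leibniz rule, in which each term lowers one of the two exponents. *)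
have -> : op_sub phi (x * y) (a * b) =
    op_sub phi x a * phi b + x *: (a * op_sub phi y b).
  rewrite /op_sub phiM mulrBl mulrBr scalerBr -!scalerAl -!scalerAr scalerA.
  by rewrite addrA subrK.
rewrite (filteredD _ _ (hsub _ _)) (filteredZ _ _ (hsub _ _)).
suff h : forall c, c = 0 + x *: 0 -> fps_eqd r
    (iter (k + l.+1) (op_sub phi (x * y)) (op_sub phi x a * phi b) +
     x *: iter (k + l.+1) (op_sub phi (x * y)) (a * op_sub phi y b)) c.
  by apply: h; rewrite scaler0 addr0.
move=> _ ->; apply: fps_eqdD; last apply: fps_eqdZ.
  apply: IHN => //.
  - by apply: (proj2 (op_sub_filtered hphi x)).
  - by apply: (proj2 hphi).
  - by rewrite -iterSr.
  - by rewrite -phi_iter; apply: (proj2 hphi).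
rewrite addnS -addSn; apply: IHN => //.
- by rewrite addSn -addnS.
- by apply: (proj2 (op_sub_filtered hphi y)).
- by rewrite -iterSr.
Qed.

(** A linear property that depends only on the jet of order [N] need only be checked on a basis of
    jets, which will consist of eigenvectors. *)
Lemma jet_basis_ind (K : fieldType) n N (P : 'M[K]_((jet_dim n N).+1))
    (Q : fps K n -> Prop) : P \in unitmx -> Q 0 ->
  (forall x a b, Q a -> Q b -> Q (x *: a + b)) ->
  (forall a b, fps_eqd N.+1 a b -> Q a -> Q b) ->
  (forall i a, jet N a = row i P -> Q a) -> forall a, Q a.
Proof.
move=> uP Q0 Qlin Qeqd Qrow a.
pose p i : fps K n := \sum_j P i j *: fps_mon K (jet_mon j).
have jp i : jet N (p i) = row i P.
  rewrite /p jet_sum [RHS]row_sum_delta; apply: eq_bigr => j _.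
  by rewrite jetZ jet_mon_delta mxE.
pose w := jet N a *m invmx P.
apply: (Qeqd (\sum_i w 0 i *: p i)).
  apply/jetP; rewrite jet_sum -[RHS](mulmxKV uP) mulmx_sum_row.
  by apply: eq_bigr => i _; rewrite jetZ jp.
elim/big_rec: _ => // i b _ Qb; apply: Qlin => //.
exact: Qrow (jp i).
Qed.

(** * The semisimple part of a multiplicative operator *)

Section SemisimpleOperator.
Variables (K : numClosedFieldType) (n : nat) (phi : fps K n -> fps K n).
Hypotheses (phi_filt : filtered phi).
Hypothesis phiM : forall a b, phi (a * b) = phi a * phi b.
Implicit Types a b : fps K n.

Let q N := sval (cid (jordan_poly_exists (jet_mx N phi))).
Let qP N : jordan_poly (jet_mx N phi) (q N).
Proof. by rewrite /q; case: cid. Qed.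

(** The polynomial [q] varies with the order of the jet, so each coefficient is computed at its own
    order; uniqueness of the semisimple part reconciles the orders. *)
Definition semisimple_op a : fps K n :=
  Fps (fun m => op_poly phi (q (mdeg m)) a m).

Lemma semisimple_op_eqd N f a : jordan_poly (jet_mx N phi) f ->
  fps_eqd N.+1 (semisimple_op a) (op_poly phi f a).
Proof.
move=> jf m; rewrite ltnS => le_m /=.
suff /jetP h : jet (mdeg m) (op_poly phi (q (mdeg m)) a) =
  jet (mdeg m) (op_poly phi f a) by apply: h.
rewrite !jet_op_poly //; congr (_ *m _); apply: jordan_poly_uniq => //.
exact: jordan_poly_leq jf.
Qed.

Lemma semisimple_op_filtered : filtered semisimple_op.
Proof.
split=> [x a b|d a a0].
  apply: fpsP => m; rewrite fpsDE fpsZE /=.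
  by rewrite (proj1 (op_poly_filtered phi_filt _)) fpsDE fpsZE.
by move=> m lt_m /=; rewrite (proj2 (op_poly_filtered phi_filt _) _ _ a0).
Qed.

Lemma jet_semisimple_op N f : jordan_poly (jet_mx N phi) f ->
  jet_mx N semisimple_op = horner_mx (jet_mx N phi) f.
Proof.
move=> jf; apply/row_matrixP => i; rewrite row_jet_mx rowE -jet_mon_delta.
by rewrite -jet_op_poly //; apply/jetP/semisimple_op_eqd.
Qed.

(** By bilinearity, [a] and [b] may be taken with eigenvector jets. By [op_sub_mul] their product is
    a generalized eigenvector for the product of the eigenvalues, hence an eigenvector of the
    semisimple part. *)
Lemma semisimple_opM a b :
  semisimple_op (a * b) = semisimple_op a * semisimple_op b.
Proof.
apply: fps_eqdP => d; apply: (@fps_eqd_leq _ _ _ d.+1) => //.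
have jq := qP d; have [P uP [dg eP]] := jordan_eigenbasis jq.
have hs := semisimple_op_filtered; have sE := jet_semisimple_op jq.
have se_row i c : jet d c = row i P -> fps_eqd d.+1 (semisimple_op c) (dg 0 i *: c).
  move=> jc; apply/jetP; rewrite jet_filtered // sE jetZ jc -row_mul eP row_mul.
  by rewrite row_diag_mx -scalemxAl -rowE.
have nil_row i c : jet d c = row i P ->
    exists M, fps_eqd d.+1 (iter M (op_sub phi (dg 0 i)) c) 0.
  move=> jc; have [M vM] : exists M, jet d c *m (jet_mx d phi - (dg 0 i)%:M) ^+ M = 0.
    apply: (jordan_eigenvector jq); rewrite -sE -jet_filtered // -jetZ.
    exact/jetP/se_row.
  exists M; apply/jetP; rewrite jet_op_sub // vM.
  by apply/rowP => j; rewrite !mxE.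
have eqd0 (c : fps K n) : fps_eqd 0 c 0 by move=> m.
move: a; apply: (jet_basis_ind uP).
- by rewrite mul0r filtered0 // mul0r.
- move=> x a a' ha ha'; rewrite mulrDl -scalerAl !(proj1 hs) mulrDl -scalerAl.
  by apply: fps_eqdD => //; apply: fps_eqdZ.
- move=> a a' e h; apply: fps_eqd_trans (fps_eqd_trans h _).
    apply: filtered_eqd => //; apply/fps_eqd_sym.
    exact: fps_eqdM.
  by apply: fps_eqdM => //; apply: filtered_eqd.
move=> i a ja; move: b; apply: (jet_basis_ind uP).
- by rewrite mulr0 filtered0 // mulr0.
- move=> x b b' hb hb'; rewrite mulrDr -scalerAr !(proj1 hs) mulrDr -scalerAr.
  by apply: fps_eqdD => //; apply: fps_eqdZ.
- move=> b b' e h; apply: fps_eqd_trans (fps_eqd_trans h _).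
    apply: filtered_eqd => //; apply/fps_eqd_sym.
    exact: fps_eqdM.
  by apply: fps_eqdM => //; apply: filtered_eqd.
move=> j b jb; have [k ak] := nil_row i a ja; have [l bl] := nil_row j b jb.
have := op_sub_mul (r := d.+1) phi_filt phiM (eqd0 a) (eqd0 b) _ _ ak bl.
rewrite addn0 add0n => /(_ (leqnn _) (leqnn _)) /jetP; rewrite jet_op_sub // => ab0.
apply: (@fps_eqd_trans _ _ _ _ ((dg 0 i * dg 0 j) *: (a * b))).
  apply/jetP; rewrite jet_filtered // sE jetZ.
  apply: (jordan_generalized jq (M := k + l)); rewrite ab0.
  by apply/rowP => c; rewrite !mxE.
have -> : (dg 0 i * dg 0 j) *: (a * b) = (dg 0 i *: a) * (dg 0 j *: b).
  by rewrite -scalerAr -scalerAl scalerA mulrC.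
by apply/fps_eqd_sym/fps_eqdM; apply: se_row.
Qed.

End SemisimpleOperator.

Section LinearPart.
Variables (K : fieldType) (n : nat).
Implicit Types (a b : fps K n) (g : fdiff K n).

Definition lin_row a : 'rV[K]_n := \row_j a U_(j)%MM.

Lemma lin_rowB a b : lin_row (a - b) = lin_row a - lin_row b.
Proof. by apply/rowP => j; rewrite !mxE. Qed.

Lemma lin_row_op g a : lin_row (fdiff_op g a) = lin_row a *m linear_part g.
Proof.
apply/rowP => j; rewrite !mxE /fdiff_op fps_comp_coef1; last exact: fdiff_coef0.
by apply: eq_bigr => i _; rewrite !mxE.
Qed.

Lemma lin_row_eqd a : a 0%MM = 0 -> lin_row a = 0 -> fps_eqd 2 a 0.
Proof.
move=> a0 /rowP al m; rewrite ltnS leq_eqVlt ltnS leqn0 => /orP[|].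
  by case/mdeg1P=> j /eqP ->; have := al j; rewrite !mxE.
by rewrite mdeg_eq0 => /eqP ->.
Qed.

Lemma linear_partM g h : linear_part (g * h)%g = linear_part g *m linear_part h.
Proof. by apply: linear_part_comp; apply: fdiff_coef0. Qed.

Lemma linear_part1 : linear_part (1%g : fdiff K n) = 1%:M.
Proof. exact: linear_part_id. Qed.

Lemma fdiff_op_mul g a b : fdiff_op g (a * b) = fdiff_op g a * fdiff_op g b.
Proof. exact/fps_compM/fdiff_coef0. Qed.

(** Nilpotency of [phi - 1] on the coordinates modulo order 2 passes to each monomial modulo its
    next order by [op_sub_mul]. Iterating raises the order of every series without bound. *)
Lemma unipotent_jet_unipotent g k :
  (linear_part g - 1%:M) ^+ k = 0 -> jet_unipotent g.
Proof.
move=> gk; set phi := fdiff_op g; have hphi : filtered phi := fdiff_op_filtered g.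
have hsub j : filtered (iter j (op_sub phi 1)).
  exact/filtered_iter/op_sub_filtered.
have sub1 : op_sub phi 1 1 = 0.
  by rewrite /op_sub scale1r /phi /fdiff_op fps_comp1 ?subrr //; apply: fdiff_coef0.
have nilX i : fps_eqd 2 (iter k (op_sub phi 1) (fps_X K i)) 0.
  have X1 : fps_eqd 1 (fps_X K i) 0 by apply: fps_eqd1; rewrite /= mcoeffX mnm1_eq0.
  apply: lin_row_eqd; first by rewrite (proj2 (hsub k) _ _ X1) ?mdeg0.
  have -> : lin_row (iter k (op_sub phi 1) (fps_X K i)) =
      lin_row (fps_X K i) *m (linear_part g - 1%:M) ^+ k.
    elim: (k) => [|j IHj]; first by rewrite expr0 mulmx1.
    rewrite iterS {1}/op_sub scale1r lin_rowB lin_row_op IHj exprSr -mulmxE.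
    by rewrite -[X in _ - X]mulmx1 -mulmxBr -mulmxA.
  by rewrite gk mulmx0.
have nil_mon m : exists j, fps_eqd (mdeg m).+1 (iter j (op_sub phi 1) (fps_mon K m)) 0.
  elim/mnm_ind: m => [|i m [j hj]]; first by exists 1%N; rewrite fps_mon0 /= sub1.
  have X1 : fps_eqd 1 (fps_X K i) 0 by apply: fps_eqd1; rewrite /= mcoeffX mnm1_eq0.
  exists (k + j)%N; rewrite fps_monU -[X in op_sub _ X](mulr1 1).
  by apply: (op_sub_mul hphi (fdiff_op_mul g) X1 (@fps_eqd_monomial _ _ m) _ _ (nilX i) hj);
    rewrite mdegD mdeg1.
have nil_deg d : exists j, forall a, fps_eqd d a 0 ->
    fps_eqd d.+1 (iter j (op_sub phi 1) a) 0.
  pose j (i : 'I_(jet_dim n d).+1) := sval (cid (nil_mon (@jet_mon n d i))).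
  have hj (i : 'I_(jet_dim n d).+1) : fps_eqd (mdeg (@jet_mon n d i)).+1
      (iter (\sum_i j i)%N (op_sub phi 1) (fps_mon K (@jet_mon n d i))) 0.
    rewrite (bigD1 i) //= addnC iterD; apply: (proj2 (hsub _)).
    by rewrite /j; case: cid.
  exists (\sum_i j i)%N => a a0.
  apply: (fps_eqd_trans (filtered_eqd (hsub _) (@fps_eqd_mon _ _ d a))).
  rewrite filtered_sum // => m lt_m; rewrite fps_sumE big1 // => i _.
  rewrite filteredZ // fpsZE.
  have [lt_i|ge_i] := ltnP (mdeg (jet_mon i)) d; first by rewrite a0 // mul0r.
  by rewrite hj ?mulr0 // (leq_trans lt_m).
have nil N : exists j, forall a, fps_eqd N (iter j (op_sub phi 1) a) 0.
  elim: N => [|N [j hj]]; first by exists 0%N => a m.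
  have [j' hj'] := nil_deg N; exists (j' + j)%N => a.
  by rewrite iterD; apply: hj'.
move=> N; have [M hM] := nil N.+1; exists M; apply/row_matrixP => i.
rewrite row0 rowE -jet_mon_delta -(jet_op_sub _ 1 M _ hphi).
have /jetP -> := hM (fps_mon K (jet_mon i)).
by apply/rowP => j; rewrite !mxE.
Qed.

End LinearPart.

Lemma trig_unipotent (K : fieldType) n (T : 'M[K]_n) :
  is_trig_mx T -> (forall i, T i i = 1) -> (T - 1%:M) ^+ n = 0.
Proof.
case: n T => [|m] T tT dT; first by apply/matrixP => -[].
have := Cayley_Hamilton T; rewrite char_poly_trig //.
rewrite (eq_bigr (fun=> 'X - 1%:P)) => [|i _]; last by rewrite dT.
rewrite prodr_const card_ord rmorphXn /= rmorphB /= horner_mx_X.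
by rewrite horner_mx_C.
Qed.

Section TriangularMatrices.
Variables (K : fieldType) (n : nat) (P : 'M[K]_n).
Hypothesis uP : P \in unitmx.
Implicit Types A B : 'M[K]_n.

Lemma trig_mul A B : is_trig_mx A -> is_trig_mx B ->
  is_trig_mx (A *m B) /\ forall i, (A *m B) i i = A i i * B i i.
Proof.
move=> /is_trig_mxP tA /is_trig_mxP tB; split=> [|i].
  apply/is_trig_mxP => i j lt_ij; rewrite mxE big1 // => k _.
  have [lt_ik|le_ki] := ltnP i k; first by rewrite tA ?mul0r.
  by rewrite tB ?mulr0 // (leq_ltn_trans le_ki).
rewrite mxE (bigD1 i) //= big1 ?addr0 // => k ne_ki.
have [lt_ik|le_ki] := ltnP i k; first by rewrite tA ?mul0r.
by rewrite tB ?mulr0 // ltn_neqAle ne_ki.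
Qed.

Lemma trig_inv A B : is_trig_mx A -> A *m B = 1%:M -> is_trig_mx B.
Proof.
move=> tA AB; have [uA _] := mulmx1_unit AB.
have dA i : A i i != 0.
  move: uA; rewrite unitmxE det_trig // unitfE => /prodf_neq0; exact.
move/is_trig_mxP: tA => tA; apply/is_trig_mxP => i j.
elim/ltn_ind: {i}(i : nat) {-2}i (erefl (i : nat)) => m IH i def_m lt_ij.
have /matrixP/(_ i j) := AB; rewrite !mxE (bigD1 i) //= big1 => [|k ne_ki].
  rewrite addr0 (_ : i == j = false); last by apply/eqP => e; rewrite e ltnn in lt_ij.
  by move/eqP; rewrite mulf_eq0 (negPf (dA i)) => /eqP.
have [lt_ik|le_ki] := ltnP i k; first by rewrite tA ?mul0r.
have lt_ki : (k < i)%N by rewrite ltn_neqAle ne_ki.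
by rewrite (IH k) ?mulr0 -?def_m // (ltn_trans lt_ki).
Qed.

Definition trig_in A := is_trig_mx (P *m A *m invmx P).
Definition diag_in A i := (P *m A *m invmx P) i i.

Lemma conjmM A B : P *m (A *m B) *m invmx P =
  (P *m A *m invmx P) *m (P *m B *m invmx P).
Proof. by rewrite -!mulmxA (mulmxA (invmx P)) mulVmx // mul1mx. Qed.

Lemma trig_inM A B : trig_in A -> trig_in B -> trig_in (A *m B).
Proof. by move=> tA tB; rewrite /trig_in conjmM; case: (trig_mul tA tB). Qed.

Lemma diag_inM A B i : trig_in A -> trig_in B ->
  diag_in (A *m B) i = diag_in A i * diag_in B i.
Proof. by move=> tA tB; rewrite /diag_in conjmM; case: (trig_mul tA tB). Qed.

Lemma conjm1 : P *m 1%:M *m invmx P = 1%:M.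
Proof. by rewrite mulmx1 mulmxV. Qed.

Lemma trig_in1 : trig_in 1%:M.
Proof. by rewrite /trig_in conjm1 scalar_mx_is_trig. Qed.

Lemma diag_in1 i : diag_in 1%:M i = 1.
Proof. by rewrite /diag_in conjm1 mxE eqxx. Qed.

Lemma trig_inV A B : trig_in A -> A *m B = 1%:M -> trig_in B.
Proof. by move=> tA AB; apply: (trig_inv tA); rewrite -conjmM AB conjm1. Qed.

Lemma diag_in_inv A B i : trig_in A -> A *m B = 1%:M ->
  diag_in B i = (diag_in A i)^-1.
Proof.
move=> tA AB; have := diag_inM i tA (trig_inV tA AB); rewrite AB diag_in1 => e.
have dA : diag_in A i != 0.
  by apply/eqP => A0; move: e; rewrite A0 mul0r => /eqP; rewrite oner_eq0.
by apply: (mulfI dA); rewrite -e mulfV.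
Qed.

Lemma diag_in_neq0 A B i : trig_in A -> A *m B = 1%:M -> diag_in A i != 0.
Proof.
move=> tA AB; apply/eqP => A0; have := diag_inM i tA (trig_inV tA AB).
by rewrite AB diag_in1 A0 mul0r => /eqP; rewrite oner_eq0.
Qed.

Lemma trig_in_unipotent A : trig_in A -> (forall i, diag_in A i = 1) ->
  (A - 1%:M) ^+ n = 0.
Proof.
move=> tA dA; set T := P *m A *m invmx P in tA dA.
have e k : (A - 1%:M) ^+ k = invmx P *m (T - 1%:M) ^+ k *m P.
  elim: k => [|k IHk]; first by rewrite !expr0 mulmx1 mulVmx.
  rewrite !exprSr -!mulmxE IHk /T -!mulmxA; congr (_ *m (_ *m _)).
  rewrite mulmxBl mul1mx -!mulmxA mulVmx // mulmx1.
  by rewrite mulmxBr mulmx1.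
by rewrite e trig_unipotent // mulmx0 mul0mx.
Qed.

Definition mx_poly A (f : {poly K}) := \sum_(i < size f) f`_i *: A ^+ i.

Lemma mx_poly_trig A f : trig_in A ->
  trig_in (mx_poly A f) /\ forall i, diag_in (mx_poly A f) i = f.[diag_in A i].
Proof.
move=> tA; have pow k : trig_in (A ^+ k) /\ forall i, diag_in (A ^+ k) i = diag_in A i ^+ k.
  elim: k => [|k [IH1 IH2]].
    by split=> [|i]; [apply: trig_in1 | apply: diag_in1].
  rewrite exprS; split=> [|i]; first exact: trig_inM.
  by rewrite diag_inM // IH2 exprS.
have entry i j : (P *m mx_poly A f *m invmx P) i j =
    \sum_(k < size f) f`_k * (P *m A ^+ k *m invmx P) i j.
  rewrite mulmx_sumr mulmx_suml summxE; apply: eq_bigr => k _.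
  by rewrite -scalemxAr -scalemxAl mxE.
split=> [|i]; last first.
  rewrite /diag_in entry horner_coef; apply: eq_bigr => k _.
  by rewrite -(proj2 (pow k)).
apply/is_trig_mxP => i j lt_ij; rewrite entry big1 // => k _.
by have /is_trig_mxP -> := proj1 (pow k); rewrite ?mulr0.
Qed.

End TriangularMatrices.

Section SemisimpleDiffeomorphism.
Variables (K : numClosedFieldType) (n : nat).
Implicit Types (g h : fdiff K n) (P : 'M[K]_n).

Definition semisimple_part g s := forall N, exists2 q,
  jordan_poly (fdiff_mx N g) q & fdiff_mx N s = horner_mx (fdiff_mx N g) q.

Lemma lin_row_op_poly g f a :
  lin_row (op_poly (fdiff_op g) f a) = lin_row a *m mx_poly (linear_part g) f.
Proof.
have it i : lin_row (iter i (fdiff_op g) a) = lin_row a *m linear_part g ^+ i.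
  elim: i => [|i IHi]; first by rewrite expr0 mulmx1.
  by rewrite iterS lin_row_op IHi exprSr -mulmxE mulmxA.
rewrite mulmx_sumr; apply/rowP => j; rewrite mxE fps_sumE summxE.
apply: eq_bigr => i _; rewrite fpsZE -scalemxAr mxE -it mxE.
by [].
Qed.

Lemma lin_row_X i : lin_row (fps_X K i) = delta_mx 0 i :> 'rV[K]_n.
Proof. by apply/rowP => j; rewrite !mxE eqxx /= mcoeffXU eq_sym. Qed.

(** The images of the coordinates under the semisimple operator define the diffeomorphism [s]; both
    are multiplicative, so they agree on monomials. Triangularity shows that the linear part of [s]
    is invertible and keeps the diagonal. *)
Lemma semisimple_part_exists g P : P \in unitmx -> trig_in P (linear_part g) ->
  exists s, [/\ semisimple_part g s, trig_in P (linear_part s) &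
    forall i, diag_in P (linear_part s) i = diag_in P (linear_part g) i].
Proof.
move=> uP tg; set phi := fdiff_op g; have hphi : filtered phi := fdiff_op_filtered g.
pose s := semisimple_op phi; have hs : filtered s := semisimple_op_filtered hphi.
have sM := semisimple_opM hphi (fdiff_op_mul g).
have [q jq] := jordan_poly_exists (jet_mx 1 phi).
pose f : {ffun 'I_n -> fps K n} := [ffun i => s (fps_X K i)].
have lf : linear_part f = mx_poly (linear_part g) q.
  apply/row_matrixP => i; rewrite [RHS]rowE -lin_row_X -lin_row_op_poly.
  apply/rowP => j; rewrite !mxE ffunE.
  by rewrite (semisimple_op_eqd hphi _ jq) // mdeg1.
have [tf df] := mx_poly_trig uP q tg; rewrite -lf in tf df.
have gV : linear_part g *m linear_part g^-1%g = 1%:M.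
  by rewrite -linear_partM mulgV linear_part1.
(* A power of [q - 'X] vanishes at the linear part, hence at its diagonal entries, which are
   scalars. *)
have dq i : q.[diag_in P (linear_part g) i] = diag_in P (linear_part g) i.
  case: (jq) => _ [e he].
  have z : mx_poly (linear_part g) ((q - 'X) ^+ e) = 0.
    apply/row_matrixP => k; rewrite row0 rowE -lin_row_X -lin_row_op_poly.
    have /jetP h0 : jet 1 (op_poly phi ((q - 'X) ^+ e) (fps_X K k)) = jet 1 0.
      by rewrite jet_op_poly // he mulmx0; apply/rowP => j; rewrite !mxE.
    by apply/rowP => j; rewrite !mxE h0 // mdeg1.
  have [_ /(_ i)] := mx_poly_trig uP ((q - 'X) ^+ e) tg.
  rewrite z /diag_in mulmx0 mul0mx mxE horner_exp !hornerE => /esym/eqP.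
  by rewrite expf_eq0 subr_eq0 => /andP[_ /eqP].
have f0 i : f i 0%MM = 0.
  rewrite ffunE (proj2 hs 1) ?mdeg0 //.
  by apply: fps_eqd1; rewrite /= mcoeffX mnm1_eq0.
have f_fdiff : is_fdiff f.
  apply/andP; split; first by apply/forallP => i; rewrite f0.
  have uT : P *m linear_part f *m invmx P \in unitmx.
    rewrite unitmxE det_trig // unitfE; apply/prodf_neq0 => i _.
    by rewrite -/(diag_in _ _ _) df dq; apply: diag_in_neq0 tg gV.
  by move: uT; rewrite !unitmx_mul unitmx_inv uP andbT.
pose sg := Fdiff f_fdiff.
have s1 : s 1 = 1.
  apply: fps_eqdP => d; apply: (@fps_eqd_leq _ _ _ d.+1) => //.
  have [q' jq'] := jordan_poly_exists (jet_mx d phi).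
  have phi1 : phi 1 = 1 by apply: fps_comp1; apply: fdiff_coef0.
  apply/jetP; rewrite jet_filtered // (jet_semisimple_op hphi jq').
  rewrite (jordan_generalized jq' (x := 1) (M := 1)) ?scale1r // expr1.
  by rewrite mulmxBr mulmx1 -jet_filtered // phi1 subrr.
have sgE : fdiff_op sg =1 s.
  have hsg := fdiff_op_filtered sg.
  have mon m : fdiff_op sg (fps_mon K m) = s (fps_mon K m).
    elim/mnm_ind: m => [|i m IHm].
      by rewrite fps_mon0 s1; apply: fps_comp1.
    rewrite fps_monU fdiff_op_mul /s sM -/s IHm; congr (_ * _).
    by rewrite /fdiff_op fps_comp_X //= ffunE.
  apply: jet_mx_inj => // N; apply/matrixP => i j.
  by rewrite !mxE mon.
exists sg; split=> // [N|i]; last by rewrite df dq.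
have [q' jq'] := jordan_poly_exists (jet_mx N phi); exists q' => //.
by rewrite -(jet_semisimple_op hphi jq'); apply: jet_mx_ext.
Qed.

Lemma semisimple_part_comm g s x : semisimple_part g s ->
  commute x g -> commute x s.
Proof.
move=> gs xg; apply: fdiff_mx_inj => N; rewrite !fdiff_mxM.
have [q _ ->] := gs N; apply: comm_mx_horner.
by rewrite /comm_mx !mulmxE -!fdiff_mxM xg.
Qed.

End SemisimpleDiffeomorphism.

(** * Groups with triangular linear parts *)

Section CentralProducts.
Variable G : groupType.
Implicit Types (A B S : set G) (x y : G).
Local Open Scope group_scope.

Lemma commg_mul_central s y s' y' : commute s s' -> commute s y -> commute s y' ->
  commute s' y -> commute s' y' -> [~ s * y, s' * y'] = [~ y, y'] :> G.
Proof.
move=> ss' sy sy' s'y s'y'.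
have e : s * y * (s' * y') = s * s' * (y * y').
  by rewrite -!mulgA; congr (_ * _); rewrite mulgA -s'y -!mulgA.
have e' : s' * y' * (s * y) = s * s' * (y' * y).
  rewrite ss' -!mulgA; congr (_ * _); rewrite !mulgA; congr (_ * _).
  by rewrite -sy'.
have c a b : [~ a, b] = (b * a)^-1 * (a * b) :> G.
  by rewrite commgEl conjgE invgM !mulgA.
by rewrite !c e e' invgM -mulgA mulKg.
Qed.

Definition central_product S A B :=
  (forall s y, S s -> S y \/ B y -> commute s y) /\
  (forall x, A x -> exists s y, [/\ S s, B y & x = s * y]).

(** Factors from [S] drop out of commutators; the inclusion thus begins with the first derived
    group, [A] itself need not lie in [B]. *)
Lemma central_product_derived S A B m : central_product S A B ->
  grp_derived A m.+1 `<=` grp_derived B m.+1.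
Proof.
case=> cS dec; rewrite -[m.+1]addn1 !grp_derived_add; apply: grp_derivedS.
apply: grp_commutator_sub; first exact: grp_commutator_subgroup.
move=> _ _ /dec[s [y [Ss By ->]]] /dec[s' [y' [Ss' By' ->]]].
by rewrite commg_mul_central; try (by apply: cS => //; auto); apply: grp_commutator_in.
Qed.

Lemma central_product_lower_central S A B m : is_subgroup B ->
  central_product S A B -> grp_lower_central A m.+1 `<=` grp_lower_central B m.+1.
Proof.
move=> B_sub [cS dec]; elim: m => [|m IHm].
  by have := central_product_derived (m := 0) (conj cS dec).
apply: grp_commutator_sub; first exact: grp_commutator_subgroup.
move=> _ y /dec[s [b [Ss Bb ->]]] /IHm By.
have By' := grp_lower_central_sub B_sub By.
have c1 (z : G) : commute 1 z by rewrite /commute mul1g mulg1.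
rewrite -[y]mul1g commg_mul_central //; last by apply: cS => //; right.
- exact: grp_commutator_in.
- by apply: commute_sym.
- by apply: cS => //; right.
Qed.

Lemma central_product_nilpotent S A B : is_subgroup A -> is_subgroup B ->
  central_product S A B -> grp_nilpotent B -> grp_nilpotent A.
Proof.
move=> A_sub B_sub cp [c Bc]; exists c.+1; apply/seteqP; split; last first.
  by move=> _ ->; case: (grp_lower_central_subgroup c.+1 A_sub).
apply: (subset_trans (central_product_lower_central B_sub cp)).
apply: grp_commutator_sub; last first.
  move=> x y _ yc.
  by have : grp_lower_central B c y by []; rewrite Bc => ->; apply: commg1.
by split=> [|x y -> ->|x ->] //=; rewrite ?mulg1 ?invg1.
Qed.

Definition generated S := smallest (@is_subgroup G) S.

Lemma generated_subgroup S : is_subgroup (generated S).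
Proof.
split=> [A [[]] //|x y hx hy A hA|x hx A hA]; have [[A1 AM AV] _] := hA.
  by apply: AM; [apply: hx | apply: hy].
by apply: AV; apply: hx.
Qed.

Lemma generated_in S x : S x -> generated S x.
Proof. by move=> Sx A [_]; apply. Qed.

Lemma generated_sub S A : is_subgroup A -> S `<=` A -> generated S `<=` A.
Proof. by move=> hA sSA; apply: smallest_sub. Qed.

Lemma centralizer_subgroup B : is_subgroup [set x | forall y, B y -> commute x y].
Proof.
split=> [y _|x x' hx hx' y By|x hx y By] /=.
- by rewrite /commute mul1g mulg1.
- exact/commute_sym/commuteM/commute_sym/hx'/By/commute_sym/hx/By.
- exact/commute_sym/commuteV/commute_sym/hx.
Qed.

End CentralProducts.

Section TriangularGroups.
Variables (K : numClosedFieldType) (n : nat) (P : 'M[K]_n) (H : set (fdiff K n)).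
Hypotheses (n_gt0 : (0 < n)%N) (uP : P \in unitmx).
Hypotheses (H_sub : is_subgroup H) (H_nil : grp_nilpotent H).
Hypothesis H_trig : forall h, H h -> trig_in P (linear_part h).

Let linV (g : fdiff K n) : linear_part g *m linear_part g^-1%g = 1%:M :> 'M[K]_n.
Proof. by rewrite -linear_partM mulgV linear_part1. Qed.

Definition ss_pair (h s : fdiff K n) :=
  [/\ H h, semisimple_part h s, trig_in P (linear_part s) &
    forall i, diag_in P (linear_part s) i = diag_in P (linear_part h) i].

Lemma ss_pair_exists h : H h -> exists s, ss_pair h s.
Proof.
move=> Hh; have [s [h1 h2 h3]] := semisimple_part_exists uP (H_trig Hh).
by exists s.
Qed.

Lemma diag_lin_comm g h i : H g -> H h -> diag_in P (linear_part [~ g, h]%g) i = 1.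
Proof.
move=> Hg Hh; have [_ HM HV] := H_sub.
have tV x : H x -> diag_in P (linear_part x^-1%g) i = (diag_in P (linear_part x) i)^-1.
  by move=> Hx; apply: diag_in_inv (linV x) => //; apply: H_trig.
have Hgh := HM _ _ Hg Hh; have [Hg' Hh'] := (HV _ Hg, HV _ Hh).
have Hh'gh := HM _ _ Hh' Hgh.
have nz x : H x -> diag_in P (linear_part x) i != 0.
  by move=> Hx; apply: diag_in_neq0 (H_trig Hx) (linV x).
rewrite commgEl conjgE !linear_partM diag_inM -?linear_partM ?H_trig //.
rewrite linear_partM diag_inM ?H_trig // linear_partM diag_inM ?H_trig // !tV //.
by rewrite mulrCA mulKf ?mulVf ?nz.
Qed.

(** Descending induction on the term of the lower central series containing [x]: [s] commutes with
    [k], the commutator of [h] and [x]. Conjugation by [x] turns [h] into [h * k = s * w], where [w]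
    is unipotent because [s] and [h] have the same diagonal and [k] has diagonal 1. Then
    [jordan_conj_comm] applies on jets. *)
Lemma ss_pair_comm h s x : ss_pair h s -> H x -> commute s x.
Proof.
case=> Hh ss ts ds; have [_ HM HV] := H_sub; have [c Hc] := H_nil.
suff step m : (forall x, grp_lower_central H m.+1 x -> commute s x) ->
    forall x, grp_lower_central H m x -> commute s x.
  have base : forall x, grp_lower_central H c x -> commute s x.
    by move=> y; rewrite Hc => ->; rewrite /commute mulg1 mul1g.
  elim: c base {Hc} => [|c IHc] base; first exact: base.
  by apply: IHc; apply: step.
move=> IH {}x xm; have Hx := grp_lower_central_sub H_sub xm.
set k := [~ h, x]%g; have ck : commute s k.
  by apply: IH; apply: grp_commutator_in.
have Hk : H k by apply: subgroup_comm.
have ch : commute s h by apply/commute_sym; apply: semisimple_part_comm ss _.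
pose w := (s^-1 * (h * k))%g.
have hk : (x^-1 * h * x = h * k)%g by rewrite /k commgEl conjgE !mulgA mulgV mul1g.
have w_unip : jet_unipotent w.
  have ts' := trig_inV uP ts (linV s).
  have Hhk := HM _ _ Hh Hk.
  apply: (unipotent_jet_unipotent (k := n)); apply: (trig_in_unipotent uP).
    by rewrite linear_partM; apply: trig_inM => //; apply: H_trig.
  move=> i; rewrite linear_partM (diag_inM uP i ts' (H_trig Hhk)).
  rewrite linear_partM diag_inM ?H_trig // diag_lin_comm // mulr1.
  rewrite (diag_in_inv uP i ts (linV s)) ds mulVf //.
  exact: diag_in_neq0 (H_trig Hh) (linV h).
apply: fdiff_mx_inj => N; rewrite !fdiff_mxM.
have [q jq sE] := ss N; have [M wM] := w_unip N; rewrite sE.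
apply: (jordan_conj_comm (B' := fdiff_mx N x^-1%g) (E := fdiff_mx N k)
  (W := fdiff_mx N w) jq _ _ _ _ _ wM).
- exact: fdiff_mxV.
- exact: fdiff_mxVl.
- by rewrite -!fdiff_mxM hk.
- by rewrite -sE -!fdiff_mxM; congr fdiff_mx; apply/esym/mulVKg.
rewrite -sE /GRing.comm -!fdiff_mxM; congr fdiff_mx.
by apply: commuteM; [apply: commuteV | apply: commuteM].
Qed.

Lemma ss_pair_comm2 h s h' s' : ss_pair h s -> ss_pair h' s' -> commute s s'.
Proof.
move=> p p'; case: (p') => Hh' ss' _ _; apply: (semisimple_part_comm ss').
exact: ss_pair_comm p Hh'.
Qed.

Let S := generated [set s | exists h, ss_pair h s].
Let U := generated [set u | exists h s, ss_pair h s /\ u = (s^-1 * h)%g].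

Let S_H s x : S s -> H x -> commute s x.
Proof.
move=> Ss; move: x; suff : [set s | forall x, H x -> commute s x] s by [].
apply: (generated_sub (centralizer_subgroup H) _ Ss) => {s Ss} s [h p] y.
exact: ss_pair_comm p.
Qed.

Let S_S s s' : S s -> S s' -> commute s s'.
Proof.
have gen t : (exists h, ss_pair h t) -> S `<=` [set t' | forall y, [set t] y -> commute t' y].
  move=> [h p]; apply: generated_sub; first exact: centralizer_subgroup.
  by move=> t' [h' p'] _ ->; apply: ss_pair_comm2 p' p.
move=> Ss; move: s'; suff : [set s | forall s', S s' -> commute s s'] s by [].
apply: (generated_sub (centralizer_subgroup S) _ Ss) => t pt t' St'.
by apply: commute_sym; apply: (gen t pt t' St').
Qed.

Let U_dec u : U u -> exists s h, [/\ S s, H h & u = (s * h)%g].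
Proof.
have [H1 HM HV] := H_sub; have [S1 SM SV] := generated_subgroup [set s | exists h, ss_pair h s].
apply: (@generated_sub _ _ [set u | exists s h, [/\ S s, H h & u = (s * h)%g]]).
  split=> [|x y [s [h [Ss Hh ->]]] [s' [h' [Ss' Hh' ->]]]|x [s [h [Ss Hh ->]]]].
  - by exists 1%g, 1%g; split; rewrite ?mulg1.
  - exists (s * s')%g, (h * h')%g; split; [exact: SM | exact: HM |].
    by rewrite -!mulgA; congr (_ * _)%g; rewrite !mulgA (S_H Ss' Hh).
  exists s^-1%g, h^-1%g; split; [exact: SV | exact: HV |].
  by rewrite invgM; apply: commute_sym; apply: commuteV; apply: commute_sym;
    apply: commuteV; apply: commute_sym; apply: S_H.
move=> _ [h [s [p ->]]]; exists s^-1%g, h; split=> //; last by case: p.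
by apply: SV; apply: generated_in; exists h.
Qed.

Let U_sub : is_subgroup U. Proof. exact: generated_subgroup. Qed.

Let U_H : central_product S U H.
Proof. by split=> [s y Ss [/(S_S Ss)|/(S_H Ss)]|u /U_dec]. Qed.

Let H_U : central_product S H U.
Proof.
split=> [s y Ss [/(S_S Ss) //|/U_dec[s' [h [Ss' Hh ->]]]]|h Hh].
  by apply: commuteM; [apply: S_S | apply: S_H].
have [s p] := ss_pair_exists Hh; exists s, (s^-1 * h)%g; split.
- by apply: generated_in; exists h.
- by apply: generated_in; exists h, s.
by rewrite mulVKg.
Qed.

Let U_unip u : U u -> jet_unipotent u.
Proof.
move=> Uu; pose unip : set (fdiff K n) := [set x | trig_in P (linear_part x) /\
  forall i, diag_in P (linear_part x) i = 1].
suff [tu du] : unip u.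
  exact: (unipotent_jet_unipotent (k := n)) (trig_in_unipotent uP tu du).
apply: (generated_sub (A := unip) _ _ Uu) => [|_ [h [s [[Hh _ ts ds] ->]]]].
  split=> [|x y [tx dx] [ty dy]|x [tx dx]]; split.
  - by rewrite linear_part1; apply: trig_in1.
  - by move=> i; rewrite linear_part1 diag_in1.
  - by rewrite linear_partM; apply: trig_inM.
  - by move=> i; rewrite linear_partM diag_inM // dx dy mulr1.
  - exact: trig_inV tx (linV x).
  - by move=> i; rewrite (diag_in_inv uP i tx (linV x)) dx invr1.
have ts' := trig_inV uP ts (linV s).
split; rewrite linear_partM; first by apply: trig_inM => //; apply: H_trig.
move=> i; rewrite (diag_inM uP i ts' (H_trig Hh)) (diag_in_inv uP i ts (linV s)) ds mulVf //.
exact: diag_in_neq0 (H_trig Hh) (linV h).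
Qed.

(** [U] lies in [S H], hence is nilpotent, and the unipotent bound applies; [H] lies in [S U], hence
    shares that bound. *)
Lemma triangular_derived x : grp_derived H n x -> x = 1%g.
Proof.
have U_nil := central_product_nilpotent U_sub H_sub U_H H_nil.
have [k le_kn Uk] := unipotent_derived U_sub U_nil U_unip.
rewrite -[X in grp_derived H X](prednK n_gt0).
move=> /(central_product_derived H_U); rewrite prednK //.
by move/(grp_derived_leq U_sub le_kn); rewrite Uk.
Qed.

End TriangularGroups.

(** * Isolators in nilpotent groups *)

Section Isolators.
Variables (Gam : groupType).
Implicit Types (A B G M : set Gam) (x y z : Gam).
Local Open Scope group_scope.

Lemma commMg_conj x y z : [~ x * y, z] = [~ x, z] ^ y * [~ y, z] :> Gam.
Proof. by rewrite !commgEl !conjgE !invgM !mulgA !mulgK. Qed.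

Lemma commgM_conj x y z : [~ x, y * z] = [~ x, z] * [~ x, y] ^ z :> Gam.
Proof. by rewrite !commgEl !conjgE !invgM !mulgA !mulgK. Qed.

Definition normal_in G M := [/\ is_subgroup M & forall x y, M x -> G y -> M (x ^ y)].

Section Modulo.
Variables (G M : set Gam).
Hypotheses (G_sub : is_subgroup G) (M_nor : normal_in G M).

Lemma centralizer_mod_subgroup x : G x -> is_subgroup [set y | G y /\ M [~ x, y]].
Proof.
move=> Gx; have [G1 GM GV] := G_sub; have [[M1 MM MV] Mn] := M_nor.
split=> [|y z [Gy xy] [Gz xz]|y [Gy xy]].
- by rewrite /= commg1.
- by split; [apply: GM | rewrite commgM_conj; apply: MM => //; apply: Mn].
split; first exact: GV.
have : [~ x, y * y^-1] = 1 by rewrite mulgV commg1.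
rewrite commgM_conj => /(canRL (mulgK _)); rewrite mul1g => ->.
by apply/MV/Mn/GV.
Qed.

(** Modulo [M], conjugation by powers of [x] fixes [[~ x, y]], so the commutators multiply;
    normality gathers the errors in [m]. *)
Lemma comm_expg_mod x y p : G x -> G y -> M [~ x, [~ x, y]] ->
  exists2 m, M m & [~ x ^+ p, y] = [~ x, y] ^+ p * m.
Proof.
move=> Gx Gy xxy; have [G1 GM GV] := G_sub; have [[M1 MM MV] Mn] := M_nor.
have Gc := subgroup_comm G_sub Gx Gy.
have cx k : M [~ [~ x, y], x ^+ k].
  have C := centralizer_mod_subgroup Gc.
  have : [set z | G z /\ M [~ [~ x, y], z]] (x ^+ k).
    by apply: subgroup_expg => //; split=> //; rewrite -invgR; apply: MV.
  by case.
elim: p => [|p [m Mm IH]].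
  by exists 1; rewrite ?expg0 ?mulg1 // -invgR commg1 invg1.
exists ([~ [~ x, y], x ^+ p] ^ ([~ x, y] ^+ p) * m).
  by apply: MM => //; apply: Mn; [apply: cx | apply: subgroup_expg].
rewrite expgS commMg_conj IH expgS; move: [~ x, y] (x ^+ p) ([~ x, y] ^+ p) => c d w.
by rewrite commgEl !conjgE !mulgA !mulgK mulgV mul1g.
Qed.

Lemma expgM_mod x y p : G x -> G y -> M [~ y, x] ->
  exists2 m, M m & (x * y) ^+ p = x ^+ p * y ^+ p * m.
Proof.
move=> Gx Gy yx; have [G1 GM GV] := G_sub; have [[M1 MM MV] Mn] := M_nor.
have cx k : M [~ y, x ^+ k].
  have : [set z | G z /\ M [~ y, z]] (x ^+ k).
    by apply: subgroup_expg; [apply: centralizer_mod_subgroup | split].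
  by case.
elim: p => [|p [m Mm IH]]; first by exists 1; rewrite ?expg0 ?mulg1.
exists ([~ y, x ^+ p] ^ (y ^+ p) * m).
  by apply: MM => //; apply: Mn; [apply: cx | apply: subgroup_expg].
rewrite expgS IH !expgS; move: (x ^+ p) (y ^+ p) => a b.
by rewrite commgEl !conjgE !mulgA !mulgK.
Qed.

End Modulo.

Variable G : set Gam.
Hypotheses (G_sub : is_subgroup G) (G_nil : grp_nilpotent G).

Definition isolated M := normal_in G M /\
  forall x p, G x -> (0 < p)%N -> M (x ^+ p) -> M x.

(* Modulo [M], the last nontrivial iterated commutator [h] of [x] with [y]
   commutes with [x], so [h ^+ p] is a commutator of [x ^+ p] and vanishes. *)
Lemma isolated_comm M x y p : isolated M -> G x -> G y -> (0 < p)%N ->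
  M [~ x ^+ p, y] -> M [~ x, y].
Proof.
move=> [M_nor Mroot] Gx Gy p_gt0 xpy; have [G1 GM GV] := G_sub.
have [[M1 MM MV] Mn] := M_nor; have [c Gc] := G_nil.
pose h i := iter i (fun z => [~ x, z]) y.
have h_lc i : grp_lower_central G i (h i).
  by elim: i => //= i IHi; apply: grp_commutator_in.
have Gh i := grp_lower_central_sub G_sub (h_lc i).
have Gxp : G (x ^+ p) by apply: subgroup_expg.
have xph i : M [~ x ^+ p, h i].
  have C := centralizer_mod_subgroup G_sub M_nor Gxp.
  suff : [set z | G z /\ M [~ x ^+ p, z]] (h i) by case.
  elim: i => [|i IHi]; first by split.
  apply: subgroup_comm => //; split=> //.
  by rewrite -invgR commgXg invg1.
suff down i : M (h i.+2) -> M (h i.+1).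
  have : M (h c.+1).
    have hc1 : h c = 1 by have := h_lc c; rewrite Gc.
    by rewrite /h iterS -/(h c) hc1 commg1.
  by elim: c {Gc} => // c IHc hc; apply/IHc/down.
move=> hi2; have [m Mm e] := comm_expg_mod G_sub M_nor p Gx (Gh i) hi2.
apply: (Mroot _ p) => //; have -> : h i.+1 ^+ p = [~ x ^+ p, h i] * m^-1.
  by rewrite e mulgK.
by apply: MM => //; apply: MV.
Qed.

Definition isolator A := smallest isolated A.

Lemma isolator_isolated A : isolated (isolator A).
Proof.
split; first split.
- split=> [M [[[[]]]]//|x y hx hy M hM|x hx M hM];
    have [[[[M1 MM MV] _] _] _] := hM.
    by apply: MM; [apply: hx | apply: hy].
  by apply: MV; apply: hx.
- by move=> x y hx Gy M hM; have [[[_ Mn] _] _] := hM; apply: Mn => //; apply: hx.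
move=> x p Gx p0 hx M hM; have [[_ Mr] _] := hM.
by apply: (Mr x p) => //; apply: hx.
Qed.

Lemma isolator_in A x : A x -> isolator A x.
Proof. by move=> Ax M [_]; apply. Qed.

Lemma isolator_sub A M : isolated M -> A `<=` M -> isolator A `<=` M.
Proof. by move=> hM sAM; apply: smallest_sub. Qed.

Lemma whole_isolated : isolated G.
Proof.
split=> //; split=> // x y Gx Gy; have [_ GM GV] := G_sub.
by rewrite conjgE; apply: (GM _ _ (GV _ Gy)); apply: GM.
Qed.

(** Closure under roots is [isolated_comm]: if a power of [x] commutes with [B] modulo [M], so does
    [x]. *)
Lemma centralizer_mod_isolated M B : isolated M -> B `<=` G ->
  (forall x y, B x -> G y -> B (x ^ y)) ->
  isolated [set x | G x /\ forall y, B y -> M [~ x, y]].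
Proof.
move=> hM sBG Bn; have [G1 GM GV] := G_sub; case: (hM) => M_nor Mroot.
have [[M1 MM MV] Mn] := M_nor.
have sym x y : M [~ x, y] -> M [~ y, x] by rewrite -[ [~ y, x] ]invgR; apply: MV.
split; [split; first split|].
- split=> // y By; apply: sym; rewrite commg1; exact: M1.
- move=> x x' [Gx hx] [Gx' hx']; split; first exact: GM.
  move=> y By; have [_ CM _] := centralizer_mod_subgroup G_sub M_nor (sBG _ By).
  have [] := CM x x'; [split=> //|split=> //|move=> _ h]; apply: sym => //.
    exact: hx.
  exact: hx'.
- move=> x [Gx hx]; split; first exact: GV.
  move=> y By; have [_ _ CV] := centralizer_mod_subgroup G_sub M_nor (sBG _ By).
  have [] := CV x; [split=> //|move=> _ h]; apply: sym => //.
  exact: hx.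
- move=> x z [Gx hx] Gz; split; first exact: (proj1 whole_isolated).2.
  move=> y By; have -> : y = (y ^ z^-1) ^ z by rewrite conjgKV.
  by rewrite -conjRg; apply: Mn => //; apply/hx/Bn/GV.
move=> x p Gx p0 [_ hx]; split=> // y By.
by apply: (isolated_comm hM Gx (sBG _ By) p0); apply: hx.
Qed.

(** One entry at a time: the elements commuting with [A] modulo the isolated target form an isolated
    subgroup containing [A], hence its isolator; then the same with [A] replaced by its isolator. *)
Lemma isolator_comm A : A `<=` G -> (forall x y, A x -> G y -> A (x ^ y)) ->
  grp_commutator (isolator A) (isolator A) `<=` isolator (grp_commutator A A).
Proof.
move=> sAG An; have hM := isolator_isolated (grp_commutator A A).
have [[M_sub _] _] := hM.
have sIG : isolator A `<=` G := isolator_sub whole_isolated sAG.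
have [[I_sub In] _] := isolator_isolated A.
pose C B := [set x | G x /\ forall y, B y -> isolator (grp_commutator A A) [~ x, y]].
have sym x y : isolator (grp_commutator A A) [~ x, y] ->
    isolator (grp_commutator A A) [~ y, x].
  by case: M_sub => _ _ MV /MV; rewrite invgR.
have h1 : isolator A `<=` C A.
  apply: isolator_sub; first exact: (centralizer_mod_isolated hM sAG An).
  move=> u Au; split; first exact: sAG.
  by move=> v Av; apply: isolator_in; apply: grp_commutator_in.
have h2 : isolator A `<=` C (isolator A).
  apply: isolator_sub; first exact: (centralizer_mod_isolated hM sIG In).
  move=> u Au; split; first exact: sAG.
  by move=> v /h1[_ hv]; apply: sym; apply: hv.
by apply: grp_commutator_sub => // x y /h2[_ hx] Iy; apply: hx.
Qed.

Lemma derived_isolator H m : H `<=` G -> is_subgroup H ->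
  (forall x y, H x -> G y -> H (x ^ y)) -> G `<=` isolator H ->
  grp_derived G m `<=` isolator (grp_derived H m).
Proof.
move=> sHG H_sub Hn sGI; elim: m => [|m IHm] //=.
apply: (subset_trans (grp_commutatorS IHm IHm)); apply: isolator_comm.
  exact: subset_trans (grp_derived_sub H_sub) sHG.
by move=> x y hx Gy; apply: grp_derived_conj hx => z Hz; apply: Hn.
Qed.

Definition torsion : set Gam := [set x | G x /\ exists2 p, (0 < p)%N & x ^+ p = 1].

Lemma grp_lower_central_normal A m : is_subgroup A ->
  normal_in A (grp_lower_central A m).
Proof.
move=> A_sub; split; first exact: grp_lower_central_subgroup.
have [A1 AM AV] := A_sub.
have AJ x y : A x -> A y -> A (x ^ y).
  by move=> Ax Ay; rewrite conjgE; apply: (AM _ _ (AV _ Ay)); apply: AM.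
elim: m => [|m IHm] x y; first exact: AJ.
move=> + Ay; apply: (@grp_commutator_sub _ _ _ (fun x => grp_lower_central A m.+1 (x ^ y))).
  have [c1 cM cV] := grp_commutator_subgroup A (grp_lower_central A m).
  split=> [|u v hu hv|u hu]; rewrite ?conj1g ?conjMg ?conjVg //.
    exact: cM.
  exact: cV.
move=> u v Au hv; rewrite conjRg; apply: grp_commutator_in; first exact: AJ.
exact: IHm.
Qed.

(* In the lower central series of the group generated by [x] and [y], all
   factors are abelian of exponent dividing [p * q]. *)
Lemma torsion_mul x y p q : G x -> G y -> x ^+ p = 1 -> y ^+ q = 1 ->
  exists c, (x * y) ^+ ((p * q) ^ c) = 1.
Proof.
move=> Gx Gy xp yq; pose S := generated [set z | z = x \/ z = y].
have S_sub : is_subgroup S := generated_subgroup _.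
have sSG : S `<=` G by apply: generated_sub => // z [->|->].
have [c Sc] := grp_nilpotentS S_sub sSG G_nil.
have Sx : S x by apply: generated_in; left.
have Sy : S y by apply: generated_in; right.
have [S1 SM SV] := S_sub.
pose g := grp_lower_central S.
have g_nor i : normal_in S (g i) := grp_lower_central_normal i S_sub.
have gS i : g i `<=` S by apply: grp_lower_central_sub.
have pow_subgroup i : is_subgroup [set z | g i z /\ g i.+1 (z ^+ (p * q))].
  have [[g1 gM gV] gn] := g_nor i; have [[h1 hM hV] hn] := g_nor i.+1.
  split=> [|u v [gu hu] [gv hv]|u [gu hu]].
  - by rewrite /= expg1n.
  - split; first exact: gM.
    have vu : g i.+1 [~ v, u] by apply: grp_commutator_in => //; apply: gS gv.
    have [m hm ->] := expgM_mod S_sub (g_nor i.+1) (p * q) (gS _ _ gu) (gS _ _ gv) vu.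
    by apply: (hM) => //; apply: hM.
  by split; [apply: gV | rewrite expVgn; apply: hV].
have pow i z : g i z -> g i.+1 (z ^+ (p * q)).
  elim: i z => [|i IHi] z gz.
    suff : [set z | g 0%N z /\ g 1%N (z ^+ (p * q))] z by case.
    apply: generated_sub gz => // w.
    have [[g1 gM gV] _] := g_nor 1%N.
    case=> ->; split=> //; first by rewrite expgnA xp expg1n.
    by rewrite mulnC expgnA yq expg1n.
  suff : [set z | g i.+1 z /\ g i.+2 (z ^+ (p * q))] z by case.
  apply: (grp_commutator_sub (pow_subgroup i.+1) _ gz) => u v Su gv.
  have Sv := gS _ _ gv; split; first exact: grp_commutator_in.
  have [[h1 hM hV] hn] := g_nor i.+2; have [[g1 gM gV] _] := g_nor i.+1.
  have vu : g i.+1 [~ v, u] by rewrite -invgR; apply: gV; apply: grp_commutator_in.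
  have [|m hm e] := comm_expg_mod S_sub (g_nor i.+2) (p * q) Sv Su.
    exact: grp_commutator_in.
  rewrite -invgR expVgn; apply: (hV).
  have -> : [~ v, u] ^+ (p * q) = [~ v ^+ (p * q), u] * m^-1 by rewrite e mulgK.
  apply: (hM); last exact: hV.
  by rewrite -invgR; apply: hV; apply: grp_commutator_in => //; apply: IHi.
exists c; have : g c ((x * y) ^+ ((p * q) ^ c)).
  elim: c {Sc} => [|c IHc]; first by rewrite expn0 expg1; apply: SM.
  by rewrite expnS mulnC expgnA; apply: pow.
by rewrite /g Sc.
Qed.

Lemma torsion_isolated : isolated torsion.
Proof.
have [G1 GM GV] := G_sub; split; first split; first split.
- by split=> //; exists 1%N.
- move=> x y [Gx [p p0 xp]] [Gy [q q0 yq]]; split; first exact: GM.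
  have [c e] := torsion_mul Gx Gy xp yq; exists ((p * q) ^ c)%N => //.
  by rewrite expn_gt0 muln_gt0 p0 q0.
- move=> x [Gx [p p0 xp]]; split; first exact: GV.
  by exists p => //; rewrite expVgn xp invg1.
- move=> x y [Gx [p p0 xp]] Gy; split; first exact: (proj1 whole_isolated).2.
  by exists p => //; rewrite -conjXg xp conj1g.
move=> x p Gx p0 [_ [q q0 e]]; split=> //; exists (p * q)%N.
  by rewrite muln_gt0 p0.
by rewrite expgnA.
Qed.

(** Having all its [k]-th powers in [H], the group [G] lies in the isolator of [H], so [G^(m)] lies
    in that of the trivial group [H^(m)]; torsion is isolated and contains it. *)
Lemma derived_torsion k m : (0 < k)%N ->
  grp_derived (generated [set x ^+ k | x in G]) m `<=` [set 1] ->
  grp_derived G m `<=` torsion.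
Proof.
move=> k0; set H := generated _ => Hm.
have H_sub : is_subgroup H := generated_subgroup _.
have sHG : H `<=` G.
  by apply: generated_sub => // _ [x Gx <-]; apply: subgroup_expg.
have Hn x y : H x -> G y -> H (x ^ y).
  move=> + Gy; apply: (@generated_sub _ _ (fun x => H (x ^ y))).
    have [H1 HM HV] := H_sub.
    split=> [|u v hu hv|u hu]; rewrite ?conj1g ?conjMg ?conjVg //.
      exact: HM.
    exact: HV.
  move=> _ [z Gz <-]; rewrite conjXg; apply: generated_in.
  by exists (z ^ y) => //; apply: (proj1 whole_isolated).2.
have sGI : G `<=` isolator H.
  move=> x Gx; have [_ Ir] := isolator_isolated H; apply: (Ir x k) => //.
  by apply: isolator_in; apply: generated_in; exists x.
apply: (subset_trans (derived_isolator (m := m) sHG H_sub Hn sGI)).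
apply: isolator_sub; first exact: torsion_isolated.
by move=> x /Hm ->; have [[[T1 _ _] _] _] := torsion_isolated.
Qed.

End Isolators.

(** * The bound for groups *)

Lemma unipotent_torsion (K : numFieldType) D (A : 'M[K]_D.+1) M p :
  (A - 1) ^+ M = 0 -> (0 < p)%N -> A ^+ p = 1 -> A = 1.
Proof.
move=> AM p_gt0 Ap; have [E hE] := flow_exists AM; apply/matrixP => a b.
pose e := poly_entry a b E.
have he j : e.[j%:R] = (A ^+ j) a b by rewrite horner_poly_entry hE.
have p0 : p%:R != 0 :> K by rewrite pnatr_eq0 -lt0n.
have c : e \Po (p%:R *: 'X) = (1 : 'M[K]_D.+1)%R a b *: 1.
  apply: poly_nat_inj => j; rewrite horner_comp !hornerE -natrM he exprM Ap expr1n.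
  by [].
(* The entry [e] is constant along multiples of [p], hence as a polynomial; the point [1 / p]
   recovers its value at time 1. *)
have := congr1 (fun q : {poly K} => q.[p%:R^-1]) c.
rewrite horner_comp !hornerE mulfV // -[1]/(1%:R) he expr1 => ->.
by [].
Qed.

Lemma tangent_torsion_free (K : numFieldType) n (g : fdiff K n) p :
  linear_part g = 1%:M -> (0 < p)%N -> (g ^+ p = 1)%g -> g = 1%g.
Proof.
move=> lg p_gt0 gp.
have g_unip : jet_unipotent g.
  by apply: (unipotent_jet_unipotent (k := 1)); rewrite lg subrr.
apply: fdiff_mx_inj => N; rewrite fdiff_mx1; have [M gM] := g_unip N.
apply: (unipotent_torsion gM p_gt0).
by rewrite -fdiff_mxX gp fdiff_mx1.
Qed.

Lemma nilpotent_derived (K : numClosedFieldType) n (G : set (fdiff K n)) :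
  (0 < n)%N -> is_subgroup G -> grp_nilpotent G -> grp_derived G n = [set 1%g].
Proof.
move=> n_gt0 G_sub G_nil; apply/seteqP; split=> [x xn|_ ->]; last first.
  by case: (grp_derived_subgroup n G_sub).
have lin_rep : mx_rep G (fun g => linear_part (fdiff_val g)).
  by split=> [|g h _ _]; [apply: linear_part1 | apply: linear_partM].
have lx := linear_nilpotent_derived G_sub G_nil lin_rep xn.
have [k [P [k_gt0 uP tP]]] := linear_nilpotent_trig G_sub G_nil lin_rep.
pose H := generated [set (g ^+ k)%g | g in G].
have H_sub : is_subgroup H := generated_subgroup _.
have sHG : H `<=` G.
  by apply: generated_sub => // _ [g Gg <-]; apply: subgroup_expg.
have H_trig h : H h -> trig_in P (linear_part h).
  apply: (@generated_sub _ _ [set h | trig_in P (linear_part (fdiff_val h))]).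
    split=> [|g h' tg th|g tg] /=.
    - by rewrite linear_part1; apply: trig_in1.
    - by rewrite linear_partM; apply: trig_inM.
    apply: trig_inV tg _ => //; rewrite -linear_partM mulgV; apply: linear_part1.
  by move=> _ [g Gg <-]; apply: tP.
have H_nil := grp_nilpotentS H_sub sHG G_nil.
have Hn : grp_derived H n `<=` [set 1%g].
  by move=> h; apply: (triangular_derived n_gt0 uP H_sub H_nil H_trig).
have [_ [p p_gt0 xp]] := derived_torsion G_sub G_nil k_gt0 Hn xn.
exact: tangent_torsion_free lx p_gt0 xp.
Qed.

Theorem theorem1p12 (R : realType) (n : nat) (n_ge1 : (1 <= n)%N) :
  (forall l : set (fvfield R[i] n),
     is_lie_subalgebra l -> lie_nilpotent l ->
     length_le (lie_soluble_length l) n) /\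
  (forall G : set (fdiff R[i] n),
     is_subgroup G -> grp_nilpotent G ->
     length_le (grp_soluble_length G) n).
Proof.
split=> [l|G]; first exact: lie_nilpotent_length.
by move=> G_sub G_nil; apply: min_nat_le (leqnn n); apply: nilpotent_derived.
Qed.
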